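(* Let $\alpha,\beta,\gamma,\kappa>0$ be arbitrary real numbers, put $\mu:=\beta-\alpha\gamma/\kappa$, and let $\mathcal{E}_{\alpha,\beta}^{\gamma,\kappa}$ be the positive-axis realization defined in the context. Then $\mathcal{E}_{\alpha,\beta}^{\gamma,\kappa}$ is completely monotone on $(0,\infty)$ if and only if $$\alpha\leq\kappa\quad\text{and}\quad\kappa\beta\geq\alpha\gamma .$$ Whenever these two inequalities hold (the admissible case), $\mathcal{E}_{\alpha,\beta}^{\gamma,\kappa}$ is strictly completely monotone, and its Bernstein measure $M$ is as follows. (i) If $0<\alpha<\kappa$ and $\mu\geq 0$, then $M$ is absolutely continuous with density $K_{\alpha,\beta}^{\gamma,\kappa}$ on $(0,\infty)$ (defined in the context), and this density is strictly positive on $(0,\infty)$. (ii) If $\alpha=\kappa$ and $\beta>\gamma$, then $M$ is absolutely continuous with density $$K_{=}(u)=\frac{u^{\gamma/\kappa-1}\,(1-u^{1/\kappa})^{\beta-\gamma-1}}{\kappa\,\Gamma(\gamma)\,\Gamma(\beta-\gamma)}\,\mathbf{1}_{(0,1)}(u).$$ (iii) If $\alpha=\kappa$ and $\beta=\gamma$, then $M=\frac{1}{\Gamma(\gamma)}\,\delta_1$, and $\mathcal{E}_{\kappa,\gamma}^{\gamma,\kappa}(x)=\dfrac{e^{-x}}{\Gamma(\gamma)}$. In every admissible case $M$ has total mass $1/\Gamma(\beta)$; consequently every admissible realization extends continuously to zero and has value $1/\Gamma(\beta)$ there.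
   Context: Complete monotonicity: a smooth $f:(0,\infty)\to\mathbb{R}$ is completely monotone on $(0,\infty)$ if $(-1)^n f^{(n)}(x)\geq 0$ for all integers $n\geq 0$ and all $x>0$; it is strictly completely monotone if $(-1)^n f^{(n)}(x)>0$ for all $n\geq 0$ and $x>0$. The Bernstein measure of a completely monotone $f$ is the unique positive Borel measure $M$ on $[0,\infty)$ with $f(x)=\int_{[0,\infty)}e^{-xu}\,M(\mathrm{d}u)$ for all $x>0$. Wright function: for real $\lambda>-1$ and $\nu,z\in\mathbb{C}$, $$W_{\lambda,\nu}(z)=\sum_{n=0}^{\infty}\frac{z^n}{n!\,\Gamma(\lambda n+\nu)},$$ with the convention $1/\Gamma(w)=0$ for $w\in\{0,-1,-2,\dots\}$; this is an entire function of $z$. Positive-axis realization: for $0<\alpha<\kappa$ define $$K_{\alpha,\beta}^{\gamma,\kappa}(u)=\frac{u^{\gamma/\kappa-1}}{\kappa\,\Gamma(\gamma)}\,W_{-\alpha/\kappa,\,\mu}\bigl(-u^{1/\kappa}\bigr)\quad(u>0),\qquad \mathcal{E}_{\alpha,\beta}^{\gamma,\kappa}(x)=\int_0^\infty e^{-xu}K_{\alpha,\beta}^{\gamma,\kappa}(u)\,\mathrm{d}u\quad(x\geq 0),$$ where $\mu=\beta-\alpha\gamma/\kappa$ (the kernel is absolutely integrable for every real $\mu$ but need not be nonnegative). For $\alpha\geq\kappa$ define instead $$\mathcal{E}_{\alpha,\beta}^{\gamma,\kappa}(x)=E_{\alpha,\beta}^{\gamma,\kappa}(-x),\qquad E_{\alpha,\beta}^{\gamma,\kappa}(z)=\sum_{n=0}^{\infty}\frac{\Gamma(\gamma+\kappa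 n)}{\Gamma(\gamma)\,n!\,\Gamma(\beta+\alpha n)}\,z^n,$$ the series being entire in that case. Here $\delta_1$ is the Dirac measure at $1$ and $\mathbf{1}_{(0,1)}$ the indicator function of $(0,1)$. *)

(* Defs.v *)
From mathcomp Require Import all_boot all_order all_algebra.
From mathcomp Require Import all_classical all_reals all_analysis.
Set Implicit Arguments.
Unset Strict Implicit.
Unset Printing Implicit Defensive.
Import Order.TTheory GRing.Theory Num.Theory.
Import numFieldNormedType.Exports.
Local Open Scope classical_set_scope.
Local Open Scope ring_scope.

Section special_functions.
Context {R : realType}.
Implicit Types (x z lambda nu alpha beta gamma kappa u : R).

Definition euler_integral x : R :=
  \int[lebesgue_measure]_(t in `]0%R, +oo[) (t `^ (x - 1) * expR (- t)).

(* For [x <= 0] this is Gamma (x + n) / (x (x + 1) ... (x + n - 1)) with [n] the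
   least natural number such that [0 < x + n].  At the poles 0, -1, -2, ... the
   denominator is 0, so that [Gamma x = 0] and also [(Gamma x)^-1 = 0], which is
   the usual convention for the reciprocal Gamma function. *)
Definition Gamma x : R :=
  if 0 < x then euler_integral x
  else let n := (Num.truncn (- x)).+1 in
       euler_integral (x + n%:R) / \prod_(i < n) (x + i%:R).

(* The Wright function at real parameter [nu] and real argument [z]; the series
   converges for [-1 < lambda]. *)
Definition Wright lambda nu z : R :=
  limn (series (fun n => z ^+ n / (n`!%:R * Gamma (lambda * n%:R + nu)))).

Definition kernelK alpha beta gamma kappa u : R :=
  u `^ (gamma / kappa - 1) / (kappa * Gamma gamma) *
  Wright (- (alpha / kappa)) (beta - alpha * gamma / kappa)
    (- (u `^ kappa^-1)).

(* The four-parameter Mittag-Leffler series, for [kappa <= alpha]. *)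
Definition ML_series alpha beta gamma kappa z : R :=
  limn (series (fun n => Gamma (gamma + kappa * n%:R) /
    (Gamma gamma * n`!%:R * Gamma (beta + alpha * n%:R)) * z ^+ n)).

(* Only the values at [0 <= x] are meaningful. *)
Definition realization alpha beta gamma kappa x : R :=
  if alpha < kappa then
    \int[lebesgue_measure]_(u in `]0%R, +oo[)
      (expR (- (x * u)) * kernelK alpha beta gamma kappa u)
  else ML_series alpha beta gamma kappa (- x).

Definition kernel_eq beta gamma kappa u : R :=
  u `^ (gamma / kappa - 1) * (1 - u `^ kappa^-1) `^ (beta - gamma - 1) /
  (kappa * Gamma gamma * Gamma (beta - gamma)) * \1_(`]0%R, 1%R[) u.

End special_functions.

Section complete_monotonicity.
Context {R : realType}.
Implicit Types (f : R -> R) (M : {measure set (measurableTypeR R) -> \bar R}).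

Definition smooth_pos f : Prop :=
  forall (n : nat) (x : R), 0 < x -> derivable (derive1n n f) x 1.

Definition completely_monotone f : Prop :=
  smooth_pos f /\
  forall (n : nat) (x : R), 0 < x -> 0 <= (-1) ^+ n * derive1n n f x.

Definition strictly_completely_monotone f : Prop :=
  smooth_pos f /\
  forall (n : nat) (x : R), 0 < x -> 0 < (-1) ^+ n * derive1n n f x.

(* A Borel measure on [0, +oo[ is encoded as a Borel measure on the line that
   vanishes on the negative half-line. *)
Definition laplace_represents f M : Prop :=
  M `]-oo, 0%R[%classic = 0%E /\
  forall x : R, 0 < x ->
    (f x)%:E = (\int[M]_(u in `[0%R, +oo[) (expR (- (x * u)))%:E)%E.

Definition bernstein_measure f M : Prop :=
  laplace_represents f M /\
  forall N : {measure set (measurableTypeR R) -> \bar R},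
    laplace_represents f N -> forall A, measurable A -> N A = M A.

(* Taking [A] to be the complement of ]0, +oo[ shows that [M] lives on
   ]0, +oo[; in particular it has no atom at 0. *)
Definition has_density_pos M f : Prop :=
  measurable_fun (`]0%R, +oo[ : set (measurableTypeR R)) f /\
  forall A : set (measurableTypeR R), measurable A ->
    M A = (\int[lebesgue_measure]_(u in A `&` `]0%R, +oo[) (f u)%:E)%E.

End complete_monotonicity.

(* Main.v *)
From HB Require Import structures.
Require Import Defs.
From mathcomp Require Import all_boot all_order all_algebra.
From mathcomp Require Import all_classical all_reals all_analysis.
From mathcomp Require Import ring lra.
From mathcomp Require Import measurable_realfun.

(** The theorem is a dichotomy between an explicit positive measure and an
    obstruction by growth or by sign. Put rho = alpha / kappa and write W mu t for
    the Wright function of parameters - rho and mu at - t.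

    Admissible case. If f x is the integral of e^(-x u) against a nonzero finite
    measure M on ]0, +oo[, differentiation under the integral gives strict
    complete monotonicity, and the total mass of M is the limit at 0
    (positive_bernstein_measure). M is the only representing measure: the
    exponential series of exp (- c e^(-n u)) integrates termwise to values of f,
    and for c = n e^(n a) these functions tend to the indicator of ]a, +oo[
    (laplace_unique). So a density, its positivity and its mass are what is left.

    For alpha < kappa the density is a power of u times W mu (u^(1/kappa)) with
    mu >= 0. The Laplace transform of a rescaled Wright function is
    lam^(-mu) e^(-t lam^rho) in lam, and its Post-Widder inversion gives
    approximants e^(-y) P_N y whose polynomials P_N have nonnegative coefficients
    (approx_coef_ge0) and whose power series have coefficients that are Gauss
    products converging to 1 / Gamma (mu - rho k) (wright_approxE, gauss_cvg).
    Tannery's theorem makes them converge to W mu, which is therefore nonnegative.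
    Their Mellin transforms are again Gauss products, whence
    int t^(s-1) W mu t dt = Gamma s / Gamma (mu + rho s). The relation
    W mu t = mu W (mu + 1) t + rho t W (mu + 1 - rho) t extends this to every real
    mu (mellin_wright), and with the growth of the Mellin transform it excludes
    zeros when mu >= 0 (wright_gt0). At s = gamma it gives the total mass
    1 / Gamma beta. For alpha = kappa and gamma < beta the moments of the beta
    kernel are those of the series (moment_kernel_eq), and for beta = gamma the
    series is that of e^(-x) / Gamma gamma.

    Necessity for alpha < kappa and mu < 0. If the realization E is nonnegative,
    so is int x^(s-1) E x dx, which by Tonelli's theorem, applied to the positive
    and negative parts of the kernel K, has the sign of int u^(-s) K u du, that is
    of 1 / Gamma (beta - alpha s) (mellin_kernelK_ge0). It is negative for
    beta - alpha s in ]-1, 0[.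

    Necessity for alpha >= kappa. Here E is entire, and complete monotonicity makes
    all Taylor coefficients of y |-> E (- y) nonnegative at every y < 0. Jensen's
    inequality for these weights bounds E (- y) below by an exponential of rate
    m 1 / m 0, where m n are the moments, so this rate is at most the exponential
    type of E (completely_monotone_growth); the same holds for all derivatives.
    The type is 0 for alpha > kappa, which is absurd, and at most 1 for
    alpha = kappa; the m n are then nonincreasing, and they are unbounded when
    beta < gamma. *)

Set Implicit Arguments.
Unset Strict Implicit.
Unset Printing Implicit Defensive.
Import Order.TTheory GRing.Theory Num.Theory.
Import numFieldNormedType.Exports.
Local Open Scope classical_set_scope.
Local Open Scope ring_scope.

(** * Measures with a density *)
Section density_measure.
Local Open Scope ereal_scope.
Context d (T : measurableType d) (R : realType).
Variables (m : {measure set T -> \bar R}) (g : T -> R).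

(** The proofs are parameters so that the measure structure below attaches to
    this constant. *)
Definition density_measure of measurable_fun [set: T] g & (forall x, (0 <= g x)%R) :=
  fun A => \int[m]_(x in A) (g x)%:E.

Hypothesis mg : measurable_fun [set: T] g.
Hypothesis g0 : forall x, (0 <= g x)%R.
Local Notation nu := (density_measure mg g0).

Let nu0 : nu set0 = 0.
Proof. by rewrite /density_measure integral_set0. Qed.

Let nu_ge0 A : 0 <= nu A.
Proof. by apply: integral_ge0 => x _; rewrite lee_fin. Qed.

Let nu_sigma_additive : semi_sigma_additive nu.
Proof.
move=> F mF tF mUF; rewrite /density_measure; apply: cvg_toP.
  apply: ereal_nondecreasing_is_cvgn => k l kl.
  by apply: lee_sum_nneg_natr => // i _ _; apply: integral_ge0 => x _; rewrite lee_fin.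
rewrite ge0_integral_bigcup//=.
- exact/measurable_funTS/measurable_EFinP.
- by move=> x _; rewrite lee_fin.
Qed.

HB.instance Definition _ := isMeasure.Build _ _ _ nu nu0 nu_ge0 nu_sigma_additive.

Import HBNNSimple.

(** Both sides commute with increasing limits, so simple functions suffice. *)
Lemma ge0_integral_density D (f : T -> \bar R) :
  measurable D -> measurable_fun D f -> (forall x, D x -> 0 <= f x) ->
  \int[nu]_(x in D) f x = \int[m]_(x in D) (f x * (g x)%:E).
Proof.
move=> mD mf f0; pose f_ := nnsfun_approx mD mf.
have mgD : measurable_fun D (EFin \o g) by apply/measurable_EFinP; exact: measurable_funTS.
have mfn n : measurable_fun D (EFin \o f_ n).
  by apply/measurable_EFinP; exact: measurable_funTS.
transitivity (limn (fun n => \int[nu]_(x in D) (f_ n x)%:E)).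
  rewrite -monotone_convergence//=.
  - by apply: eq_integral => x /[!inE] xD; apply/esym/cvg_lim => //=; exact: cvg_nnsfun_approx.
  - by move=> n x _; rewrite lee_fin.
  - by move=> x _ a b ab; rewrite lee_fin//; exact/lefP/nd_nnsfun_approx.
transitivity (limn (fun n => \int[m]_(x in D) ((f_ n x)%:E * (g x)%:E))); last first.
  rewrite -monotone_convergence//=.
  - apply: eq_integral => x /[!inE] xD; apply/cvg_lim => //=.
    by apply: cvgeMr => //; exact: cvg_nnsfun_approx.
  - by move=> n; apply: emeasurable_funM; [exact: mfn|exact: mgD].
  - by move=> n x _; rewrite mule_ge0// lee_fin.
  - move=> x _ a b ab; rewrite lee_wpmul2r ?lee_fin//.
    exact/lefP/nd_nnsfun_approx.
congr (limn _); apply/funext => n.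
transitivity (\int[nu]_(x in D)
   (\sum_(k \in range (f_ n)) (k * \1_(f_ n @^-1` [set k]) x)%:E)).
  by apply: eq_integral => x _; rewrite [in LHS]fimfunE -fsumEFin.
rewrite ge0_integral_fsum//; last 2 first.
- by move=> y; exact/measurable_EFinP/measurable_funM.
- by move=> y x _; rewrite nnfun_muleindic_ge0.
transitivity (\int[m]_(x in D)
   (\sum_(k \in range (f_ n)) (k * \1_(f_ n @^-1` [set k]) x)%:E * (g x)%:E)).
  rewrite ge0_integral_fsum//; last 2 first.
  - move=> y; apply: emeasurable_funM => //.
    exact/measurable_EFinP/measurable_funM.
  - by move=> y x _; rewrite mule_ge0 ?lee_fin// -lee_fin EFinM nnfun_muleindic_ge0.
  apply: eq_fsbigr => r _.
  rewrite integralZl_indic_nnsfun// integral_indic//= /density_measure.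
  have [r0|r0] := ltP r 0%R.
    rewrite preimage_nnfun0// set0I integral_set0 mule0 integral0_eq//.
    by move=> x _; rewrite indic0 mulr0 mul0e.
  rewrite setIC integral_mkcondr/=.
  rewrite -ge0_integralZl//=; last 2 first.
  - have mr : measurable (f_ n @^-1` [set r]) by exact: measurable_sfunP.
    apply: measurable_funTS; apply: (measurable_restrictT _ mr).1.
    exact/measurable_funTS/measurable_EFinP.
  - by move=> x _; rewrite erestrict_ge0// => y _; rewrite lee_fin.
  apply: eq_integral => x _; rewrite EFinM -muleA; congr (_ * _).
  by rewrite indicE patchE; case: ifPn => _ /=; rewrite ?mul1e ?mul0e.
apply: eq_integral => x _; rewrite [in RHS]fimfunE -fsumEFin// ge0_mule_fsuml//.
by move=> i; rewrite EFinM nnfun_muleindic_ge0.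
Qed.

End density_measure.

(** * Integration on the positive half-line *)
Section ftc_pos.
Context {R : realType}.
Implicit Types (f F : R -> R) (x : R).
Local Notation mu := (@lebesgue_measure R).

Lemma bigcup_itv_inv_y : \bigcup_n `[n.+1%:R^-1 : R, +oo[%classic = `]0, +oo[%classic.
Proof.
apply/seteqP; split => [x [n _]|x] /=; rewrite !in_itv/= !andbT.
  by apply: lt_le_trans; rewrite invr_gt0 ltr0n.
move=> x0; exists (Num.truncn x^-1) => //=; rewrite in_itv/= andbT.
rewrite -[leRHS]invrK lef_pV2 ?posrE ?invr_gt0 ?ltr0n//.
exact/ltW/truncnS_gt.
Qed.

Lemma bigcup_itv_inv_S :
  \bigcup_n `[n.+1%:R^-1 : R, n.+2%:R]%classic = `]0, +oo[%classic.
Proof.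
apply/seteqP; split => [x [n _]|x] /=; rewrite !in_itv/= ?andbT.
  by move=> /andP[+ _]; apply: lt_le_trans; rewrite invr_gt0 ltr0n.
move=> x0; exists (maxn (Num.truncn x^-1) (Num.truncn x)) => //=.
rewrite in_itv/=; apply/andP; split.
  rewrite -[leRHS]invrK lef_pV2 ?posrE ?invr_gt0 ?ltr0n//.
  by apply: (le_trans (ltW (truncnS_gt _))); rewrite ler_nat ltnS leq_maxl.
apply: (le_trans (ltW (truncnS_gt _))); rewrite ler_nat.
by rewrite ltnS (leq_trans (leq_maxr (Num.truncn x^-1) _)).
Qed.

(** The half-line is exhausted by rays starting at 1 / n, since f need not
    extend continuously to 0. *)
Lemma ge0_FTC_itv0y f F (l0 l1 : R) :
  (forall x, 0 < x -> 0 <= f x) ->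
  (forall x : R, 0 < x -> {for x, continuous f}) ->
  (forall x : R, 0 < x -> is_derive x (1 : R) F (f x)) ->
  F x @[x --> 0^'+] --> l0 -> F x @[x --> +oo] --> l1 ->
  (\int[mu]_(x in `]0%R, +oo[) (f x)%:E = (l1 - l0)%:E)%E.
Proof.
move=> f0 cf dF F0 F1.
have dFx x : 0 < x -> derivable F x 1 by move=> /dF[].
have cF x : 0 < x -> {for x, continuous F}.
  by move=> /dFx ?; apply/differentiable_continuous/derivable1_diffP.
have mf : measurable_fun (`]0%R, +oo[ : set R) f.
  apply: open_continuous_measurable_fun => // x.
  by rewrite inE/= in_itv/= andbT; exact: cf.
have E n : (\int[mu]_(x in `[(n.+1%:R^-1 : R)%R, +oo[) (f x)%:E =
    (l1 - F n.+1%:R^-1)%:E)%E.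
  have n0 : 0 < n.+1%:R^-1 :> R by rewrite invr_gt0 ltr0n.
  rewrite (@ge0_continuous_FTC2y _ f F _ l1)//.
  - by move=> x nx; apply: f0; exact: lt_le_trans nx.
  - apply/continuous_within_itvcyP; split.
      move=> x; rewrite in_itv/= andbT => nx.
      by apply: cf; exact: lt_trans nx.
    by apply: cvg_at_right_filter; exact: cf.
  - by move=> x nx; apply: dFx; exact: lt_trans nx.
  - by apply: cvg_at_right_filter; exact: cF.
  - move=> x; rewrite in_itv/= andbT => nx.
    rewrite derive1E; have [_ ->//] := dF x (lt_trans n0 nx).
have nd : nondecreasing_seq (fun n => `[(n.+1%:R^-1 : R), +oo[%classic).
  move=> m n mn; apply/subsetPset => x /=; rewrite !in_itv/= !andbT.
  by apply: le_trans; rewrite lef_pV2 ?posrE ?ltr0n// ler_nat.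
have := @ge0_nondecreasing_set_cvg_integral _ (measurableTypeR R) R
  (fun n => `[(n.+1%:R^-1 : R), +oo[%classic) (EFin \o f) mu nd.
rewrite bigcup_itv_inv_y => H.
have H1 : (l1 - F n.+1%:R^-1)%:E @[n --> \oo] --> (l1 - l0)%:E.
  apply: cvg_EFin; first exact: nearW.
  apply: cvgB; first exact: cvg_cst.
  move/cvg_at_rightP : F0; apply; split.
    by move=> n; rewrite invr_gt0 ltr0n.
  exact: cvg_harmonic.
apply: (cvg_unique _ _ H1) => //.
rewrite (_ : (fun n => _) = (fun n => \int[mu]_(x in `[n.+1%:R^-1%R, +oo[) (f x)%:E)%E); last first.
  by apply/funext => n; rewrite E.
have sub n : `[n.+1%:R^-1 : R, +oo[ `<=` `]0, +oo[.
  by rewrite -bigcup_itv_inv_y => x nx; exists n.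
apply: H => [n|n|n x] /=; first exact: measurable_itv.
  apply/measurable_EFinP; apply: measurable_funS mf => //; exact: sub.
by move/(sub n); rewrite /= in_itv/= andbT lee_fin; exact: f0.
Unshelve. all: by end_near. Qed.

(** Without a sign, dominated convergence along [1 / n, n + 1] replaces the
    monotone exhaustion. *)
Lemma FTC_itv0y f F (l0 l1 : R) :
  mu.-integrable `]0, +oo[ (EFin \o f) ->
  (forall x : R, 0 < x -> {for x, continuous f}) ->
  (forall x : R, 0 < x -> is_derive x (1 : R) F (f x)) ->
  F x @[x --> 0^'+] --> l0 -> F x @[x --> +oo] --> l1 ->
  (\int[mu]_(x in `]0%R, +oo[) (f x)%:E = (l1 - l0)%:E)%E.
Proof.
move=> intf cf dF F0 F1.
have dFx x : 0 < x -> derivable F x 1 by move=> /dF[].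
have cF x : 0 < x -> {for x, continuous F}.
  by move=> /dFx ?; apply/differentiable_continuous/derivable1_diffP.
have n0 n : 0 < n.+1%:R^-1 :> R by rewrite invr_gt0 ltr0n.
have n2 n : n.+1%:R^-1 < n.+2%:R :> R.
  by apply: (@le_lt_trans _ _ 1); rewrite ?invf_le1 ?ltr0n// ?ler1n// ltr1n.
pose A n := `[n.+1%:R^-1 : R, n.+2%:R]%classic.
have sub n : A n `<=` `]0, +oo[.
  by rewrite -bigcup_itv_inv_S => x nx; exists n.
have E n : (\int[mu]_(x in A n) (f x)%:E = (F n.+2%:R - F n.+1%:R^-1)%:E)%E.
  rewrite (@continuous_FTC2 _ f F)// ?EFinB//.
  - apply: continuous_in_subspaceT => x /set_mem/sub/=.
    by rewrite in_itv/= andbT; exact: cf.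
  - split.
    + move=> x; rewrite in_itv/= => /andP[nx _]; apply: dFx; exact: lt_trans nx.
    + by apply: cvg_at_right_filter; exact: cF.
    + by apply: cvg_at_left_filter; apply: cF; exact: lt_trans (n2 n).
  - move=> x; rewrite in_itv/= => /andP[nx _].
    by rewrite derive1E; have [_ ->//] := dF x (lt_trans (n0 n) nx).
have mf : measurable_fun (`]0%R, +oo[ : set (measurableTypeR R)) (EFin \o f).
  exact: measurable_int intf.
have H1 : (F n.+2%:R - F n.+1%:R^-1)%:E @[n --> \oo] --> (l1 - l0)%:E.
  apply: cvg_EFin; first exact: nearW.
  apply: cvgB; last first.
    move/cvg_at_rightP : F0; apply; split => //.
    exact: cvg_harmonic.
  move/cvg_pinftyP : F1; apply.
  apply/cvgryPge => M; near=> n.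
  apply: (@le_trans _ _ n%:R); last by rewrite ler_nat -addn2 leq_addr.
  near: n; exact: nbhs_infty_ger.
apply: (cvg_unique _ _ H1) => //.
have ndA m n : (m <= n)%N -> A m `<=` A n.
  move=> mn x; rewrite /A/= !in_itv/= => /andP[mx xm]; apply/andP; split.
    by apply: le_trans mx; rewrite lef_pV2 ?posrE ?ltr0n// ler_nat.
  by apply: (le_trans xm); rewrite ler_nat !ltnS.
have mfn n : measurable_fun (`]0%R, +oo[ : set (measurableTypeR R)) ((EFin \o f) \_ (A n)).
  apply/measurable_restrict => //; first exact: measurable_itv.
  by apply: measurable_funS mf => //; exact: subIsetr.
have cvgfn : {ae mu, forall x, `]0%R, +oo[%classic x ->
    ((EFin \o f) \_ (A n)) x @[n --> \oo] --> (EFin \o f) x}.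
  apply/aeW => x; rewrite -bigcup_itv_inv_S => -[N _ ANx].
  apply: cvg_near_cst; near=> n.
  rewrite patchE mem_set//; apply: ndA ANx.
  by near: n; exact: nbhs_infty_ge.
have domf : {ae mu, forall x n, `]0%R, +oo[%classic x ->
    (`|((EFin \o f) \_ (A n)) x| <= (abse \o (EFin \o f)) x)%E}.
  apply/aeW => x n _ /=; rewrite patchE; case: ifPn => //= _.
  by rewrite normr0 lee_fin.
have [_ _ ] := @dominated_convergence _ (measurableTypeR R) R mu `]0%R, +oo[%classic
  (measurable_itv _) _ _ _ mfn mf cvgfn (integrable_abse intf) domf.
rewrite (_ : [sequence _]_n = fun n => (F n.+2%:R - F n.+1%:R^-1)%:E)//.
by apply/funext => n/=; rewrite -E -integral_mkcondr setIC; congr (integral _ _ _); exact/setIidPl/sub.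
Unshelve. all: by end_near. Qed.

End ftc_pos.

Section change_of_variables.
Context {R : realType}.
Local Notation mu := (@lebesgue_measure R).
Implicit Types m : {measure set (measurableTypeR R) -> \bar R}.

Lemma bigcup_itv_oc_inv (b : R) : 0 < b ->
  \bigcup_n `]b * n.+2%:R^-1, b]%classic = `]0, b]%classic.
Proof.
move=> b0; apply/seteqP; split => [x [n _]|x] /=; rewrite !in_itv/=.
  move=> /andP[bx ->]; rewrite andbT; apply: lt_trans bx.
  by rewrite mulr_gt0// invr_gt0 ltr0n.
move=> /andP[x0 xb]; exists (Num.truncn (b / x)) => //=.
rewrite in_itv/= xb andbT ltr_pdivrMr ?ltr0n// mulrC -ltr_pdivrMr//.
by apply: (lt_trans (truncnS_gt _)); rewrite ltr_nat.
Qed.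

Lemma measure_null_oc m (a b : R) : m `]-oo, 0]%classic = 0%E -> a <= 0 -> 0 < b ->
  m `]a, b]%classic = m `]0, b]%classic.
Proof.
move=> m0 a0 b0.
have -> : `]a, b]%classic = `]a, 0]%classic `|` `]0, b]%classic :> set R.
  by rewrite -itv_bndbnd_setU// bnd_simp// ltW.
rewrite measureU//; last first.
  apply/seteqP; split => // x [] /=; rewrite !in_itv/=.
  by move=> /andP[_ x0] /andP[+ _]; rewrite ltNge x0.
rewrite [X in (X + _)%E](_ : _ = 0%E) ?add0e//.
apply: (subset_measure0 _ _ _ m0) => // x /=.
by rewrite !in_itv/= => /andP[].
Qed.

(** Continuity from below extends the agreement to intervals ]0, b], hence to
    the generating pi-system of half-open intervals. *)
Lemma measure_eq_pos m1 m2 :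
  m1 `]-oo, 0]%classic = 0%E -> m2 `]-oo, 0]%classic = 0%E ->
  (forall b : R, 0 < b -> (m1 `]0%R, b]%classic < +oo)%E) ->
  (forall a b : R, 0 < a -> a < b -> m1 `]a, b]%classic = m2 `]a, b]%classic) ->
  forall A, measurable A -> m1 A = m2 A.
Proof.
move=> m10 m20 fin1 E.
have E0 (b : R) : 0 < b -> m1 `]0, b]%classic = m2 `]0, b]%classic.
  move=> b0; rewrite -bigcup_itv_oc_inv//.
  have nd : nondecreasing_seq (fun n => `]b * n.+2%:R^-1, b]%classic).
    move=> k n kn; apply/subsetPset => x /=; rewrite !in_itv/= => /andP[+ ->].
    rewrite andbT; apply: le_lt_trans; rewrite ler_pM2l//.
    by rewrite lef_pV2 ?posrE ?ltr0n// ler_nat.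
  have mU : measurable (\bigcup_n `]b * n.+2%:R^-1, b]%classic : set (measurableTypeR R)).
    by apply: bigcupT_measurable => n; exact: measurable_itv.
  have H1 := @nondecreasing_cvg_mu _ _ _ m1 _ (fun n => measurable_itv _) mU nd.
  have H2 := @nondecreasing_cvg_mu _ _ _ m2 _ (fun n => measurable_itv _) mU nd.
  apply: (cvg_unique _ _ H2) => //; move: H1.
  rewrite (_ : m1 \o _ = m2 \o (fun n => `]b * n.+2%:R^-1, b]%classic))//.
  apply/funext => n /=; apply: E; first by rewrite mulr_gt0// invr_gt0 ltr0n.
  by rewrite gtr_pMr// invf_lt1 ?ltr0n// ltr1n.
move=> A mA.
refine (@measure_unique _ R (measurableTypeR R) (@ocitv R)
  (fun n => `](- n%:R), n%:R]%classic) _ _ _ _ m1 m2 _ _ A mA) => //.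
- exact: ocitvI.
- by move=> n; exact: is_ocitv.
- apply/seteqP; split => // x _; exists (Num.truncn `|x|).+1 => //=.
  rewrite in_itv/=; have := truncnS_gt `|x|; rewrite ltr_norml => /andP[-> /ltW].
  by rewrite andTb.
- move=> _ [[a b] _ <-]/=.
  have [b0|b0] := leP b 0.
    by rewrite !(subset_measure0 _ _ _ m10, subset_measure0 _ _ _ m20)// => x/=;
      rewrite !in_itv/= => /andP[_ /le_trans]; exact.
  have [a0|a0] := leP a 0; first by rewrite !measure_null_oc// E0.
  have [ab|ab] := ltP a b; first exact: E.
  by rewrite set_itv_ge ?measure0// -leNgt bnd_simp.
- move=> [|n]; first by rewrite oppr0 set_itv_ge ?measure0// bnd_simp ltxx.
  by rewrite measure_null_oc ?fin1// ?oppr_le0 ?ltr0n.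
Qed.

(** The push-forward under G of Lebesgue measure on I and the measure with
    density f agree on ]a, b], where both are F b - F a. *)
Lemma ge0_change_of_variables (F f G : R -> R) (I : set (measurableTypeR R)) (h : R -> \bar R) :
  (forall x : R, 0 < x -> 0 <= f x) ->
  (forall x : R, 0 < x -> {for x, continuous f}) ->
  (forall x : R, 0 < x -> is_derive x (1 : R) F (f x)) ->
  (forall x y : R, 0 < x -> x < y -> F x < F y) ->
  measurable I -> is_interval I -> I `<=` `]0, +oo[ ->
  (forall x : R, 0 < x -> I (F x)) ->
  (forall y : R, I y -> 0 < G y /\ F (G y) = y) ->
  measurable_fun [set: measurableTypeR R] (G : measurableTypeR R -> measurableTypeR R) ->
  measurable_fun I h -> (forall y, I y -> (0 <= h y)%E) ->
  (\int[mu]_(x in `]0%R, +oo[) (h (F x) * (f x)%:E) = \int[mu]_(y in I) h y)%E.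
Proof.
move=> f0 cf dF incF mI cvxI I0 FI GI mG mh h0.
have FK (x : R) : 0 < x -> G (F x) = x.
  move=> x0; have [G0 FG] := GI _ (FI _ x0).
  have [xG|xG|//] := ltgtP (G (F x)) x.
    by have := incF _ _ G0 xG; rewrite FG ltxx.
  by have := incF _ _ x0 xG; rewrite FG ltxx.
have incG (a y : R) : 0 < a -> I y -> (a < G y) = (F a < y).
  move=> a0 Iy; have [G0 FG] := GI _ Iy.
  have [aG|Ga|->] := ltgtP a (G y); first by rewrite -FG incF.
    by apply/esym; rewrite -FG ltNge ltW// incF.
  by rewrite FG ltxx.
have mf : measurable_fun (`]0%R, +oo[ : set (measurableTypeR R)) f.
  apply: open_continuous_measurable_fun => // x.
  by rewrite inE/= in_itv/= andbT; exact: cf.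
pose fp := f \_ `]0, +oo[.
have mfp : measurable_fun [set: measurableTypeR R] fp.
  by apply: (measurable_restrictT _ (measurable_itv _)).1.
have fp0 (x : R) : 0 <= fp x.
  by rewrite /fp patchE; case: ifPn => // /set_mem/=; rewrite in_itv/= andbT; exact: f0.
have mI1 : measurable_fun [set: measurableTypeR R] (\1_I : _ -> R) by exact: measurable_indic.
have I10 (x : R) : 0 <= (\1_I x : R) by [].
have mpreG A : measurable A -> measurable (G @^-1` A).
  by move=> mA; rewrite -[_ @^-1` _]setTI; exact: mG.
pose m1_ : {measure set (measurableTypeR R) -> \bar R} :=
  pushforward (density_measure mu mI1 I10) (G : measurableTypeR R -> measurableTypeR R).
pose m1 := m1_ mG.
pose m2 : {measure set (measurableTypeR R) -> \bar R} := density_measure mu mfp fp0.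
have m1E A : measurable A -> m1 A = mu (G @^-1` A `&` I).
  move=> mA.
  rewrite /m1 /m1_/= /pushforward/= /density_measure integral_indic// 1?setIC//.
  exact: mpreG.
have m12 : forall A, measurable A -> m1 A = m2 A.
  apply: measure_eq_pos.
  - rewrite m1E//.
    rewrite (_ : _ `&` _ = set0) ?measure0//.
    apply/seteqP; split => // y [/= + /GI[G0 _]].
    by rewrite in_itv/= leNgt G0.
  - rewrite /m2/= /density_measure; apply: integral0_eq => x.
    rewrite /= in_itv/= => x0; rewrite /fp patchE memNset//= in_itv/= andbT.
    by apply/negP; rewrite -leNgt.
  - move=> b b0; rewrite m1E//.
     apply: (@le_lt_trans _ _ (mu `]0%R, F b]%classic)); last first.
      by rewrite lebesgue_measure_itv/=; case: ifPn; rewrite ?ltry// -EFinD ltry.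
    apply: le_measure; rewrite ?inE//.
    + by apply: measurableI => //; apply: mpreG; exact: measurable_itv.
    + move=> y [/=]; rewrite !in_itv/= => /andP[G0 Gb] Iy.
      have := I0 _ Iy; rewrite /= in_itv/= andbT => ->/=.
      by rewrite leNgt -incG// -leNgt.
  - move=> a b a0 ab; have b0 := lt_trans a0 ab.
    rewrite m1E//.
    rewrite (_ : _ `&` _ = `]F a, F b]%classic); last first.
      apply/seteqP; split => y/=; rewrite !in_itv/=.
        by move=> [/andP[aG Gb] Iy]; rewrite -incG// aG/= leNgt -incG// -leNgt.
      move=> /andP[Fay yFb].
      have Iy : I y by apply: (cvxI (F a) (F b)); [exact: FI..|rewrite ltW].
      by split=> //; rewrite incG// Fay/= leNgt incG// -leNgt.
    rewrite lebesgue_measure_itv/= lte_fin incF//.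
    rewrite /m2/= /density_measure.
    transitivity (\int[mu]_(x in `]a, b]) (f x)%:E)%E; last first.
      apply: eq_integral => x; rewrite inE/= in_itv/= => /andP[ax _].
      by rewrite /fp patchE mem_set//= in_itv/= andbT (lt_trans a0).
    rewrite integral_itv_obnd_cbnd//; last first.
      apply/measurable_EFinP; apply: measurable_funS mf => //.
      by move=> x/=; rewrite !in_itv/= andbT => /andP[ax _]; exact: lt_trans ax.
    have cF (x : R) : 0 < x -> {for x, continuous F}.
      by move=> /dF[? _]; apply/differentiable_continuous/derivable1_diffP.
    rewrite (@continuous_FTC2 _ f F)//.
    - apply: continuous_in_subspaceT => x /set_mem/=.
      by rewrite in_itv/= => /andP[ax _]; apply: cf; exact: lt_le_trans ax.
    - split.
      + by move=> x; rewrite in_itv/= => /andP[ax _]; have [] := dF _ (lt_trans a0 ax).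
      + by apply: cvg_at_right_filter; exact: cF.
      + by apply: cvg_at_left_filter; exact: cF.
    - move=> x; rewrite in_itv/= => /andP[ax _].
      by rewrite derive1E; have [_ ->//] := dF x (lt_trans a0 ax).
have mhF : measurable_fun (`]0%R, +oo[ : set (measurableTypeR R)) (h \o F).
  apply: (measurable_comp mI _ mh).
    by move=> _ [x/= + <-]; rewrite in_itv/= andbT; exact: FI.
  apply: open_continuous_measurable_fun => // x.
  rewrite inE/= in_itv/= andbT => x0.
  by have [? _] := dF _ x0; apply/differentiable_continuous/derivable1_diffP.
have hF0 (x : R) : `]0, +oo[%classic x -> (0 <= (h \o F) x)%E.
  by rewrite /= in_itv/= andbT => x0; apply: h0; exact: FI.
transitivity (\int[m2]_(x in `]0%R, +oo[) (h \o F) x)%E.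
  rewrite ge0_integral_density//.
  by apply: eq_integral => x x0; rewrite /fp patchE x0.
rewrite (@eq_measure_integral _ _ _ _ m1 m2); last by move=> A mA _; rewrite m12.
rewrite ge0_integral_pushforward//; last by move=> x /set_mem; exact: hF0.
have mpre : measurable (G @^-1` `]0, +oo[%classic).
  by apply: mpreG; exact: measurable_itv.
rewrite ge0_integral_density//; last 2 first.
- apply: (measurable_comp (measurable_itv `]0, +oo[) _ mhF) => //.
    by move=> _ [x/= + <-].
  exact: measurable_funTS.
- by move=> x /= Gx; apply: hF0.
rewrite (integral_mkcond I) integral_mkcond; apply: eq_integral => y _.
rewrite !patchE indicE.
have [Iy|nIy] := boolP (y \in I); last by rewrite mule0 if_same.
have [G0 FG] := GI _ (set_mem Iy).
by rewrite mem_set/= ?FG ?mule1// in_itv/= andbT.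
Qed.

End change_of_variables.

Section power_functions.
Context {R : realType}.
Implicit Types (x y t p c : R).
Local Notation mu := (@lebesgue_measure R).

Lemma is_derive_powR p (x : R) : 0 < x ->
  is_derive x (1 : R) (fun t => t `^ p) (p * x `^ (p - 1)).
Proof.
move=> x0; have xI : x \in `]0, +oo[ by rewrite in_itv/= x0.
apply: DeriveDef; first exact: derivable_powR.
by rewrite -derive1E powR_derive1.
Qed.

Lemma continuous_powRl p (x : R) : 0 < x -> {for x, continuous (fun t => t `^ p)}.
Proof.
move=> x0; have [? _] := is_derive_powR p x0.
exact/differentiable_continuous/derivable1_diffP.
Qed.

Lemma cvgy_powR p : 0 < p -> (x : R) `^ p @[x --> +oo] --> +oo.
Proof.
move=> p0; apply/cvgryPge => M; near=> x.
have M0 : 0 <= Num.max M 0 by rewrite le_max lexx orbT.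
have Mx : (Num.max M 0) `^ p^-1 <= x by near: x; exact: nbhs_pinfty_ge.
apply: (@le_trans _ _ (Num.max M 0)); first by rewrite le_max lexx.
rewrite -[leLHS](powRr1 M0) -(mulVf (lt0r_neq0 p0)) powRrM.
by apply: ge0_ler_powR Mx; rewrite ?ltW// nnegrE// ?powR_ge0// (le_trans _ Mx)// powR_ge0.
Unshelve. all: by end_near. Qed.

(** From ln s < s at s = t / (2 p). *)
Lemma powR_le_expR p t : 0 < p -> 0 < t ->
  t `^ p <= (2 * p) `^ p * expR (t / 2).
Proof.
move=> p0 t0; have p2 : 0 < 2 * p by rewrite mulr_gt0.
have -> : t = (2 * p) * (t / (2 * p)) by rewrite mulrC divfK// gt_eqF.
set s := t / (2 * p); have s0 : 0 < s by rewrite divr_gt0.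
rewrite powRM ?(ltW p2) ?(ltW s0)// ler_pM2l ?powR_gt0//.
rewrite /powR gt_eqF// ler_expR.
rewrite (_ : 2 * p * s / 2 = p * s); last by field.
by rewrite ler_pM2l// ltW// ln_sublinear.
Qed.

Lemma ge0_integral_powR_subst c p (h : R -> \bar R) : 0 < c -> 0 < p ->
  measurable_fun (`]0, +oo[ : set (measurableTypeR R)) h -> (forall y, 0 < y -> (0 <= h y)%E) ->
  (\int[mu]_(x in `]0%R, +oo[) (h (c * x `^ p)%R * (c * p * x `^ (p - 1))%:E) =
   \int[mu]_(y in `]0%R, +oo[) h y)%E.
Proof.
move=> c0 p0 mh h0.
have pV0 : 0 < p^-1 by rewrite invr_gt0.
apply: (@ge0_change_of_variables _ (fun x => c * x `^ p) _ (fun y => (y / c) `^ p^-1)).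
- by move=> x x0; rewrite !mulr_ge0 ?powR_ge0 ?ltW.
- by move=> x x0; apply: cvgM; [exact: cvg_cst|exact: continuous_powRl].
- move=> x x0; rewrite -mulrA.
  have := is_deriveZ c (is_derive_powR p x0); exact.
- move=> x y x0 xy; rewrite ltr_pM2l// gt0_ltr_powR// nnegrE ltW//.
  exact: lt_trans xy.
- exact: measurable_itv.
- exact: interval_is_interval.
- by [].
- by move=> x x0; rewrite /= in_itv/= andbT mulr_gt0// powR_gt0.
- move=> y; rewrite /= in_itv/= andbT => y0.
  have yc0 : 0 < y / c by rewrite divr_gt0.
  rewrite powR_gt0//; split => //.
  by rewrite -powRrM mulVf ?gt_eqF// powRr1 ?ltW// mulrC divfK// gt_eqF.
- apply: (measurableT_comp (measurable_powR _)).
  exact: measurable_funM.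
- exact: mh.
- by move=> y; rewrite /= in_itv/= andbT; exact: h0.
Qed.

End power_functions.

Section integral_gt0.
Context d (T : measurableType d) (R : realType) (m : {measure set T -> \bar R}).

Lemma integral_gt0 (D : set T) (f : T -> \bar R) :
  measurable D -> measurable_fun D f -> (forall x, D x -> (0 < f x)%E) ->
  m D != 0%E -> (0 < \int[m]_(x in D) f x)%E.
Proof.
move=> mD mf f0 mD0.
have f0' x : D x -> (0 <= f x)%E by move=> /f0/ltW.
rewrite lt_neqAle eq_sym integral_ge0// andbT; apply: contra mD0 => /eqP E0.
have /(ae_eq_integral_abs _ mD mf) : (\int[m]_(x in D) `|f x| = 0)%E.
  by rewrite -E0; apply: eq_integral => x /set_mem Dx; rewrite gee0_abs ?f0'.
move=> [N [mN N0 sub]]; apply/eqP; apply: (subset_measure0 mD mN _ N0) => x Dx.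
by apply: sub => /= /(_ Dx) fx0; have := f0 _ Dx; rewrite fx0 ltxx.
Qed.

End integral_gt0.

(** * The Gamma function *)
Section gamma_integral.
Context {R : realType}.
Implicit Types (x y t p c : R).
Local Notation mu := (@lebesgue_measure R).

Lemma continuous_pow_exp p c (t : R) : 0 < t ->
  {for t, continuous (fun t => t `^ p * expR (- (c * t)))}.
Proof.
move=> t0; apply: cvgM; first exact: continuous_powRl.
apply: continuous_comp; last exact: continuous_expR.
by apply: cvgN; apply: cvgM; [exact: cvg_cst|exact: cvg_id].
Qed.

Lemma measurable_pos (f : R -> R) : (forall t : R, 0 < t -> {for t, continuous f}) ->
  measurable_fun (`]0, +oo[ : set (measurableTypeR R)) f.
Proof.
move=> cf; apply: open_continuous_measurable_fun => // x.
by rewrite inE/= in_itv/= andbT; exact: cf.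
Qed.

Lemma measurable_posR : measurable (`]0, +oo[%classic : set (measurableTypeR R)).
Proof. exact: measurable_itv. Qed.

Lemma posP (t : R) : `]0, +oo[%classic t <-> 0 < t.
Proof. by rewrite /= in_itv/= andbT. Qed.

(** A majorant of t^(x-1) e^(-t) up to a constant, at 0 and at +oo; it is
    integrable because - 1 / (x (1 + t^x)) is a primitive. *)
Lemma integrable_pow_majorant x : 0 < x ->
  mu.-integrable `]0, +oo[ (EFin \o (fun t => t `^ (x - 1) / (1 + t `^ x) ^+ 2)).
Proof.
move=> x0.
have D0 (t : R) : 0 < 1 + t `^ x by rewrite ltr_wpDr ?powR_ge0.
have cf (t : R) : 0 < t ->
    {for t, continuous (fun t => t `^ (x - 1) / (1 + t `^ x) ^+ 2)}.
  move=> t0; apply: cvgM; first exact: continuous_powRl.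
  apply: cvgV; first by rewrite expf_neq0// gt_eqF.
  apply: (@continuous_comp _ _ _ (fun t => 1 + t `^ x) (fun t => t ^+ 2)).
    by apply: cvgD; [exact: cvg_cst|exact: continuous_powRl].
  exact: exprn_continuous.
apply/integrableP; split; first by apply/measurable_EFinP; exact: measurable_pos.
under eq_integral do rewrite /= ger0_norm ?mulr_ge0 ?invr_ge0 ?powR_ge0 ?exprn_ge0 ?ltW//.
suff -> : (\int[mu]_(t in `]0%R, +oo[) (t `^ (x - 1) / (1 + t `^ x) ^+ 2)%:E =
    (- x^-1 * 0 - - x^-1 * (1 + 0)^-1)%:E)%E by rewrite ltry.
apply: (@ge0_FTC_itv0y _ _ (fun t => - x^-1 * (1 + t `^ x)^-1)) => //.
- by move=> t t0; rewrite mulr_ge0 ?invr_ge0 ?powR_ge0 ?exprn_ge0 ?ltW.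
- move=> t t0.
  have d1 : is_derive t (1 : R) (fun t => 1 + t `^ x) (x * t `^ (x - 1)).
    have := is_deriveD (is_derive_cst (1 : R) t (1 : R)) (is_derive_powR x t0).
    by rewrite add0r.
  have n0 : 1 + t `^ x != 0 by rewrite gt_eqF.
  have d2 := @is_deriveV R (fun t => 1 + t `^ x) t _ 1 n0 d1.
  have := is_deriveZ (- x^-1) d2.
  rewrite (_ : _ *: _ = t `^ (x - 1) / (1 + t `^ x) ^+ 2)//.
  rewrite /GRing.scale/= -exprVn; field.
  by rewrite !gt_eqF.
- apply: cvgM; first exact: cvg_cst.
  apply: cvgV; first by rewrite addr0 oner_neq0.
  by apply: cvgD; [exact: cvg_cst|exact: powR_cvg0].
- apply: cvgM; first exact: cvg_cst.
  apply/gtr0_cvgV0; first by apply: nearW => t; exact: D0.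
  apply: ger_cvgy (cvgy_powR x0).
  by apply: nearW => t; rewrite lerDr.
Qed.

Lemma integrable_gamma x : 0 < x ->
  mu.-integrable `]0, +oo[ (EFin \o (fun t => t `^ (x - 1) * expR (- t))).
Proof.
move=> x0; have x2 : 0 < 2 * x by rewrite mulr_gt0.
pose C : R := 2 + 2 * (2 * (2 * x)) `^ (2 * x).
apply: (@le_integrable _ (measurableTypeR R) R mu `]0, +oo[%classic (measurable_itv _) _
   (EFin \o (fun t => C * (t `^ (x - 1) / (1 + t `^ x) ^+ 2)))).
- apply/measurable_EFinP; apply: measurable_pos => t t0.
  have := @continuous_pow_exp (x - 1) 1 t t0.
  by rewrite (_ : (fun t => _ * expR (- (1 * t))) = (fun t => t `^ (x - 1) * expR (- t)))//;
    apply/funext => s; rewrite mul1r.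
- move=> t /posP t0.
  rewrite /= lee_fin normrM (ger0_norm (powR_ge0 _ _)) (ger0_norm (expR_ge0 _)).
  apply: le_trans (ler_norm _).
  have D0 : 0 < (1 + t `^ x) ^+ 2 by rewrite exprn_gt0// ltr_wpDr ?powR_ge0.
  rewrite mulrCA ler_wpM2l ?powR_ge0// ler_pdivlMr// mulrC.
  rewrite expRN ler_pdivrMr ?expR_gt0//.
  have h1 : (1 + t `^ x) ^+ 2 <= 2 + 2 * (t `^ x) ^+ 2.
    by have := sqr_ge0 (1 - t `^ x); nra.
  have h2 : (t `^ x) ^+ 2 = t `^ (2 * x).
    by rewrite mulrC powRrM powR_mulrn ?powR_ge0.
  have h3 := powR_le_expR x2 t0.
  have h4 : expR (t / 2) <= expR t by rewrite ler_expR; lra.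
  have h5 : 1 <= expR t by rewrite -expR0 ler_expR ltW.
  apply: (le_trans h1); rewrite h2 /C [leRHS]mulrDl lerD//; first by rewrite ler_peMr.
  rewrite -mulrA ler_pM2l//; apply: (le_trans h3).
  by rewrite ler_wpM2l// powR_ge0.
- have := @integrableZl _ (measurableTypeR R) R mu `]0, +oo[%classic (measurable_itv _) C _ (integrable_pow_majorant x0).
  exact.
Qed.

Lemma integral_Gamma x : 0 < x ->
  (\int[mu]_(t in `]0%R, +oo[) (t `^ (x - 1) * expR (- t))%:E = (Gamma x)%:E)%E.
Proof.
move=> x0; rewrite /Gamma x0 /euler_integral /Rintegral fineK//.
by apply: integrable_fin_num => //; exact: integrable_gamma.
Qed.

Lemma mu_pos_neq0 : mu `]0, +oo[%classic != 0%E.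
Proof. by rewrite lebesgue_measure_itv/= ltry. Qed.

Lemma Gamma_gt0 x : 0 < x -> 0 < Gamma x.
Proof.
move=> x0; rewrite -lte_fin -integral_Gamma//; apply: integral_gt0 => //.
- by have /integrableP[] := integrable_gamma x0.
- by move=> t /posP t0; rewrite lte_fin mulr_gt0 ?powR_gt0 ?expR_gt0.
- exact: mu_pos_neq0.
Qed.

(** The integral of the derivative of t^x e^(-t). *)
Lemma GammaS x : 0 < x -> Gamma (x + 1) = x * Gamma x.
Proof.
move=> x0; have x10 : 0 < x + 1 by rewrite addr_gt0.
have I1 := integrable_gamma x0; have I2 := integrable_gamma x10.
pose g1 := EFin \o (fun t => t `^ (x - 1) * expR (- t)).
pose g2 := EFin \o (fun t => t `^ (x + 1 - 1) * expR (- t)).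
have I1' : mu.-integrable `]0, +oo[ (fun t => x%:E * g1 t)%E.
  exact: (@integrableZl _ (measurableTypeR R) R mu `]0, +oo[%classic (measurable_itv _)).
have cg p (t : R) : 0 < t -> {for t, continuous (fun t => t `^ p * expR (- t))}.
  move=> t0; have := @continuous_pow_exp p 1 t t0.
  by rewrite (_ : (fun t => _ * expR (- (1 * t))) = (fun t => t `^ p * expR (- t)))//;
    apply/funext => s; rewrite mul1r.
have := @FTC_itv0y R (fun t => x * (t `^ (x - 1) * expR (- t)) - t `^ (x + 1 - 1) * expR (- t))
  (fun t => t `^ x * expR (- t)) 0 0.
have -> : EFin \o (fun t => x * (t `^ (x - 1) * expR (- t)) - t `^ (x + 1 - 1) * expR (- t)) =
   ((fun t => x%:E * g1 t) \- g2)%E by apply/funext.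
move=> /(_ (integrableB measurable_posR I1' I2)) H.
have {H} : (\int[mu]_(t in `]0%R, +oo[)
    (x * (t `^ (x - 1) * expR (- t)) - t `^ (x + 1 - 1) * expR (- t))%:E = (0 - 0)%:E)%E.
  apply: H.
  - move=> t t0; apply: cvgB; last exact: cg.
    by apply: cvgM; [exact: cvg_cst|exact: cg].
  - move=> t t0.
    have d1 : is_derive t (1 : R) (fun t => expR (- t)) (- expR (- t)).
      have := @is_derive1_comp R expR (fun t => - t) t (expR (- t)) (- 1) _ _.
      by rewrite mulrN1; apply.
    have := is_deriveM (is_derive_powR x t0) d1.
    rewrite (_ : _ + _ = x * (t `^ (x - 1) * expR (- t)) - t `^ (x + 1 - 1) * expR (- t))//.
    by rewrite /GRing.scale/= addrK; ring.
  - rewrite -[X in _ --> X](mul0r (expR (- 0))).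
    apply: cvgM; first exact: powR_cvg0.
    apply: cvg_at_right_filter; apply: continuous_comp; first exact: cvgN.
    exact: continuous_expR.
  - have E2 : ((2 * x) `^ x * expR (- (t / 2)) @[t --> +oo] --> (0 : R)).
      rewrite -[X in _ --> X](mulr0 ((2 * x) `^ x)); apply: cvgM; first exact: cvg_cst.
      apply: (@cvg_comp _ _ _ (fun t : R => t / 2) (fun t => expR (- t)) _ (pinfty_nbhs R)); last exact: cvgr_expR.
      by apply: gt0_cvgMly => //; rewrite invr_gt0.
    apply: (@squeeze_cvgr _ _ _ _ (cst 0) (fun t => (2 * x) `^ x * expR (- (t / 2)))) => //; last exact: cvg_cst.
    near=> t; have t0 : 0 < t by near: t; exact: nbhs_pinfty_gt.
    rewrite /cst mulr_ge0 ?powR_ge0 ?expR_ge0//=.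
    apply: (@le_trans _ _ ((2 * x) `^ x * expR (t / 2) * expR (- t))).
      by rewrite ler_wpM2r ?expR_ge0// powR_le_expR.
    by rewrite -mulrA -expRD (_ : t / 2 - t = - (t / 2)); [|field].
have -> : (fun t => (x * (t `^ (x - 1) * expR (- t)) - t `^ (x + 1 - 1) * expR (- t))%:E) =
   ((fun t => x%:E * g1 t) \- g2)%E by apply/funext.
rewrite (integralB measurable_posR)// (integralZl measurable_posR)// !integral_Gamma//.
by rewrite -EFinM -EFinB subrr => -[] /eqP; rewrite subr_eq0 => /eqP ->.
Unshelve. all: by end_near. Qed.

End gamma_integral.

Section gamma_function.
Context {R : realType}.
Implicit Types (a b c x y t p s : R).
Local Notation mu := (@lebesgue_measure R).

(** Pointwise inequalities between powers of t become inequalities for Gamma. *)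
Lemma Gamma_le_comb (A B C a b c : R) : 0 < a -> 0 < b -> 0 < c ->
  0 <= A -> 0 <= B -> 0 <= C ->
  (forall t, 0 < t -> A * t `^ (a - 1) <= B * t `^ (b - 1) + C * t `^ (c - 1)) ->
  A * Gamma a <= B * Gamma b + C * Gamma c.
Proof.
move=> a0 b0 c0 A0 B0 C0 H.
have mg y : 0 < y -> measurable_fun (`]0, +oo[%classic : set (measurableTypeR R))
    (fun t => (t `^ (y - 1) * expR (- t))%:E).
  by move=> y0; have /integrableP[] := integrable_gamma y0.
have g0 y (t : R) : (0 <= (t `^ (y - 1) * expR (- t))%:E)%E.
  by rewrite lee_fin mulr_ge0 ?powR_ge0 ?expR_ge0.
rewrite -lee_fin EFinD !EFinM -!integral_Gamma//.
rewrite -!(ge0_integralZl_EFin _ measurable_posR)//; [|exact: mg..].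
rewrite -(ge0_integralD _ measurable_posR)//; first last.
- by apply: measurable_funeM; exact: mg.
- by move=> t _; rewrite mule_ge0.
- by apply: measurable_funeM; exact: mg.
- by move=> t _; rewrite mule_ge0.
apply: (ge0_le_integral _ measurable_posR).
- by move=> t _; rewrite mule_ge0.
- by apply: measurable_funeM; exact: mg.
- by apply: emeasurable_funD; apply: measurable_funeM; exact: mg.
move=> t /posP t0; rewrite -!EFinM -EFinD lee_fin !mulrA -mulrDl.
by rewrite ler_wpM2r ?expR_ge0// H.
Qed.

(** e^z >= 1 + z at z = p ln s, and ln s >= 1 - 1/s. *)
Lemma powR_ge_tangent p s : 0 <= p -> 0 < s -> 1 + p - p / s <= s `^ p.
Proof.
move=> p0 s0; rewrite /powR gt_eqF//.
apply: le_trans (expR_ge1Dx _); rewrite -addrA lerD2l.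
have sV0 : 0 < s^-1 by rewrite invr_gt0.
have /le_ln1Dx : -1 < s^-1 - 1 by lra.
rewrite (_ : 1 + (s^-1 - 1) = s^-1); last by ring.
rewrite lnV ?posrE// => h.
by rewrite -[X in X - _]mulr1 -mulrBr ler_wpM2l//; lra.
Qed.

(** With c = y + p, integrate the tangent inequality t^p (1 + p - p t / c) <= c^p
    against t^(y-1) e^(-t); as Gamma (c + 1) = c Gamma c, the left side gives
    Gamma c. *)
Lemma Gamma_shift_le y p : 0 < y -> 0 <= p ->
  Gamma (y + p) <= (y + p) `^ p * Gamma y.
Proof.
move=> y0 p0; set c := y + p; have c0 : 0 < c by rewrite ltr_wpDr.
have cp0 : 0 < c `^ p by rewrite powR_gt0.
suff : (1 + p) * Gamma c <= c `^ p * Gamma y + p / c * Gamma (c + 1).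
  by rewrite GammaS// mulrA divfK ?gt_eqF// mulrDl mul1r lerD2r.
have c10 : 0 < c + 1 := addr_gt0 c0 ltr01.
have p10 : 0 <= 1 + p := addr_ge0 ler01 p0.
have pc0 : 0 <= p / c := divr_ge0 p0 (ltW c0).
apply: Gamma_le_comb (ltW cp0) pc0 _ => //.
move=> t t0.
have -> : t `^ (c - 1) = t `^ p * t `^ (y - 1).
  by rewrite -powRD; [congr powR; rewrite /c; ring|rewrite (gt_eqF t0) implybT].
have -> : t `^ (c + 1 - 1) = t `^ p * t * t `^ (y - 1).
  rewrite -[X in _ * X * _](powRr1 (ltW t0)) -!powRD ?(gt_eqF t0) ?implybT//.
  by congr powR; rewrite /c; ring.
rewrite !mulrA -mulrDl ler_wpM2r ?powR_ge0//.
have ct0 : 0 < c / t by rewrite divr_gt0.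
have := powR_ge_tangent p0 ct0; rewrite invf_div => h.
have tp0 : 0 < t `^ p by rewrite powR_gt0.
have e : (c / t) `^ p * t `^ p = c `^ p by rewrite -powRM ?divfK ?gt_eqF ?ltW.
rewrite -e -subr_ge0 (_ : _ - _ = t `^ p * ((c / t) `^ p - (1 + p - p * (t / c)))).
  by apply: mulr_ge0; [exact: ltW|rewrite subr_ge0].
by field; rewrite gt_eqF.
Qed.

(** With c = y - 1, integrate the tangent inequality c^p (1 + p - p c / t) <= t^p
    against t^(y-1) e^(-t); as Gamma y = c Gamma c, the left side gives
    c^p Gamma y. *)
Lemma Gamma_shift_ge y p : 1 < y -> 0 <= p ->
  (y - 1) `^ p * Gamma y <= Gamma (y + p).
Proof.
move=> y1 p0; have y0 : 0 < y by lra.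
set c := y - 1; have c0 : 0 < c by rewrite /c; lra.
have cp0 : 0 < c `^ p by rewrite powR_gt0.
have yE : y = c + 1 by rewrite /c; ring.
suff : (c `^ p * (1 + p)) * Gamma y <= 1 * Gamma (y + p) + c `^ p * p * c * Gamma c.
  have -> : c `^ p * p * c * Gamma c = c `^ p * p * Gamma y.
    by rewrite [in RHS]yE GammaS//; ring.
  by rewrite mulrDr mulr1 mulrDl mul1r lerD2r.
have p10 : 0 <= c `^ p * (1 + p) := mulr_ge0 (ltW cp0) (addr_ge0 ler01 p0).
have pc0 : 0 <= c `^ p * p * c := mulr_ge0 (mulr_ge0 (ltW cp0) p0) (ltW c0).
have yp0 : 0 < y + p by lra.
apply: Gamma_le_comb p10 ler01 pc0 _ => //.
move=> t t0.
have -> : t `^ (y + p - 1) = t `^ p * t * t `^ (c - 1).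
  rewrite -[X in _ * X * _](powRr1 (ltW t0)) -!powRD ?(gt_eqF t0) ?implybT//.
  by congr powR; rewrite /c; ring.
have -> : t `^ (y - 1) = t * t `^ (c - 1).
  rewrite -[X in _ = X * _](powRr1 (ltW t0)) -!powRD ?(gt_eqF t0) ?implybT//.
  by congr powR; rewrite /c; ring.
rewrite mul1r !mulrA -mulrDl ler_wpM2r ?powR_ge0//.
have tc0 : 0 < t / c by rewrite divr_gt0.
have := powR_ge_tangent p0 tc0; rewrite invf_div => h.
have e : (t / c) `^ p * c `^ p = t `^ p by rewrite -powRM ?divfK ?gt_eqF ?ltW.
rewrite -e -subr_ge0 (_ : _ - _ = c `^ p * t * ((t / c) `^ p - (1 + p - p * (c / t)))).
  by apply: mulr_ge0; [apply: mulr_ge0; exact: ltW|rewrite subr_ge0].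
by field; rewrite gt_eqF.
Qed.

Lemma Gamma1 : Gamma 1 = 1 :> R.
Proof.
have mexp : forall t : R, 0 < t -> {for t, continuous (fun t => expR (- t))}.
  move=> t _; apply: continuous_comp; last exact: continuous_expR.
  exact: cvgN.
apply: EFin_inj; rewrite -integral_Gamma//.
transitivity (\int[mu]_(t in `]0%R, +oo[) (expR (- t))%:E)%E.
  by apply: eq_integral => t _; rewrite subrr powRr0 mul1r.
rewrite -[RHS](_ : (0 - - 1 : R)%:E = _); last by rewrite sub0r opprK.
apply: (@ge0_FTC_itv0y _ _ (fun t => - expR (- t))).
- by move=> t _; exact: expR_ge0.
- exact: mexp.
- move=> t _.
  have d1 : is_derive t (1 : R) (fun t => expR (- t)) (- expR (- t)).
    have := @is_derive1_comp R expR (fun t => - t) t (expR (- t)) (- 1) _ _.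
    by rewrite mulrN1; apply.
  by have := is_deriveN d1; rewrite opprK.
- apply: cvgN; rewrite -[X in _ --> X]expR0 -[X in expR X]oppr0.
  apply: cvg_at_right_filter; apply: continuous_comp; last exact: continuous_expR.
  exact: cvgN.
- rewrite -oppr0; apply: cvgN; exact: cvgr_expR.
Qed.

Lemma Gamma_addn a N : 0 < a -> Gamma (a + N%:R) = \prod_(j < N) (a + j%:R) * Gamma a.
Proof.
move=> a0; elim: N => [|N IH]; first by rewrite big_ord0 mul1r addr0.
rewrite -natr1 addrA GammaS ?ltr_wpDr// IH big_ord_recr/=; ring.
Qed.

Lemma Gamma_nat n : Gamma (n.+1%:R) = n`!%:R :> R.
Proof.
elim: n => [|n IH]; first exact: Gamma1.
by rewrite -natr1 GammaS// IH factS natrM.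
Qed.

(** With 1 / Gamma = 0 at the poles, the recursion has no exception. *)
Lemma GammaV_rec a : (Gamma a)^-1 = a / Gamma (a + 1).
Proof.
have [a0|a0] := ltP 0 a.
  rewrite GammaS// invfM mulrA divff ?gt_eqF// mul1r//.
have [->|an0] := eqVneq a 0.
  rewrite mul0r /Gamma ltxx oppr0 truncn0 big_ord_recl/= addr0 !mul0r.
  by rewrite invr0 mulr0 invr0.
have aN : a < 0 by rewrite lt_neqAle an0.
have [a1|a1] := ltP 0 (a + 1).
  have t0 : Num.truncn (- a) = 0%N by apply: truncn_def; apply/andP; split; lra.
  rewrite {1}/Gamma ltNge a0/= t0 big_ord_recl big_ord0/= addr0 mulr1.
  by rewrite invf_div /Gamma a1.
have t0 : Num.truncn (- a) = (Num.truncn (- (a + 1))).+1.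
  apply: truncn_def.
  have /truncn_itv/andP[h1 h2] : 0 <= - (a + 1) by lra.
  by rewrite -[X in X <= _ < _]natr1 -[X in _ <= _ < X]natr1; apply/andP; split; lra.
rewrite /Gamma ltNge a0 ltNge a1/= t0 big_ord_recl/= addr0.
set n := (Num.truncn (- (a + 1))).+1.
have -> : \prod_(i < n) (a + (bump 0 i)%:R) = \prod_(i < n) (a + 1 + i%:R).
  by apply: eq_bigr => i _; rewrite /bump/= natrD addrA.
rewrite !invf_div mulrA; congr (_ / euler_integral _).
by rewrite -addn1 natrD; ring.
Qed.

End gamma_function.

(** * Gauss's limit for the reciprocal Gamma function *)
Section gauss_limit.
Context {R : realType}.
Implicit Types (a b s : R) (N : nat).

(** Gauss's approximation of 1 / Gamma a, in the variant with the N factors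
    a, ..., a + N - 1. *)
Definition gauss N a : R := \prod_(j < N) (a + j%:R) * N%:R `^ (1 - a) / N`!%:R.

Lemma gauss_Gamma N a : 0 < a ->
  gauss N.+1 a = Gamma (N.+1%:R + a) / (Gamma (N.+1%:R) * N.+1%:R `^ a) / Gamma a.
Proof.
move=> a0; rewrite /gauss [N.+1%:R + a]addrC Gamma_addn// Gamma_nat factS natrM.
have N0 : 0 < N.+1%:R :> R by rewrite ltr0n.
have f0 : 0 < N`!%:R :> R by rewrite ltr0n fact_gt0.
have Na0 : 0 < N.+1%:R `^ a :> R by rewrite powR_gt0.
rewrite powRB ?(gt_eqF N0) ?implybT// powRr1 ?ltW//.
by field; rewrite !gt_eqF ?Gamma_gt0.
Qed.

Lemma gauss_ge N a : 0 < a ->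
  (N.+1%:R / N.+2%:R) `^ a / Gamma a <= gauss N.+2 a.
Proof.
move=> a0; rewrite gauss_Gamma// ler_pM2r ?invr_gt0 ?Gamma_gt0//.
have N0 : 0 < N.+2%:R :> R by rewrite ltr0n.
rewrite ler_pdivlMr ?mulr_gt0 ?Gamma_gt0 ?powR_gt0//.
have e : N.+2%:R - 1 = N.+1%:R :> R by rewrite -natr1 addrK.
have := @Gamma_shift_ge R N.+2%:R a; rewrite ltr1n ltW// e => /(_ isT isT).
apply: le_trans; rewrite [Gamma _ * _]mulrC mulrA -powRM ?divr_ge0 ?ler0n//.
by rewrite divfK ?pnatr_eq0.
Qed.

Lemma gauss_le N a : 0 < a ->
  gauss N.+1 a <= ((N.+1%:R + a) / N.+1%:R) `^ a / Gamma a.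
Proof.
move=> a0; rewrite gauss_Gamma// ler_pM2r ?invr_gt0 ?Gamma_gt0//.
have N0 : 0 < N.+1%:R :> R by rewrite ltr0n.
rewrite ler_pdivrMr ?mulr_gt0 ?Gamma_gt0 ?powR_gt0//.
have := @Gamma_shift_le R N.+1%:R a N0 (ltW a0); move/le_trans; apply.
rewrite [Gamma _ * _]mulrC mulrA -powRM ?divr_ge0 ?addr_ge0 ?ler0n ?(ltW a0)//.
by rewrite divfK ?pnatr_eq0.
Qed.

Lemma cvg_powR_1 (u : R^nat) a : u @ \oo --> (1 : R) -> (u n) `^ a @[n --> \oo] --> (1 : R).
Proof.
move=> u1; have : (1 : R) `^ a = 1 by rewrite powR1.
move=> <-; apply: (@cvg_comp _ _ _ u (fun t => t `^ a) _ (nbhs (1 : R)) _ u1).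
exact: continuous_powRl.
Qed.

Lemma cvg_powR_natN p : 0 < p -> (n.+1%:R : R) `^ (- p) @[n --> \oo] --> 0.
Proof.
move=> p0; have /cvg_at_rightP := powR_cvg0 p0.
move=> /(_ (fun n => n.+1%:R^-1)) H.
rewrite (_ : (fun n => _) = (fun n => (n.+1%:R^-1) `^ p)).
  by apply: H; split => [n|]; [rewrite invr_gt0 ltr0n|exact: cvg_harmonic].
by apply/funext => n; rewrite -powR_inv1// -powRrM mulN1r.
Qed.

(** Gamma (N + a) is N^a Gamma N up to a factor tending to 1. *)
Lemma gauss_cvg_pos a : 0 < a -> gauss N a @[N --> \oo] --> (Gamma a)^-1.
Proof.
move=> a0; suff : (gauss N.+2 a) @[N --> \oo] --> 1 * (Gamma a)^-1.
  by rewrite mul1r -[X in _ -> X]cvg_shiftS -[X in _ -> X](cvg_shiftS (fun n => gauss n.+1 a)).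
have h := @cvg_harmonic R.
have h1 : (n.+2%:R^-1 : R) @[n --> \oo] --> (0 : R) by move: h; rewrite -cvg_shiftS.
apply: (@squeeze_cvgr _ _ _ _ (fun N => (N.+1%:R / N.+2%:R) `^ a / Gamma a)
  (fun N => ((N.+2%:R + a) / N.+2%:R) `^ a / Gamma a)).
- by apply: nearW => N; rewrite gauss_ge// gauss_le.
- apply: cvgMl; apply: cvg_powR_1.
  rewrite (_ : (fun N => _) = (fun N => 1 - N.+2%:R^-1)).
    by rewrite -[X in _ --> X]subr0; apply: cvgB => //; exact: cvg_cst.
  apply/funext => n; rewrite (_ : n.+1%:R = n.+2%:R - 1); last by rewrite -[n.+2%:R]natr1 addrK.
  by rewrite mulrBl divff ?pnatr_eq0// div1r.
- apply: cvgMl; apply: cvg_powR_1.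
  rewrite (_ : (fun N => _) = (fun N => 1 + a * N.+2%:R^-1)).
    rewrite -[X in _ --> X]addr0; apply: cvgD; first exact: cvg_cst.
    by rewrite -[X in _ --> X](mulr0 a); apply: cvgMr.
  by apply/funext => n; rewrite mulrDl divff ?pnatr_eq0.
Qed.

Lemma gauss_rec N a : (N.+1%:R + a != 0) ->
  gauss N.+1 a = gauss N.+1 (a + 1) * a / (1 + a / N.+1%:R).
Proof.
move=> Na0; have N0 : N.+1%:R != 0 :> R by rewrite pnatr_eq0.
have E : \prod_(j < N.+1) (a + j%:R) * (a + N.+1%:R) = a * \prod_(j < N.+1) (a + 1 + j%:R).
  rewrite -(big_ord_recr N.+1 (fun j => a + j%:R))/= big_ord_recl/= addr0; congr (_ * _).
  by apply: eq_bigr => i _; rewrite /bump/= natrD addrA.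
have aN : a + N.+1%:R != 0 by rewrite addrC.
have f0 : N.+1`!%:R != 0 :> R by rewrite pnatr_eq0 -lt0n fact_gt0.
rewrite /gauss; have -> : \prod_(j < N.+1) (a + j%:R) = a * \prod_(j < N.+1) (a + 1 + j%:R) / (a + N.+1%:R).
  by rewrite -E mulfK.
have -> : 1 - a = (1 - (a + 1)) + 1 by ring.
rewrite powRD ?N0 ?implybT// powRr1 ?ler0n//; field.
by rewrite nat1r f0 N0 Na0.
Qed.

(** The recursion in a carries the limit from a + k > 0 back to a. *)
Lemma gauss_cvg a : gauss N a @[N --> \oo] --> (Gamma a)^-1.
Proof.
have [k ka] : exists k : nat, 0 < a + k%:R.
  exists (Num.truncn (- a)).+1; have := truncnS_gt (- a); lra.
elim: k a ka => [|k IH] a ka; first by apply: gauss_cvg_pos; rewrite addr0 in ka.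
have := IH (a + 1) _; rewrite -addrA nat1r => /(_ ka) {}IH.
have C : gauss N.+1 (a + 1) * a / (1 + a / N.+1%:R) @[N --> \oo] --> a / Gamma (a + 1).
  rewrite mulrC -[X in _ --> X]divr1; apply: cvgM.
    by apply: cvgMl; move: IH; rewrite -cvg_shiftS.
  apply: cvgV; first exact: oner_neq0.
  rewrite -[X in _ --> X]addr0; apply: cvgD; first exact: cvg_cst.
  rewrite -[X in _ --> X](mulr0 a); apply: cvgMr; exact: cvg_harmonic.
rewrite GammaV_rec -cvg_shiftS; apply: cvg_trans C; apply: near_eq_cvg; near=> N => /=.
suff h : N.+1%:R + a != 0 by rewrite [RHS]gauss_rec.
have : - a < N%:R by near: N; exact: nbhs_infty_gtr.
by move=> Na; rewrite gt_eqF// -natr1; lra.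
Unshelve. all: by end_near. Qed.

Lemma gauss_cvg2 a : gauss n.+2 a @[n --> \oo] --> (Gamma a)^-1.
Proof.
by have := @gauss_cvg a; rewrite -cvg_shiftS -(cvg_shiftS (fun n => gauss n.+1 _)).
Qed.

(** As long as N <= b the product is the term b^N / N! of the exponential
    series; all later factors are 1. *)
Lemma prod_max1_le (b : R) N : 0 < b ->
  \prod_(j < N) Num.max 1 (b / j.+1%:R) <= expR b.
Proof.
move=> b0; elim: N => [|N IH]; first by rewrite big_ord0 -expR0 ler_expR ltW.
have [Nb|bN] := leP N.+1%:R b; last first.
  rewrite big_ord_recr/= max_l ?mulr1// ler_pdivrMr ?ltr0n// mul1r ltW//.
apply: le_trans (_ : 1 + b ^+ N.+1 / N.+1`!%:R <= _); last exact/expR_ge1Dxn/ltW.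
apply: le_trans (_ : b ^+ N.+1 / N.+1`!%:R <= _); last by rewrite lerDr.
rewrite le_eqVlt; apply/orP; left; apply/eqP.
elim: {IH}N Nb => [|N IH] Nb.
  by rewrite big_ord_recl big_ord0 mulr1 expr1 max_r ?divr1.
rewrite big_ord_recr/= IH; last by apply: le_trans Nb; rewrite ler_nat.
rewrite max_r ?ler_pdivlMr ?ltr0n ?mul1r// [in RHS]factS natrM [in RHS]exprSr.
by rewrite mulrACA invfM [X in _ = _ * X]mulrC.
Qed.

(** A reflection formula: up to sign gauss N (- b) * gauss N b is b^2 times a
    partial product of 1 - b^2 / j^2, whose factors beyond j = b are at most 1,
    and gauss N b is bounded below by gauss_ge. *)
Lemma gauss_neg_bound (b : R) N : 0 < b ->
  `|gauss N.+2 (- b)| <= b ^+ 2 * expR (2 * b) * 2 `^ b * Gamma b.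
Proof.
move=> b0.
have refl : `|gauss N.+2 (- b)| * gauss N.+2 b =
    b ^+ 2 * \prod_(j < N.+1) `|1 - (b / j.+1%:R) ^+ 2|.
  have N0 : N.+2%:R != 0 :> R by rewrite pnatr_eq0.
  have fE : N.+1`!%:R = \prod_(j < N.+1) j.+1%:R :> R.
    rewrite fact_prod big_add1 big_mkord natr_prod.
    by apply: eq_bigr.
  have f0 : N.+1`!%:R != 0 :> R by rewrite pnatr_eq0 -lt0n fact_gt0.
  rewrite /gauss !normrM normfV !(ger0_norm (powR_ge0 _ _)) normr_nat normr_prod.
  have -> : \prod_(j < N.+1) `|1 - (b / j.+1%:R) ^+ 2| =
     \prod_(j < N.+1) (`|- b + j.+1%:R| * (b + j.+1%:R)) / N.+1`!%:R ^+ 2.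
    rewrite fE -prodrXl -prodfV -big_split/=; apply: eq_bigr => j _.
    have j0 : 0 < j.+1%:R :> R by rewrite ltr0n.
    have bj0 : 0 <= b + j.+1%:R by rewrite addr_ge0 ?ltW.
    have -> : 1 - (b / j.+1%:R) ^+ 2 = (- b + j.+1%:R) * (b + j.+1%:R) * (j.+1%:R ^+ 2)^-1.
      by field; rewrite nat1r gt_eqF.
    rewrite !normrM (ger0_norm bj0) [X in _ * X]ger0_norm ?invr_ge0 ?exprn_ge0 ?(ltW j0)//.
  have -> : \prod_(j < N.+1) (`|- b + j.+1%:R| * (b + j.+1%:R)) =
      \prod_(j < N.+1) `|- b + j.+1%:R| * \prod_(j < N.+1) (b + j.+1%:R).
    by rewrite big_split.
  rewrite !(big_ord_recl N.+1)/= !addr0.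
  rewrite normrN (gtr0_norm b0) factS natrM opprK.
  have -> : N.+2%:R `^ (1 + b) = N.+2%:R * N.+2%:R `^ b :> R.
    by rewrite powRD ?N0 ?implybT// powRr1 ?ler0n.
  have -> : N.+2%:R `^ (1 - b) = N.+2%:R / N.+2%:R `^ b :> R.
    by rewrite powRB ?N0 ?implybT// powRr1 ?ler0n.
  have Nb0 : N.+2%:R `^ b != 0 :> R by rewrite gt_eqF// powR_gt0// ltr0n.
  have -> : \prod_(i < N.+1) `|- b + (bump 0 i)%:R| = \prod_(i < N.+1) `|- b + i.+1%:R| by [].
  have -> : \prod_(i < N.+1) (b + (bump 0 i)%:R) = \prod_(i < N.+1) (b + i.+1%:R) by [].
  field.
  by rewrite -natrD f0 Nb0 N0.
have g0 : 2 `^ (- b) / Gamma b <= gauss N.+2 b.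
  apply: le_trans (gauss_ge _ b0); rewrite ler_pM2r ?invr_gt0 ?Gamma_gt0//.
  have -> : 2 `^ (- b) = 2^-1 `^ b :> R by rewrite -[2^-1]powR_inv1// -powRrM mulN1r.
  apply: ge0_ler_powR; rewrite ?nnegrE ?invr_ge0 ?divr_ge0 ?ler0n ?(ltW b0)//.
  rewrite ler_pdivlMr ?ltr0n// -[N.+2%:R]natr1 -[N.+1%:R]natr1.
  by have := ler0n R N; lra.
have pb : \prod_(j < N.+1) `|1 - (b / j.+1%:R) ^+ 2| <= expR (2 * b).
  apply: (@le_trans _ _ (\prod_(j < N.+1) (Num.max 1 (b / j.+1%:R)) ^+ 2)).
    apply: ler_prod => j _; rewrite normr_ge0/=.
    have s0 : 0 <= b / j.+1%:R by rewrite divr_ge0 ?(ltW b0).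
    set s := b / _ in s0 *.
    have [s1|s1] := leP s 1; first by rewrite expr1n ger0_norm; nra.
    by rewrite ltr0_norm; nra.
  rewrite prodrXl (_ : expR (2 * b) = expR b ^+ 2); last by rewrite -expRM_natl.
  rewrite lerXn2r ?nnegrE ?expR_ge0 ?prod_max1_le//.
  by apply: prodr_ge0 => j _; rewrite le_max ler01.
have P2 : 0 < 2 `^ b :> R by rewrite powR_gt0.
have G0 := Gamma_gt0 b0.
have g1 : 0 < 2 `^ (- b) / Gamma b by rewrite divr_gt0 ?powR_gt0.
rewrite -(ler_pM2r g1); apply: (@le_trans _ _ (b ^+ 2 * expR (2 * b))).
  apply: (@le_trans _ _ (`|gauss N.+2 (- b)| * gauss N.+2 b)).
    by rewrite ler_wpM2l.
  by rewrite refl ler_wpM2l// exprn_ge0 ?(ltW b0).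
by rewrite powRN le_eqVlt; apply/orP; left; apply/eqP; field; rewrite !gt_eqF.
Qed.

End gauss_limit.

(** * Exponential generating functions *)
Section egf.
Context {R : realType}.
Implicit Types (m b u v : nat -> R) (x y z q : R).

Lemma ratio_geometric_bound u v l q : (forall n, 0 <= u n) ->
  (\forall n \near \oo, u n.+1 <= v n * u n) -> v @ \oo --> l -> l < q -> 0 < q ->
  exists2 D, 0 <= D & forall n, u n <= D * q ^+ n.
Proof.
move=> u0 uv vl lq q0.
have [N _ HN] : \forall n \near \oo, u n.+1 <= q * u n.
  near=> n; apply: (@le_trans _ _ (v n * u n)); first by near: n.
  rewrite ler_wpM2r//; near: n; exact: (cvgr_le l).
have t0 i : 0 <= u i / q ^+ i by rewrite divr_ge0// exprn_ge0// ltW.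
exists (\sum_(i < N.+1) u i / q ^+ i); first by rewrite sumr_ge0.
have small n : (n <= N)%N -> u n <= (\sum_(i < N.+1) u i / q ^+ i) * q ^+ n.
  move=> nN; rewrite -ler_pdivrMr ?exprn_gt0//.
  have nN1 : (n < N.+1)%N by [].
  by rewrite (bigD1 (Ordinal nN1))//= lerDl sumr_ge0.
move=> n; have [/small//|/ltnW Nn] := leqP n N.
rewrite -(subnKC Nn); elim: (n - N)%N => [|k IH]; first by rewrite addn0 small.
rewrite addnS exprS mulrCA; apply: le_trans (HN _ (leq_addr _ _)) _.
by rewrite ler_wpM2l// ltW.
Unshelve. all: by end_near. Qed.

(** The coefficients m n of an exponential generating function
    sum m n x^n / n! with infinite radius of convergence. *)
Definition entire_coef m :=
  forall q, 0 < q -> exists2 D, 0 <= D & forall n, `|m n| / n`!%:R <= D * q ^+ n.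

Definition egf_coef m x n := m n / n`!%:R * x ^+ n.

Definition egf m x := limn (series (egf_coef m x)).

Lemma entire_coef_le m b : (forall n, `|m n| <= `|b n|) -> entire_coef b -> entire_coef m.
Proof.
move=> mb eb q q0; have [D D0 H] := eb q q0; exists D => // n.
by apply: le_trans (H n); rewrite ler_wpM2r ?invr_ge0.
Qed.

Lemma entire_coef_geometric m (D q : R) : 0 <= D -> 0 <= q ->
  (forall n, `|m n| <= D * q ^+ n) -> entire_coef m.
Proof.
move=> D0 q0 H p p0; exists (D * expR (q / p)); first by rewrite mulr_ge0 ?expR_ge0.
move=> n; have f0 : 0 < n`!%:R :> R by rewrite ltr0n fact_gt0.
apply: (@le_trans _ _ (D * q ^+ n / n`!%:R)); first by rewrite ler_wpM2r ?invr_ge0.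
rewrite -!mulrA ler_wpM2l// -ler_pdivrMr ?exprn_gt0//.
rewrite mulrAC -expr_div_n; set s := q / p.
have s0 : 0 <= s by rewrite divr_ge0// ltW.
case: n {H f0} => [|n]; first by rewrite expr0 fact0 divr1 -expR0 ler_expR.
by apply: le_trans (expR_ge1Dxn n s0); rewrite lerDr.
Qed.

Lemma entire_coef_shift m : entire_coef m -> entire_coef (fun n => m n.+1).
Proof.
move=> em q q0; have q20 : 0 < q / 2 by rewrite divr_gt0.
have [D D0 H] := em _ q20; exists (D * q) => [|n]; first by rewrite mulr_ge0// ltW.
have f0 : 0 < n`!%:R :> R by rewrite ltr0n fact_gt0.
have n10 : 0 < n.+1%:R :> R by rewrite ltr0n.
have -> : `|m n.+1| / n`!%:R = n.+1%:R * (`|m n.+1| / n.+1`!%:R).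
  by rewrite factS natrM; field; rewrite nat1r !gt_eqF.
apply: (@le_trans _ _ (n.+1%:R * (D * (q / 2) ^+ n.+1))).
  by rewrite ler_wpM2l// ltW.
rewrite mulrCA -mulrA ler_wpM2l// -exprS expr_div_n.
rewrite mulrCA ler_piMr ?exprn_ge0 ?(ltW q0)// ler_pdivrMr ?exprn_gt0// mul1r -natrX ler_nat.
exact: ltnW (ltn_expl _ _).
Qed.

Lemma entire_coef_mulX m : entire_coef m -> entire_coef (fun n => n%:R * m n.-1).
Proof.
move=> em q q0; have [D D0 H] := em _ q0.
exists (D / q) => [|[|n]]; first by rewrite divr_ge0// ltW.
  by rewrite mul0r normr0 mul0r mulr1 divr_ge0// ltW.
rewrite exprS mulrA divfK ?gt_eqF//=; apply: le_trans (H n).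
have f0 : 0 < n`!%:R :> R by rewrite ltr0n fact_gt0.
have n10 : 0 < n.+1%:R :> R by rewrite ltr0n.
rewrite normrM normr_nat factS natrM le_eqVlt; apply/orP; left; apply/eqP.
by field; rewrite nat1r !gt_eqF.
Qed.

Lemma is_cvg_egf_norm m x : entire_coef m -> cvgn [normed series (egf_coef m x)].
Proof.
move=> em; pose q := (2 * (`|x| + 1))^-1.
have x1 : 0 < `|x| + 1 by rewrite ltr_wpDl.
have q0 : 0 < q by rewrite invr_gt0 mulr_gt0.
have [D D0 H] := em _ q0.
have qx : q * `|x| <= 2^-1.
  rewrite /q invfM -mulrA ler_piMr ?invr_ge0// mulrC ler_pdivrMr// mul1r; lra.
apply: (@series_le_cvg _ _ (geometric D 2^-1)) => [n|n|n|].
- exact: normr_ge0.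
- by rewrite /= mulr_ge0// exprn_ge0// invr_ge0.
- rewrite /egf_coef /= !normrM normfV normr_nat normrX.
  apply: (@le_trans _ _ (D * q ^+ n * `|x| ^+ n)); first by rewrite ler_wpM2r ?exprn_ge0.
  rewrite -mulrA -exprMn ler_wpM2l// lerXn2r// ?nnegrE ?invr_ge0//.
  by rewrite mulr_ge0// ltW.
- apply: is_cvg_geometric_series; rewrite ger0_norm ?invr_ge0// invf_lt1//.
  by rewrite ltr1n.
Qed.

Lemma is_cvg_egf m x : entire_coef m -> cvgn (series (egf_coef m x)).
Proof. by move=> em; apply: normed_cvg; exact: is_cvg_egf_norm. Qed.

Lemma is_derive_egf m x : entire_coef m ->
  is_derive x (1 : R) (egf m) (egf (fun n => m n.+1) x).
Proof.
move=> em; pose c n := m n / n`!%:R.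
have dE k : pseries_diffs (fun n => k n / n`!%:R) = fun n => k n.+1 / n`!%:R :> R.
  apply/funext => n; rewrite /pseries_diffs factS natrM; field.
  by rewrite nat1r !pnatr_eq0 -lt0n fact_gt0.
have C k y : entire_coef k -> cvgn (pseries (fun n => k n / n`!%:R) y).
  by move=> /is_cvg_egf; exact.
have := @pseries_snd_diffs R c (`|x| + 1) x.
rewrite /c dE => H; apply: H; first exact: C.
- exact/C/entire_coef_shift.
- rewrite (dE (fun n => m n.+1)); apply: C.
  exact/(@entire_coef_shift (fun n => m n.+1))/entire_coef_shift.
- by rewrite [ltRHS]ger0_norm ?addr_ge0// ltrDl.
Qed.

Lemma continuous_egf m : entire_coef m -> continuous (egf m).
Proof.
move=> em x; have [? _] := @is_derive_egf _ x em.
exact/differentiable_continuous/derivable1_diffP.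
Qed.

Lemma egf0 m : egf m 0 = m 0%N.
Proof.
apply/cvg_lim => //; apply: cvg_near_cst; exists 1%N => // -[//|n] _.
rewrite /series/= big_nat_recl// big1 ?addr0.
  by rewrite /egf_coef fact0 divr1 expr0 mulr1.
by move=> i _; rewrite /egf_coef expr0n/= mulr0.
Qed.

Lemma egf_lin (a b : R) m1 m2 x : entire_coef m1 -> entire_coef m2 ->
  egf (fun n => a * m1 n + b * m2 n) x = a * egf m1 x + b * egf m2 x.
Proof.
move=> e1 e2; have C1 := @is_cvg_egf _ x e1; have C2 := @is_cvg_egf _ x e2.
apply/cvg_lim => //.
rewrite (_ : series _ = (fun n => a * series (egf_coef m1 x) n + b * series (egf_coef m2 x) n)).
  by apply: cvgD; apply: cvgMr.
apply/funext => n; rewrite /series/= !mulr_sumr -big_split/=.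
by apply: eq_bigr => i _; rewrite /egf_coef; ring.
Qed.

Lemma entire_coef_lin (a b : R) m1 m2 : entire_coef m1 -> entire_coef m2 ->
  entire_coef (fun n => a * m1 n + b * m2 n).
Proof.
move=> e1 e2 q q0; have [D1 D10 H1] := e1 q q0; have [D2 D20 H2] := e2 q q0.
exists (`|a| * D1 + `|b| * D2) => [|n]; first by rewrite addr_ge0// mulr_ge0.
have f0 : 0 <= n`!%:R^-1 :> R by rewrite invr_ge0.
apply: (@le_trans _ _ ((`|a| * `|m1 n| + `|b| * `|m2 n|) / n`!%:R)).
  by rewrite ler_wpM2r// -!normrM ler_normD.
by rewrite !mulrDl -!mulrA lerD// ler_wpM2l.
Qed.

Lemma entire_coef0 : entire_coef (fun=> 0).
Proof. by move=> q q0; exists 0 => // n; rewrite normr0 !mul0r. Qed.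

Lemma entire_coef_sum N (p : nat -> R) (m : nat -> nat -> R) :
  (forall j, entire_coef (m j)) ->
  entire_coef (fun n => \sum_(j < N) p j * m j n).
Proof.
move=> em; elim: N => [|N IH].
  by under eq_fun do rewrite big_ord0; exact: entire_coef0.
have := entire_coef_lin 1 (p N) IH (em N); congr entire_coef.
by apply/funext => n; rewrite mul1r big_ord_recr.
Qed.

Lemma egf_sum N (p : nat -> R) (m : nat -> nat -> R) x :
  (forall j, entire_coef (m j)) ->
  egf (fun n => \sum_(j < N) p j * m j n) x = \sum_(j < N) p j * egf (m j) x.
Proof.
move=> em; elim: N => [|N IH].
  rewrite big_ord0; apply/cvg_lim => //; apply: cvg_near_cst.
  by apply: nearW => n; rewrite /series/= big1// => i _; rewrite /egf_coef big_ord0 !mul0r.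
rewrite big_ord_recr/= -IH -[X in _ = X + _]mul1r -egf_lin//; last exact: entire_coef_sum.
by congr (egf _ x); apply/funext => n; rewrite mul1r big_ord_recr.
Qed.

Lemma egf_mulX m x : entire_coef m -> x * egf m x = egf (fun n => n%:R * m n.-1) x.
Proof.
move=> em; apply/esym/cvg_lim => //; rewrite -cvg_shiftS.
rewrite (_ : [sequence _]_n = (fun n => x * series (egf_coef m x) n)).
  by apply: cvgMr; exact: is_cvg_egf.
apply/funext => n; rewrite /series/= big_nat_recl// /egf_coef !mul0r add0r mulr_sumr.
apply: eq_bigr => i _; rewrite factS natrM exprS/=; field.
by rewrite nat1r !pnatr_eq0 -lt0n fact_gt0.
Qed.

Lemma egf1 x : egf (fun=> 1) x = expR x.
Proof.
rewrite /egf expRE /pseries; congr (limn _); congr (series _); apply/funext => n.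
by rewrite /egf_coef mul1r.
Qed.

Lemma entire_coef1 : entire_coef (fun=> 1).
Proof.
apply: (@entire_coef_geometric _ 1 1) => // n.
by rewrite expr1n mulr1 normr1.
Qed.

Lemma entire_coef_ffact j : entire_coef (fun k => (k ^_ j)%:R).
Proof.
elim: j => [|j IH].
  by under eq_fun do rewrite ffactn0; exact: entire_coef1.
have := entire_coef_mulX IH; congr entire_coef; apply/funext => -[|k].
  by rewrite mul0r ffact0n.
by rewrite -natrM ffactSS.
Qed.

Lemma egf_ffact j x : egf (fun k => (k ^_ j)%:R) x = x ^+ j * expR x.
Proof.
elim: j => [|j IH].
  by rewrite mul1r -egf1; congr (egf _ x); apply/funext => k; rewrite ffactn0.
rewrite exprS -mulrA -IH egf_mulX; last exact: entire_coef_ffact.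
congr (egf _ x); apply/funext => -[|k]; first by rewrite mul0r ffact0n.
by rewrite -natrM ffactSS.
Qed.

Lemma egf_tail_le m b x K : (forall n, `|m n| <= b n) -> entire_coef b ->
  `|egf m x - series (egf_coef m x) K| <= egf b `|x| - series (egf_coef b `|x|) K.
Proof.
move=> mb eb.
have em : entire_coef m.
  by apply: entire_coef_le eb => n; exact: le_trans (ler_norm _).
have Cm := @is_cvg_egf _ x em; have Cb := @is_cvg_egf _ `|x| eb.
have L1 : series (egf_coef m x) N - series (egf_coef m x) K @[N --> \oo] -->
    egf m x - series (egf_coef m x) K.
  by apply: cvgB; [exact: Cm|exact: cvg_cst].
have L2 : series (egf_coef b `|x|) N - series (egf_coef b `|x|) K @[N --> \oo] -->
    egf b `|x| - series (egf_coef b `|x|) K.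
  by apply: cvgB; [exact: Cb|exact: cvg_cst].
apply: (ler_cvg_to (cvg_norm L1) L2).
near=> N; have KN : (K <= N)%N by near: N; exact: nbhs_infty_ge.
rewrite !sub_series_geq//; apply: (le_trans (ler_norm_sum _ _ _)); apply: ler_sum => i _.
by rewrite /egf_coef !normrM normfV normr_nat normrX ler_wpM2r ?exprn_ge0// ler_wpM2r.
Unshelve. all: by end_near. Qed.

Lemma egf_norm_le m b x : (forall n, `|m n| <= b n) -> entire_coef b ->
  `|egf m x| <= egf b `|x|.
Proof.
move=> mb eb; have := @egf_tail_le _ _ x 0 mb eb.
by rewrite /series/= !big_geq// !subr0.
Qed.

Lemma egf_ge0_homo b x y : (forall n, 0 <= b n) -> entire_coef b ->
  0 <= x -> x <= y -> egf b x <= egf b y.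
Proof.
move=> b0 eb x0 xy; apply: lim_series_le; [exact: is_cvg_egf..|].
move=> n; rewrite /egf_coef ler_wpM2l ?divr_ge0// lerXn2r// nnegrE//.
exact: le_trans xy.
Qed.

Lemma egf_geometric_bound m (D q x : R) : 0 <= D -> 0 <= q ->
  (forall n, `|m n| <= D * q ^+ n) -> `|egf m x| <= D * expR (q * `|x|).
Proof.
move=> D0 q0 H.
have eb : entire_coef (fun n => D * q ^+ n).
  apply: (@entire_coef_geometric _ D q) => // n.
  by rewrite ger0_norm// mulr_ge0// exprn_ge0.
apply: (le_trans (@egf_norm_le _ _ x H eb)).
rewrite le_eqVlt; apply/orP; left; apply/eqP.
rewrite -egf1; apply/cvg_lim => //.
rewrite (_ : series _ = (fun n => D * series (egf_coef (fun=> 1) (q * `|x|)) n)).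
  by apply: cvgMr; exact: (@is_cvg_egf _ _ entire_coef1).
apply/funext => n; rewrite /series/= !mulr_sumr.
by apply: eq_bigr => i _; rewrite /egf_coef exprMn; ring.
Qed.

(** Tannery's theorem. *)
Lemma egf_cvg (u : nat -> nat -> R) v b x : (forall n k, `|u n k| <= b k) ->
  entire_coef b -> (forall k, u n k @[n --> \oo] --> v k) ->
  egf (u n) x @[n --> \oo] --> egf v x.
Proof.
move=> ub eb uv.
have vb k : `|v k| <= b k.
  have L : (b k) @[_ --> \oo] --> b k by exact: cvg_cst.
  by apply: (ler_cvg_to (cvg_norm (uv k)) L); apply: nearW => n; exact: ub.
apply/cvgrPdist_le => e e0.
have e30 : 0 < e / 3 by rewrite divr_gt0.
have Cb := @is_cvg_egf _ `|x| eb.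
have [K _ HK] : \forall K \near \oo, egf b `|x| - series (egf_coef b `|x|) K <= e / 3.
  move/cvgrPdist_le : Cb => /(_ _ e30); apply: filterS => K; exact/le_trans/ler_norm.
have {}HK := HK K (leqnn K).
have fin : series (egf_coef (u n) x) K @[n --> \oo] --> series (egf_coef v x) K.
  elim: K {HK} => [|K IH].
    rewrite (_ : (fun n => _) = fun=> 0); last by apply/funext => n; rewrite /series/= big_geq.
    by rewrite /series/= big_geq//; exact: cvg_cst.
  rewrite (_ : (fun n => _) = fun n => series (egf_coef (u n) x) K + egf_coef (u n) x K).
    rewrite /series/= big_nat_recr//=; apply: cvgD; first exact: IH.
    by apply: cvgMl; apply: cvgMl; exact: uv.
  by apply/funext => n; rewrite /series/= big_nat_recr.
move/cvgrPdist_le : fin => /(_ _ e30); apply: filterS => n Hn.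
have h1 := @egf_tail_le _ _ x K vb eb.
have h2 := @egf_tail_le _ _ x K (ub n) eb.
set A := egf v x in h1 *; set B := egf (u n) x in h2 *.
set a := series _ K in h1 Hn; set b' := series (egf_coef (u n) x) K in h2 Hn.
rewrite (_ : A - B = (A - a) + (a - b') - (B - b')); last by ring.
apply: (le_trans (ler_normB _ _)); apply: (@le_trans _ _ (e / 3 + e / 3 + e / 3)); last by lra.
rewrite lerD ?(le_trans h2)//; apply: (le_trans (ler_normD _ _)).
by rewrite lerD// (le_trans h1).
Qed.

End egf.

(** * The Wright function *)
Section wright_coefficients.
Context {R : realType}.
Implicit Types (x y z t q p : R).
Variables (rho : R).
Hypothesis rho01 : 0 < rho < 1.

(** The bound of gauss_neg_bound. *)
Let B x : R := x ^+ 2 * expR (2 * x) * 2 `^ x * Gamma x.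

(** B (rho k - mu) grows by a factor of order k^rho when k increases by 1, and
    rho < 1, so that it is negligible against k!. *)
Let B_ratio x : rho <= x ->
  B (x + rho) <= 4 * expR (2 * rho) * 2 `^ rho * (x + rho) `^ rho * B x.
Proof.
have /andP[rho0 _] := rho01.
move=> rx; have x0 : 0 < x := lt_le_trans rho0 rx.
have G := Gamma_shift_le x0 (ltW rho0).
have Gx := Gamma_gt0 x0.
have p2 : 0 < 2 `^ x :> R by rewrite powR_gt0.
have p2r : 0 < 2 `^ rho :> R by rewrite powR_gt0.
have e1 := expR_gt0 (2 * x); have e2 := expR_gt0 (2 * rho).
have sq : (x + rho) ^+ 2 <= 4 * x ^+ 2 by nra.
rewrite /B mulrDr expRD powRD; last by rewrite pnatr_eq0 implybT.
have x20 : 0 <= x ^+ 2 by exact: sqr_ge0.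
have xr0 := addr_gt0 x0 rho0; have Gxr := Gamma_gt0 xr0.
set c := (x + rho) `^ rho in G *; have c0 : 0 <= c := powR_ge0 _ _.
have -> : 4 * expR (2 * rho) * 2 `^ rho * c * (x ^+ 2 * expR (2 * x) * 2 `^ x * Gamma x) =
  (4 * x ^+ 2) * (expR (2 * x) * expR (2 * rho)) * (2 `^ x * 2 `^ rho) * (c * Gamma x) by ring.
rewrite ler_pM ?ler_wpM2r ?mulr_ge0 ?sqr_ge0 ?(ltW p2) ?(ltW p2r) ?(ltW e1) ?(ltW e2) ?(ltW xr0) ?(ltW Gxr)//.
Qed.

Variable mu : R.

(** The domination behind Tannery's theorem: gauss_neg_bound for mu < rho k, and
    the boundedness of a convergent sequence for the finitely many other k. *)
Lemma gauss_dominated : exists2 b : nat -> R, entire_coef b &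
  forall n k, `|gauss n.+2 (mu - rho * k%:R)| <= b k.
Proof.
have /andP[rho0 rho1] := rho01.
have : forall k, exists C, (forall n, `|gauss n.+2 (mu - rho * k%:R)| <= C) /\
    (mu < rho * k%:R -> C = B (rho * k%:R - mu)).
  move=> k; have [muk|muk] := ltP mu (rho * k%:R).
    exists (B (rho * k%:R - mu)); split=> // n.
    have b0 : 0 < rho * k%:R - mu by rewrite subr_gt0.
    by have := gauss_neg_bound n b0; rewrite opprB.
  have C : cvgn (fun n => gauss n.+2 (mu - rho * k%:R)).
    apply/cvg_ex; exists (Gamma (mu - rho * k%:R))^-1.
    by have := @gauss_cvg _ (mu - rho * k%:R);
      rewrite -cvg_shiftS -(cvg_shiftS (fun n => gauss n.+1 _)).
  have [M [_ HM]] := cvg_seq_bounded C.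
  by exists (M + 1); split => // n; apply: HM => //; rewrite ltrDl.
move=> /choice[b Hb]; exists b; last by move=> n k; have [->] := Hb k.
have b0 k : 0 <= b k by have [/(_ 0%N) + _] := Hb k; apply: le_trans.
move=> q q0.
pose C : R := 4 * expR (2 * rho) * 2 `^ rho * (1 + `|mu|) `^ rho.
have m1 : 0 < 1 + `|mu| by rewrite ltr_wpDr.
have C0 : 0 <= C by rewrite !mulr_ge0 ?expR_ge0 ?powR_ge0.
have v0 : C * n.+1%:R `^ (- (1 - rho)) @[n --> \oo] --> 0.
  by rewrite -[X in _ --> X](mulr0 C); apply: cvgMr; apply: cvg_powR_natN; rewrite subr_gt0.
apply: (ratio_geometric_bound _ _ v0 q0 q0) => [n|]; first by rewrite divr_ge0.
near=> k; have n10 : 0 < k.+1%:R :> R by rewrite ltr0n.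
have muk : mu + rho <= rho * k%:R.
  rewrite mulrC -ler_pdivrMr//; near: k; exact: nbhs_infty_ger.
have kmu : mu < rho * k%:R by lra.
have kmu1 : mu < rho * k.+1%:R by rewrite -natr1 mulrDr mulr1; lra.
rewrite !ger0_norm//.
have [_ ->//] := Hb k; have [_ ->//] := Hb k.+1.
have f0 : 0 < k`!%:R :> R by rewrite ltr0n fact_gt0.
set x := rho * k%:R - mu; have rx : rho <= x by rewrite /x; lra.
have x0 : 0 < x by lra.
have -> : rho * k.+1%:R - mu = x + rho by rewrite /x -natr1; ring.
have Bx0 : 0 <= B x by rewrite /B !mulr_ge0 ?sqr_ge0 ?expR_ge0 ?powR_ge0 ?ltW ?Gamma_gt0.
rewrite factS natrM ler_pdivrMr ?mulr_gt0//.
apply: (le_trans (B_ratio rx)).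
have -> : C * k.+1%:R `^ (- (1 - rho)) * (B x / k`!%:R) * (k.+1%:R * k`!%:R) =
   4 * expR (2 * rho) * 2 `^ rho * ((1 + `|mu|) * k.+1%:R) `^ rho * B x.
  rewrite opprB powRB ?(gt_eqF n10) ?implybT// powRr1 ?ltW// /C powRM ?ltW//.
  by field; rewrite nat1r !gt_eqF.
rewrite ler_wpM2r// ler_wpM2l ?mulr_ge0 ?expR_ge0 ?powR_ge0//.
apply: ge0_ler_powR; rewrite ?nnegrE ?mulr_ge0 ?(ltW rho0) ?(ltW m1)//; first by lra.
rewrite /x -natr1; have := ler_norm (- mu); rewrite normrN => h.
have := ler0n R k; have := normr_ge0 mu; nra.
Unshelve. all: by end_near. Qed.

Lemma entire_rGamma : entire_coef (fun k => (@Gamma R (mu - rho * k%:R))^-1).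
Proof.
have [b eb H] := gauss_dominated; apply: entire_coef_le eb => k.
apply: le_trans (ler_norm _).
have L : (b k) @[_ --> \oo] --> b k by exact: cvg_cst.
apply: (ler_cvg_to (cvg_norm (@gauss_cvg2 _ (mu - rho * k%:R))) L).
by apply: nearW => n; exact: H.
Qed.

End wright_coefficients.

Lemma WrightE (R : realType) (rho mu z : R) :
  Wright (- rho) mu z = egf (fun k => (Gamma (mu - rho * k%:R))^-1) z.
Proof.
rewrite /Wright /egf; congr (limn _); congr (series _); apply/funext => n.
by rewrite /egf_coef invfM mulNr [- _ + mu]addrC; ring.
Qed.

Section wright_approximants.
Context {R : realType}.
Implicit Types (x y z t s : R).
Local Notation leb := (@lebesgue_measure R).
Variables (rho mu : R).
Hypothesis rho01 : 0 < rho < 1.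

(** Coefficients of the polynomials in the Post-Widder inversion of the Laplace
    transform lam^(-mu) e^(-t lam^rho): with D = - d/dlam,
    D^n (lam^(-mu) e^(-t lam^rho)) is lam^(-mu-n) e^(-t lam^rho) times
    sum_j (approx_coef n j) (t lam^rho)^j. *)
Fixpoint approx_coef n (j : nat) : R :=
  if n is n'.+1 then
    (mu + n'%:R - rho * j%:R) * approx_coef n' j +
    rho * (if j is j'.+1 then approx_coef n' j' else 0)
  else (j == 0%N)%:R.

Lemma approx_coef_gt n j : (n < j)%N -> approx_coef n j = 0.
Proof.
elim: n j => [|n IH] [|j] //= nj; rewrite IH ?mulr0 ?add0r; last exact: ltnW.
by rewrite IH ?mulr0.
Qed.

(** mu + n - rho j >= 0 for j <= n: this is the complete monotonicity of
    lam^(-mu) e^(-t lam^rho), and the source of all positivity below. *)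
Lemma approx_coef_ge0 n j : 0 <= mu -> 0 <= approx_coef n j.
Proof.
have /andP[rho0 rho1] := rho01.
move=> mu0; elim: n j => [|n IH] j /=; first exact: ler0n.
have h : 0 <= rho * (if j is j'.+1 then approx_coef n j' else 0).
  by rewrite mulr_ge0 ?(ltW rho0)//; case: j.
rewrite addr_ge0//; have [jn|nj] := leqP j n; last by rewrite approx_coef_gt ?mulr0.
rewrite mulr_ge0// -addrA addr_ge0// subr_ge0.
by apply: (@le_trans _ _ j%:R); rewrite ?ler_nat// ler_piMl ?(ltW rho1).
Qed.

(** On sequences with F (j + 1) = (s + j) F j the recursion of approx_coef acts as
    a scalar. Falling factorials with s = - k give the power series of the
    approximants, and F j = Gamma (s + j) gives their Mellin transforms. *)
Lemma approx_coef_sum n (F : nat -> R) s : (forall j, F j.+1 = (s + j%:R) * F j) ->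
  \sum_(j < n.+1) approx_coef n j * F j = \prod_(i < n) (mu + rho * s + i%:R) * F 0%N.
Proof.
move=> FS; elim: n => [|n IH].
  by rewrite big_ord_recl !big_ord0 /= addr0.
rewrite [in RHS]big_ord_recr/= [in RHS]mulrAC -IH mulr_suml.
transitivity (\sum_(j < n.+2) ((mu + n%:R - rho * j%:R) * approx_coef n j * F j) +
    \sum_(j < n.+2) (rho * (if val j is j'.+1 then approx_coef n j' else 0) * F j)).
  by rewrite -big_split/=; apply: eq_bigr => j _; rewrite -mulrDl.
rewrite big_ord_recr/= approx_coef_gt// mulr0 mul0r addr0.
rewrite [X in _ + X]big_ord_recl/= mulr0 mul0r add0r -big_split/=.
by apply: eq_bigr => j _; rewrite FS; ring.
Qed.

Lemma approx_coef_ffact n k :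
  \sum_(j < n.+1) approx_coef n j * ((-1) ^+ j * (k ^_ j)%:R) =
  \prod_(i < n) (mu - rho * k%:R + i%:R).
Proof.
rewrite (@approx_coef_sum n (fun j => (-1) ^+ j * (k ^_ j)%:R) (- k%:R)).
  by rewrite mul1r ffactn0 mulr1 mulrN.
move=> j; have [kj|jk] := ltnP k j.
  by rewrite !ffact_small ?mulr0// ltnW.
by rewrite ffactnSr natrM natrB// exprS; ring.
Qed.

(** The Post-Widder approximant, rescaled by lam = N so that it tends to the
    Wright function at - t. *)
Definition wright_approx N t : R := N%:R `^ (1 - mu) / N`!%:R *
  (expR (- (t * N%:R `^ rho)) * \sum_(j < N.+1) approx_coef N j * (t * N%:R `^ rho) ^+ j).

Lemma wright_approx_ge0 N t : 0 <= mu -> 0 <= t -> 0 <= wright_approx N t.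
Proof.
move=> mu0 t0; rewrite /wright_approx !mulr_ge0 ?powR_ge0 ?invr_ge0 ?expR_ge0//.
apply: sumr_ge0 => j _; rewrite mulr_ge0 ?approx_coef_ge0// exprn_ge0//.
by rewrite mulr_ge0 ?powR_ge0.
Qed.

(** Expanding e^(-y) y^j in powers of - y produces falling factorials of the
    index, which approx_coef_ffact sums. *)
Lemma wright_approxE N t : (0 < N)%N ->
  wright_approx N t = egf (fun k => gauss N (mu - rho * k%:R)) (- t).
Proof.
move=> N0; have N00 : 0 < N%:R :> R by rewrite ltr0n.
set y := t * N%:R `^ rho.
have ent j : entire_coef (fun k => (-1) ^+ j * (k ^_ j)%:R : R).
  apply: entire_coef_le (entire_coef_ffact j) => k.
  by rewrite normrM normrX normrN1 expr1n mul1r.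
have -> : wright_approx N t = N%:R `^ (1 - mu) / N`!%:R *
    egf (fun k => \sum_(j < N.+1) approx_coef N j * ((-1) ^+ j * (k ^_ j)%:R)) (- y).
  rewrite /wright_approx (@egf_sum _ N.+1 (approx_coef N) (fun j k => (-1) ^+ j * (k ^_ j)%:R))// mulr_sumr -/y; congr (_ * _); apply: eq_bigr => j _.
  rewrite mulrCA; congr (_ * _).
  have := @egf_lin R ((-1) ^+ j) 0 _ _ (- y) (entire_coef_ffact j) entire_coef0.
  rewrite [X in _ = _ + X]mul0r addr0 egf_ffact => e.
  transitivity ((-1) ^+ j * ((- y) ^+ j * expR (- y))).
    by rewrite mulrA -exprMn mulN1r opprK mulrC.
  by rewrite -e; congr (egf _ _); apply/funext => k; rewrite mul0r addr0.
have ep : entire_coef (fun k => \prod_(i < N) (mu - rho * k%:R + i%:R)).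
  under eq_fun do rewrite -approx_coef_ffact.
  exact: (@entire_coef_sum _ N.+1 (approx_coef N) (fun j k => (-1) ^+ j * (k ^_ j)%:R)).
under eq_fun do rewrite approx_coef_ffact.
apply/esym/cvg_lim => //.
rewrite (_ : series _ = fun n => N%:R `^ (1 - mu) / N`!%:R *
    series (egf_coef (fun k => \prod_(i < N) (mu - rho * k%:R + i%:R)) (- y)) n).
  by apply: cvgMr; exact: is_cvg_egf.
apply/funext => n; rewrite /series/= mulr_sumr; apply: eq_bigr => k _.
rewrite /egf_coef /gauss /y.
have -> : 1 - (mu - rho * k%:R) = (1 - mu) + rho * k%:R by ring.
rewrite powRD ?(gt_eqF N00) ?implybT// powRrM powR_mulrn ?powR_ge0//.
have -> : - (t * N%:R `^ rho) = - t * N%:R `^ rho by ring.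
by rewrite exprMn; ring.
Qed.

Lemma wright_approx_cvg t :
  wright_approx n.+2 t @[n --> \oo] --> egf (fun k => (Gamma (mu - rho * k%:R))^-1) (- t).
Proof.
have [b eb H] := gauss_dominated rho01 mu.
under eq_fun do rewrite wright_approxE//.
apply: (egf_cvg H eb) => k; exact: gauss_cvg2.
Qed.

Lemma egf_rGamma_ge0 t : 0 <= mu -> 0 <= t ->
  0 <= egf (fun k => (Gamma (mu - rho * k%:R))^-1) (- t).
Proof.
move=> mu0 t0; have L := @wright_approx_cvg t.
have Z : (0 : R) @[_ --> \oo] --> (0 : R) by exact: cvg_cst.
by apply: (ler_cvg_to Z L); apply: nearW => n; exact: wright_approx_ge0.
Qed.

End wright_approximants.

Section gamma_scaling.
Context {R : realType}.
Implicit Types (x y z t s c : R).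
Local Notation leb := (@lebesgue_measure R).

Lemma integral_Gamma_scale x c : 0 < x -> 0 < c ->
  (\int[leb]_(t in `]0%R, +oo[) (t `^ (x - 1) * expR (- (c * t)))%:E =
   (c `^ (- x) * Gamma x)%:E)%E.
Proof.
move=> x0 c0; have mg : measurable_fun (`]0, +oo[%classic : set (measurableTypeR R))
    (fun t => (t `^ (x - 1) * expR (- t))%:E).
  by have /integrableP[] := integrable_gamma x0.
have g0 t : 0 < t -> (0 <= (t `^ (x - 1) * expR (- t))%:E)%E.
  by move=> _; rewrite lee_fin mulr_ge0 ?powR_ge0 ?expR_ge0.
have mgc : measurable_fun (`]0, +oo[%classic : set (measurableTypeR R))
    (fun t => (t `^ (x - 1) * expR (- (c * t)))%:E).
  by apply/measurable_EFinP; apply: measurable_pos => t t0; exact: continuous_pow_exp.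
have E : ((Gamma x)%:E = (c `^ x)%:E *
    \int[leb]_(t in `]0%R, +oo[) (t `^ (x - 1) * expR (- (c * t)))%:E)%E.
  rewrite -integral_Gamma// -(@ge0_integral_powR_subst R c 1 _ c0 ltr01 mg g0).
  rewrite -(ge0_integralZl_EFin _ measurable_posR)//; first last.
  - exact: powR_ge0.
  - by move=> t _; rewrite lee_fin mulr_ge0 ?powR_ge0 ?expR_ge0.
  have P (t : R) : 0 < t ->
      (c * t `^ 1) `^ (x - 1) * expR (- (c * t `^ 1)) * (c * 1 * t `^ (1 - 1)) =
      c `^ x * (t `^ (x - 1) * expR (- (c * t))).
    move=> t0; rewrite powRr1 ?(ltW t0)// subrr powRr0 !mulr1.
    have -> : c `^ x = c `^ (x - 1) * c.
      by rewrite -[X in _ * X](powRr1 (ltW c0)) -powRD ?subrK// (gt_eqF c0) implybT.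
    by rewrite powRM ?(ltW c0) ?(ltW t0)//; ring.
  apply: eq_integral => t /set_mem/posP t0.
  by rewrite -!EFinM; congr EFin; exact: P.
rewrite EFinM E muleA -EFinM -powRD ?(gt_eqF c0) ?implybT//.
by rewrite addNr powRr0 mul1e.
Qed.

End gamma_scaling.

Section wright_mellin.
Context {R : realType}.
Implicit Types (x y z t s c : R).
Local Notation leb := (@lebesgue_measure R).
Variables (rho : R).
Hypothesis rho01 : 0 < rho < 1.

Lemma integral_wright_approx mu N s : (0 < N)%N -> 0 <= mu -> 0 < s ->
  (\int[leb]_(t in `]0%R, +oo[) (t `^ (s - 1) * wright_approx rho mu N t)%:E =
   (Gamma s * gauss N (mu + rho * s))%:E)%E.
Proof.
move=> N0 mu0 s0; have N00 : 0 < N%:R :> R by rewrite ltr0n.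
have c0 : 0 < N%:R `^ rho :> R by rewrite powR_gt0.
set c := N%:R `^ rho in c0.
pose A : R := N%:R `^ (1 - mu) / N`!%:R.
have A0 : 0 <= A by rewrite divr_ge0 ?powR_ge0.
pose a j : R := A * approx_coef rho mu N j * c ^+ j.
have a0 j : 0 <= a j by rewrite !mulr_ge0 ?approx_coef_ge0// exprn_ge0 ?(ltW c0).
have sj j : 0 < s + j%:R by rewrite ltr_wpDr.
have mg p : measurable_fun (`]0, +oo[%classic : set (measurableTypeR R))
    (fun t => (t `^ p * expR (- (c * t)))%:E).
  by apply/measurable_EFinP; apply: measurable_pos => t t0; exact: continuous_pow_exp.
transitivity (\int[leb]_(t in `]0%R, +oo[)
    \sum_(j < N.+1) ((a j)%:E * (t `^ (s + j%:R - 1) * expR (- (c * t)))%:E))%E.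
  apply: eq_integral => t /set_mem/posP t0.
  under eq_bigr do rewrite -EFinM.
  rewrite sumEFin; congr EFin.
  rewrite /wright_approx -/c -/A [t * c]mulrC !mulr_sumr; apply: eq_bigr => j _.
  have -> : t `^ (s + j%:R - 1) = t `^ (s - 1) * t ^+ j.
    by rewrite -powR_mulrn ?(ltW t0)// -powRD ?(gt_eqF t0) ?implybT//; congr powR; ring.
  by rewrite /a exprMn; ring.
rewrite ge0_integral_sum//; last 2 first.
- by move=> j; apply: measurable_funeM; exact: mg.
- move=> j t _; rewrite -EFinM lee_fin.
  by apply: mulr_ge0; [exact: a0|rewrite mulr_ge0 ?powR_ge0 ?expR_ge0].
transitivity (\sum_(j < N.+1) (A * c `^ (- s) * (approx_coef rho mu N j * Gamma (s + j%:R)))%:E)%E.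
  apply: eq_bigr => j _; rewrite (ge0_integralZl_EFin _ measurable_posR _ (mg _) (a0 j)); last first.
    by move=> t _; rewrite lee_fin mulr_ge0 ?powR_ge0 ?expR_ge0.
  rewrite integral_Gamma_scale// -EFinM; congr EFin.
  have -> : c `^ (- (s + j%:R)) = c `^ (- s) / c ^+ j.
    rewrite opprD powRD ?(gt_eqF c0) ?implybT// [X in _ * X]powRN.
    by rewrite powR_mulrn ?(ltW c0).
  by rewrite /a; field; rewrite expf_neq0// gt_eqF.
rewrite sumEFin; congr EFin; rewrite -mulr_sumr.
rewrite (@approx_coef_sum _ _ _ N (fun j => Gamma (s + j%:R)) s); last first.
  by move=> j; rewrite -natr1 addrA GammaS.
rewrite addr0 /gauss /A.
have -> : N%:R `^ (1 - (mu + rho * s)) = N%:R `^ (1 - mu) * c `^ (- s).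
  by rewrite /c -powRrM -powRD ?(gt_eqF N00) ?implybT//; congr powR; ring.
by ring.
Qed.

End wright_mellin.

Section wright_function.
Context {R : realType}.
Implicit Types (x y z t s c : R).
Local Notation leb := (@lebesgue_measure R).
Variables (rho : R).
Hypothesis rho01 : 0 < rho < 1.

Local Notation W mu t := (Wright (- rho) mu (- t)).

Lemma continuous_wright mu : continuous (fun t => W mu t).
Proof.
rewrite (_ : (fun t => _) = egf (fun k => (Gamma (mu - rho * k%:R))^-1) \o -%R).
  move=> t; apply: continuous_comp; first exact: cvgN.
  exact/continuous_egf/entire_rGamma.
by apply/funext => t; rewrite WrightE.
Qed.

Lemma measurable_pow_wright p mu :
  measurable_fun (`]0, +oo[%classic : set (measurableTypeR R)) (fun t => t `^ p * W mu t).
Proof.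
apply: measurable_pos => t t0; apply: cvgM; first exact: continuous_powRl.
exact: continuous_wright.
Qed.

Lemma wright_ge0 mu t : 0 <= mu -> 0 <= t -> 0 <= W mu t.
Proof. by move=> mu0 t0; rewrite WrightE egf_rGamma_ge0. Qed.

Let L mu s : R := Gamma s / Gamma (mu + rho * s).

(** On ]0, T] the approximants converge boundedly; beyond T their moment of order
    s is at most 1 / T times their moment of order s + 1. *)
Let truncated_mellin mu s k : 0 <= mu -> 0 < s ->
  ((L mu s - L mu (s + 1) / k.+1%:R)%:E <=
     \int[leb]_(t in `]0%R, k.+1%:R]) (t `^ (s - 1) * W mu t)%:E <= (L mu s)%:E)%E.
Proof.
have /andP[rho0 rho1] := rho01.
move=> mu0 s0; have T0 : 0 < k.+1%:R :> R by rewrite ltr0n.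
set T := k.+1%:R in T0 *.
have s10 : 0 < s + 1 by rewrite addr_gt0.
pose D := `]0, T]%classic : set (measurableTypeR R).
have mD : measurable D by exact: measurable_itv.
have DP t : D t -> 0 < t /\ t <= T by rewrite /D/= in_itv/= => /andP[].
have Dpos : D `<=` `]0, +oo[ by move=> t /DP[t0 _]; apply/posP.
pose a n t := t `^ (s - 1) * wright_approx rho mu n.+2 t.
pose m n s' : R := Gamma s' * gauss n.+2 (mu + rho * s').
have mL s' : m n s' @[n --> \oo] --> L mu s' by apply: cvgMr; exact: gauss_cvg2.
have [b eb bH] := gauss_dominated rho01 mu.
have b0 j : 0 <= b j by apply: le_trans (bH 0%N j).
have ma n p : measurable_fun (`]0, +oo[%classic : set (measurableTypeR R))
    (fun t => (t `^ p * wright_approx rho mu n.+2 t)%:E).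
  apply/measurable_EFinP; apply: measurable_pos => t t0.
  apply: cvgM; first exact: continuous_powRl.
  have -> : wright_approx rho mu n.+2 = egf (fun k => gauss n.+2 (mu - rho * k%:R)) \o -%R.
    by apply/funext => x; rewrite wright_approxE.
  apply: continuous_comp; first exact: cvgN.
  apply: continuous_egf; apply: entire_coef_le eb => j.
  by apply: (le_trans (bH n j)); exact: ler_norm.
have a0 n p t : 0 < t -> (0 <= (t `^ p * wright_approx rho mu n.+2 t)%:E)%E.
  by move=> t0; rewrite lee_fin mulr_ge0 ?powR_ge0 ?wright_approx_ge0 ?(ltW t0).
have lim : (\int[leb]_(t in D) (a n t)%:E @[n --> \oo] -->
    \int[leb]_(t in D) (t `^ (s - 1) * W mu t)%:E)%E.
  have eb0 : 0 <= egf b T.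
    have bn j : `|b j| <= b j by rewrite ger0_norm.
    have := @egf_norm_le _ _ _ T bn eb; rewrite (ger0_norm (ltW T0)).
    by apply: le_trans.
  pose C := egf b T * expR T.
  have C0 : 0 <= C.
    by rewrite mulr_ge0 ?expR_ge0.
  have intG : leb.-integrable D (fun t => C%:E * (t `^ (s - 1) * expR (- t))%:E)%E.
    apply: (integrableZl mD); apply: (integrableS measurable_posR mD Dpos).
    exact: integrable_gamma.
  have maD n : measurable_fun D (fun t => (a n t)%:E) by exact: measurable_funS (ma n _).
  have mgD : measurable_fun D (fun t => (t `^ (s - 1) * W mu t)%:E).
    by apply/measurable_EFinP; apply: measurable_funS (measurable_pow_wright _ _).
  have cv : {ae leb, forall t, D t -> (a n t)%:E @[n --> \oo] --> (t `^ (s - 1) * W mu t)%:E}.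
    apply: aeW => t _; apply: cvg_EFin; first exact: nearW.
    by apply: cvgMr; rewrite WrightE; exact: wright_approx_cvg.
  have dom : {ae leb, forall t n, D t ->
      (`|(a n t)%:E| <= C%:E * (t `^ (s - 1) * expR (- t))%:E)%E}.
    apply: aeW => t n /DP[t0 tT]; rewrite /= -EFinM lee_fin.
    rewrite /a normrM ger0_norm ?powR_ge0// wright_approxE// mulrCA ler_wpM2l ?powR_ge0//.
    apply: (@le_trans _ _ (egf b T)); last first.
      by rewrite /C -mulrA -expRD ler_peMr// -expR0 ler_expR subr_ge0.
    apply: (le_trans (@egf_norm_le _ _ _ (- t) (bH n) eb)).
    by rewrite normrN (ger0_norm (ltW t0)); apply: egf_ge0_homo; rewrite ?(ltW t0).
  by have [] := dominated_convergence mD maD mgD cv intG dom.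
have up n : (\int[leb]_(t in D) (a n t)%:E <= (m n s)%:E)%E.
  rewrite /m -(integral_wright_approx rho01)//.
  apply: ge0_subset_integral => //; first exact: ma.
  by move=> t /posP; exact: a0.
have low n : ((m n s - m n (s + 1) / T)%:E <= \int[leb]_(t in D) (a n t)%:E)%E.
  rewrite EFinB leeBlDr//.
  rewrite /m -(integral_wright_approx rho01)//.
  have posE : `]0%R, +oo[%classic = D `|` `]T, +oo[%classic :> set (measurableTypeR R).
    by rewrite /D -itv_bndbnd_setU// bnd_simp ltW.
  have mT : measurable (`]T, +oo[%classic : set (measurableTypeR R)) by exact: measurable_itv.
  have Tpos : (`]T, +oo[%classic : set (measurableTypeR R)) `<=` `]0, +oo[%classic.
    by move=> t /=; rewrite !in_itv/= !andbT; exact: lt_trans.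
  rewrite posE ge0_integral_setU//; first last.
  - by apply/disj_setPS => t [/DP[_ tT]] /=; rewrite in_itv/= andbT ltNge tT.
  - by rewrite -posE => t /posP; exact: a0.
  - by rewrite -posE; exact: ma.
  rewrite leeD2l// mulrC EFinM.
  rewrite -(integral_wright_approx rho01)//.
  rewrite -(ge0_integralZl_EFin _ measurable_posR _ (ma n _)); first last.
  - by rewrite invr_ge0 ltW.
  - by move=> t /posP; exact: a0.
  apply: (@le_trans _ _ (\int[leb]_(t in `]T, +oo[)
      (T^-1%:E * (t `^ (s + 1 - 1) * wright_approx rho mu n.+2 t)%:E))%E); last first.
    apply: ge0_subset_integral => //; first by apply: measurable_funeM; exact: ma.
    move=> t /posP t0; rewrite mule_ge0 ?a0// lee_fin invr_ge0 ltW//.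
  apply: ge0_le_integral => //.
  - by move=> t /Tpos/posP; exact: a0.
  - exact: measurable_funS (ma n _).
  - by apply: measurable_funeM; exact: measurable_funS (ma n _).
  move=> t; rewrite /= in_itv/= andbT => Tt; have t0 := lt_trans T0 Tt.
  rewrite -EFinM lee_fin [leRHS]mulrA ler_wpM2r ?wright_approx_ge0 ?(ltW t0)//.
  have -> : t `^ (s + 1 - 1) = t `^ (s - 1) * t.
    by rewrite -[X in _ = _ * X](powRr1 (ltW t0)) -powRD ?(gt_eqF t0) ?implybT//; congr powR; ring.
  by rewrite mulrC -mulrA ler_peMr ?powR_ge0// ler_pdivlMr// mul1r ltW.
have Lup : (m n s)%:E @[n --> \oo] --> (L mu s)%:E.
  by apply: cvg_EFin; [exact: nearW|exact: mL].
have Llow : (m n s - m n (s + 1) / T)%:E @[n --> \oo] --> (L mu s - L mu (s + 1) / T)%:E.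
  apply: cvg_EFin; first exact: nearW.
  by apply: cvgB; [exact: mL|apply: cvgMl; exact: mL].
apply/andP; split.
- rewrite -(cvg_lim _ Llow)// -(cvg_lim _ lim)//.
  apply: lee_lim; [exact: cvgP Llow|exact: cvgP lim|exact: nearW].
- rewrite -(cvg_lim _ Lup)// -(cvg_lim _ lim)//.
  apply: lee_lim; [exact: cvgP lim|exact: cvgP Lup|exact: nearW].
Qed.

Lemma mellin_wright_ge0 mu s : 0 <= mu -> 0 < s ->
  (\int[leb]_(t in `]0%R, +oo[) (t `^ (s - 1) * W mu t)%:E = (L mu s)%:E)%E.
Proof.
move=> mu0 s0.
have g0 t : 0 < t -> (0 <= (t `^ (s - 1) * W mu t)%:E)%E.
  by move=> t0; rewrite lee_fin mulr_ge0 ?powR_ge0 ?wright_ge0 ?(ltW t0).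
have Dpos k : (`]0, k.+1%:R]%classic : set (measurableTypeR R)) `<=` `]0, +oo[%classic.
  by move=> t /=; rewrite !in_itv/= andbT => /andP[].
have nd : nondecreasing_seq (fun k => `]0, k.+1%:R]%classic : set (measurableTypeR R)).
  move=> i j ij; apply/subsetPset => t /=; rewrite !in_itv/= => /andP[-> /le_trans]; apply.
  by rewrite ler_nat.
have U : \bigcup_k `]0, k.+1%:R]%classic = `]0, +oo[%classic :> set (measurableTypeR R).
  apply/seteqP; split => [t [k _ /Dpos//]|t /posP t0].
  by exists (Num.truncn t) => //=; rewrite in_itv/= t0 ltW// truncnS_gt.
have := @ge0_nondecreasing_set_cvg_integral _ (measurableTypeR R) R _
  (fun t => (t `^ (s - 1) * W mu t)%:E) leb nd.
rewrite U => H.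
have {}H : (\int[leb]_(t in `]0%R, k.+1%:R]) (t `^ (s - 1) * W mu t)%:E @[k --> \oo] -->
    \int[leb]_(t in `]0%R, +oo[) (t `^ (s - 1) * W mu t)%:E)%E.
  apply: H => [k|k|k t /Dpos/posP]; first exact: measurable_itv.
    by apply/measurable_EFinP; apply: measurable_funS (measurable_pow_wright _ _).
  exact: g0.
apply: (cvg_unique _ H) => //.
apply: (@squeeze_cvge _ _ _ _ (fun k => (L mu s - L mu (s + 1) / k.+1%:R)%:E) _
  (fun=> (L mu s)%:E)).
- by apply: nearW => k; exact: truncated_mellin.
- apply: cvg_EFin; first exact: nearW.
  rewrite -[X in _ --> X]subr0; apply: cvgB; first exact: cvg_cst.
  rewrite -[X in _ --> X](mulr0 (L mu (s + 1))); apply: cvgMr; exact: cvg_harmonic.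
- exact: cvg_cst.
Qed.

(** Inherited from 1 / Gamma a = a / Gamma (a + 1), coefficient by coefficient. *)
Lemma wright_contiguous mu t :
  W mu t = mu * W (mu + 1) t + rho * (t * W (mu + 1 - rho) t).
Proof.
have e1 := entire_rGamma rho01 (mu + 1).
have e2 := entire_rGamma rho01 (mu + 1 - rho).
rewrite !WrightE.
have -> : t * egf (fun k => (Gamma (mu + 1 - rho - rho * k%:R))^-1) (- t) =
    - egf (fun n => n%:R * (Gamma (mu + 1 - rho - rho * n.-1%:R))^-1) (- t).
  by rewrite -(egf_mulX _ e2); ring.
rewrite mulrN -mulNr -egf_lin//; last exact: (entire_coef_mulX e2).
congr (egf _ _); apply/funext => -[|k].
  by rewrite mulr0 !subr0 mul0r mulr0 addr0 GammaV_rec.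
rewrite /= GammaV_rec (_ : mu + 1 - rho - rho * k%:R = mu - rho * k.+1%:R + 1); last first.
  by rewrite -natr1; ring.
rewrite (_ : mu + 1 - rho * k.+1%:R = mu - rho * k.+1%:R + 1); last by ring.
by ring.
Qed.

(** The contiguous relation expresses W mu by parameters larger by at least
    1 - rho, so that finitely many steps reach the case mu >= 0. *)
Lemma mellin_wright mu s : 0 < s ->
  leb.-integrable `]0, +oo[ (EFin \o (fun t => t `^ (s - 1) * W mu t)) /\
  (\int[leb]_(t in `]0%R, +oo[) (t `^ (s - 1) * W mu t)%:E = (L mu s)%:E)%E.
Proof.
have /andP[rho0 rho1] := rho01.
have [k] : exists k : nat, 0 <= mu + k%:R * (1 - rho).
  exists (Num.truncn (- mu / (1 - rho))).+1.
  have r1 : 0 < 1 - rho by lra.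
  have := truncnS_gt (- mu / (1 - rho)); rewrite ltr_pdivrMr//; lra.
elim: k mu s => [|k IH] mu s kmu s0.
  rewrite mul0r addr0 in kmu; have E := mellin_wright_ge0 kmu s0; split => //.
  apply/integrableP; split.
    by apply/measurable_EFinP; exact: measurable_pow_wright.
  rewrite (_ : (\int[_]_(x in _) _)%E = (L mu s)%:E) ?ltry// -E.
  apply: eq_integral => t /set_mem/posP t0.
  by rewrite /= ger0_norm// mulr_ge0 ?powR_ge0 ?wright_ge0 ?(ltW t0).
have s10 : 0 < s + 1 by lra.
have k0 : 0 <= k%:R :> R by [].
have kmu1 : 0 <= mu + 1 + k%:R * (1 - rho) by move: kmu; rewrite -natr1; nra.
have kmu2 : 0 <= mu + 1 - rho + k%:R * (1 - rho) by move: kmu; rewrite -natr1; nra.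
have [I1 E1] := IH _ s kmu1 s0; have [I2 E2] := IH _ (s + 1) kmu2 s10.
have J1 := integrableZl measurable_posR mu I1.
have J2 := integrableZl measurable_posR rho I2.
have eqf t : 0 < t -> (t `^ (s - 1) * W mu t)%:E =
   (mu%:E * (EFin \o (fun t => (t `^ (s - 1) * W (mu + 1) t)%R)) t +
    rho%:E * (EFin \o (fun t => (t `^ (s + 1 - 1) * W (mu + 1 - rho) t)%R)) t)%E.
  move=> t0; rewrite /= -!EFinM -EFinD wright_contiguous; congr EFin.
  have -> : t `^ (s + 1 - 1) = t `^ (s - 1) * t.
    by rewrite -[X in _ = _ * X](powRr1 (ltW t0)) -powRD ?(gt_eqF t0) ?implybT//; congr powR; ring.
  ring.
split.
  apply: (eq_integrable measurable_posR _ _ _ (integrableD measurable_posR J1 J2)).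
  by move=> t /set_mem/posP t0; rewrite /= (eqf t t0).
under eq_integral => t /set_mem/posP t0 do rewrite (eqf t t0).
rewrite (integralD measurable_posR J1 J2) !(integralZl measurable_posR)// E1 E2.
rewrite -!EFinM -EFinD; congr EFin; rewrite /L.
rewrite (_ : mu + 1 - rho + rho * (s + 1) = mu + rho * s + 1); last by ring.
rewrite (_ : mu + 1 + rho * s = mu + rho * s + 1); last by ring.
by rewrite [in RHS]GammaV_rec (GammaS s0); ring.
Qed.

Lemma is_derive_wright mu t : is_derive t (1 : R) (fun t => W mu t) (- W (mu - rho) t).
Proof.
have d := @is_derive_egf _ _ (- t) (entire_rGamma rho01 mu).
have dN : is_derive t (1 : R) (-%R : R -> R) (- 1) by apply: is_deriveN.
have := is_derive1_comp d dN; rewrite mulrN1.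
rewrite (_ : (fun t => W mu t) = egf (fun k => (Gamma (mu - rho * k%:R))^-1) \o -%R); last first.
  by apply/funext => x; rewrite WrightE.
rewrite WrightE.
suff -> : (fun k => (Gamma (mu - rho - rho * k%:R))^-1) =
  (fun n => (Gamma (mu - rho * n.+1%:R))^-1) by [].
by apply/funext => k; rewrite -natr1; congr (Gamma _)^-1; ring.
Qed.

Lemma wright_nonincreasing mu x y : rho <= mu -> 0 <= x -> x <= y -> W mu y <= W mu x.
Proof.
move=> rmu x0; rewrite le_eqVlt => /predU1P[->//|xy].
have [||c cxy E] := @MVT R (fun t => W mu t) (fun t => - W (mu - rho) t) x y xy.
- by move=> t _; exact: is_derive_wright.
- by apply: continuous_subspaceT => t; exact: continuous_wright.
rewrite -subr_le0 E; move: cxy; rewrite in_itv/= => /andP[xc _].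
by rewrite mulNr oppr_le0 mulr_ge0 ?subr_ge0 ?(ltW xy)// wright_ge0 ?subr_ge0// (le_trans x0 (ltW xc)).
Qed.

(** A zero at t0 would confine the nonincreasing W mu to [0, t0], so that its
    Mellin transform would grow at most geometrically; but it grows like
    Gamma s / Gamma (rho s) with rho < 1. *)
Let wright_gt0_ge1 mu t : 1 <= mu -> 0 < t -> 0 < W mu t.
Proof.
have /andP[rho0 rho1] := rho01.
move=> mu1 t0; have mu0 : 0 < mu by lra.
rewrite lt_neqAle eq_sym wright_ge0 ?(ltW t0) ?(ltW mu0)// andbT.
apply/negP => /eqP Wt0.
have Wt x : t <= x -> W mu x = 0.
  move=> tx; apply/eqP; rewrite eq_le wright_ge0 ?(le_trans (ltW t0) tx) ?(ltW mu0)//.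
  rewrite andbT -Wt0; apply: wright_nonincreasing (ltW t0) tx.
  exact: le_trans (ltW rho1) mu1.
have H s : 1 <= s -> s `^ (1 - rho) <= t * (mu + 2) `^ rho.
  move=> s1; have s0 : 0 < s by lra.
  have s10 : 0 < s + 1 by lra.
  have y0 : 0 < mu + rho * s by rewrite addr_gt0 ?mulr_gt0.
  have le : L mu (s + 1) <= t * L mu s.
    rewrite -lee_fin [leRHS]EFinM -!mellin_wright_ge0 ?(ltW mu0)//.
    rewrite -(ge0_integralZl_EFin _ measurable_posR); first last.
    - exact: ltW.
    - by apply/measurable_EFinP; exact: measurable_pow_wright.
    - by move=> x /posP x0; rewrite lee_fin mulr_ge0 ?powR_ge0 ?wright_ge0 ?(ltW x0) ?(ltW mu0).
    apply: (ge0_le_integral _ measurable_posR).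
    - by move=> x /posP x0; rewrite lee_fin mulr_ge0 ?powR_ge0 ?wright_ge0 ?(ltW x0) ?(ltW mu0).
    - by apply/measurable_EFinP; exact: measurable_pow_wright.
    - by apply: measurable_funeM; apply/measurable_EFinP; exact: measurable_pow_wright.
    move=> x /posP x0; rewrite -EFinM lee_fin.
    have [tx|xt] := leP t x; first by rewrite Wt// !mulr0.
    have -> : x `^ (s + 1 - 1) = x * x `^ (s - 1).
      by rewrite -[X in _ = X * _](powRr1 (ltW x0)) -powRD ?(gt_eqF x0) ?implybT//; congr powR; ring.
    by rewrite -mulrA ler_wpM2r ?(ltW xt)// mulr_ge0 ?powR_ge0 ?wright_ge0 ?(ltW x0) ?(ltW mu0).
  have G := Gamma_shift_le y0 (ltW rho0).
  have Gs := Gamma_gt0 s0; have Gy := Gamma_gt0 y0.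
  have yr0 : 0 < mu + rho * s + rho by rewrite addr_gt0.
  have Gyr := Gamma_gt0 yr0.
  have h1 : s <= t * (mu + rho * s + rho) `^ rho.
    move: le; rewrite /L GammaS//.
    rewrite (_ : mu + rho * (s + 1) = mu + rho * s + rho); last by ring.
    rewrite ler_pdivrMr// => le.
    rewrite -(ler_pM2r Gs); apply: (le_trans le).
    rewrite mulrA mulrAC ler_pdivrMr// -!mulrA ler_pM2l//.
    by rewrite [leRHS]mulrCA ler_pM2l.
  have h2 : (mu + rho * s + rho) `^ rho <= ((mu + 2) * s) `^ rho.
    apply: ge0_ler_powR; rewrite ?nnegrE ?(ltW rho0) ?(ltW yr0) ?mulr_ge0 ?(ltW s0)//; first by lra.
    nra.
  rewrite powRB ?(gt_eqF s0) ?implybT// powRr1 ?(ltW s0)// ler_pdivrMr ?powR_gt0//.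
  apply: (le_trans h1); rewrite -mulrA -powRM ?(ltW s0)//; last by lra.
  by rewrite ler_pM2l.
have r10 : 0 < 1 - rho by lra.
have := cvgy_powR r10 => /cvgryPgt/(_ (t * (mu + 2) `^ rho)) E.
have [s [Es /= s1]] := filter_ex (filterI E (nbhs_pinfty_ge (num_real 1))).
by have := H s s1; rewrite leNgt Es.
Qed.

(** The contiguous relation reduces mu > 0 to mu + 1 >= 1, and mu = 0 to
    1 - rho > 0. *)
Lemma wright_gt0 mu t : 0 <= mu -> 0 < t -> 0 < W mu t.
Proof.
have /andP[rho0 rho1] := rho01.
move=> mu0 t0.
have pos m : 0 < m -> 0 < W m t.
  move=> m0; rewrite wright_contiguous ltr_pwDl//.
    by rewrite mulr_gt0// wright_gt0_ge1//; lra.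
  by rewrite !mulr_ge0 ?(ltW rho0) ?(ltW t0)// wright_ge0 ?(ltW t0)//; lra.
move: mu0; rewrite le_eqVlt => /predU1P[<-|]; last exact: pos.
by rewrite wright_contiguous mul0r !add0r !mulr_gt0// pos//; lra.
Qed.

End wright_function.

(** * Laplace transforms of measures *)
Section laplace_uniqueness.
Context {R : realType}.
Implicit Types (M N : {measure set (measurableTypeR R) -> \bar R}) (f : R -> R) (x u a c : R).

Local Notation D0 := (`[0%R, +oo[%classic : set (measurableTypeR R)).

Let mD0 : measurable D0. Proof. exact: measurable_itv. Qed.

Let mexpN : measurable_fun [set: measurableTypeR R] (fun u : R => expR (- u)).
Proof. exact: measurableT_comp. Qed.

Let expN0 u : 0 <= expR (- u). Proof. exact: expR_ge0. Qed.

(** The measure e^(-u) N(du); unlike N it is finite on the half-line, its total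
    mass being f 1. *)
Let nu N : {measure set (measurableTypeR R) -> \bar R} := density_measure N mexpN expN0.

Let D0P u : D0 u <-> 0 <= u.
Proof. by rewrite /= in_itv/= andbT. Qed.

Let mexp x : measurable_fun [set: measurableTypeR R] (fun u : R => (expR (- (x * u)))%:E).
Proof.
apply/measurable_EFinP; apply: measurableT_comp => //.
by apply: measurableT_comp => //; exact: measurable_funM.
Qed.

Let nu_exp f N x : laplace_represents f N -> 0 <= x ->
  (\int[nu N]_(u in D0) (expR (- (x * u)))%:E = (f (x + 1))%:E)%E.
Proof.
move=> [_ NE] x0; rewrite NE ?ltr_wpDl//.
rewrite ge0_integral_density; [|exact: mD0|exact: (measurable_funTS (mexp x))|].
  2: by move=> u _; rewrite lee_fin expR_ge0.
apply: eq_integral => u _; rewrite -EFinM -expRD; congr (expR _)%:E; ring.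
Qed.

Let nu_neg f N : laplace_represents f N -> nu N `]-oo, 0%R[%classic = 0%E.
Proof.
move=> [N0 _]; rewrite /nu/= /density_measure.
apply: null_set_integral => //; apply: measurable_funTS; exact/measurable_EFinP.
Qed.

Let nu_D0 f N : laplace_represents f N -> nu N D0 = (f 1)%:E.
Proof.
move=> fN; have := nu_exp fN (lexx 0); rewrite add0r => <-.
rewrite -[LHS]mul1e -integral_cst//; apply: eq_integral => u _.
by rewrite mul0r oppr0 expR0.
Qed.

(** Termwise integration of the exponential series expresses the integral by
    values of f alone. *)
Let nu_gumbel f N n c : laplace_represents f N -> 0 <= c ->
  ((\sum_(k < K) (- c) ^+ k / k`!%:R * f (n%:R * k%:R + 1))%:E @[K --> \oo] -->
   \int[nu N]_(u in D0) (expR (- (c * expR (- (n%:R * u)))))%:E)%E.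
Proof.
move=> fN c0.
pose S K u : R := \sum_(k < K) (- c) ^+ k / k`!%:R * expR (- (n%:R * k%:R * u)).
have SE K u : S K u = series (exp_coeff (- (c * expR (- (n%:R * u))))) K.
  rewrite /S /series/= big_mkord; apply: eq_bigr => k _.
  rewrite /exp_coeff/= (_ : - (c * expR (- (n%:R * u))) = - c * expR (- (n%:R * u))); last by ring.
  rewrite exprMn -expRM_natl mulrAC; congr (_ * expR _ / _); ring.
have intexp x : 0 <= x -> (nu N).-integrable D0 (fun u => (expR (- (x * u)))%:E).
  move=> x0; apply/integrableP; split; first exact: (measurable_funTS (mexp x)).
  under eq_integral do rewrite /= ger0_norm ?expR_ge0//.
  by rewrite (nu_exp fN x0) ltry.
have intS K : (nu N).-integrable D0 (fun u => (S K u)%:E) /\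
    (\int[nu N]_(u in D0) (S K u)%:E =
     (\sum_(k < K) (- c) ^+ k / k`!%:R * f (n%:R * k%:R + 1))%:E)%E.
  elim: K => [|K [I E]].
    rewrite big_ord0; split.
      rewrite (_ : (fun u => _) = cst 0%E); first exact: integrable0.
      by apply/funext => u; rewrite /S big_ord0.
    by rewrite integral0_eq// => u _; rewrite /S big_ord0.
  have nk0 : 0 <= n%:R * K%:R :> R by rewrite mulr_ge0.
  have J := integrableZl mD0 ((- c) ^+ K / K`!%:R) (intexp _ nk0).
  have SS : (fun u => (S K.+1 u)%:E) =
      (fun u => (S K u)%:E + ((- c) ^+ K / K`!%:R)%:E * (expR (- (n%:R * K%:R * u)))%:E)%E.
    by apply/funext => u; rewrite /S big_ord_recr.
  rewrite SS; split; first exact: (integrableD mD0 I J).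
  rewrite (integralD mD0 I J) E (integralZl mD0 (intexp _ nk0)) (nu_exp fN nk0).
  by rewrite big_ord_recr.
have mS K : measurable_fun D0 (fun u => (S K u)%:E) by have [/integrableP[]] := intS K.
have mlim : measurable_fun D0 (fun u => (expR (- (c * expR (- (n%:R * u)))))%:E).
  apply: measurable_funTS; apply/measurable_EFinP; apply: measurableT_comp => //.
  apply: measurableT_comp => //; apply: measurable_funM => //.
  by apply/measurable_EFinP; exact: mexp.
have cv : {ae nu N, forall u, D0 u -> (S K u)%:E @[K --> \oo] -->
    (expR (- (c * expR (- (n%:R * u)))))%:E}.
  apply: aeW => u _; apply: cvg_EFin; first exact: nearW.
  under eq_fun do rewrite SE.
  exact: is_cvg_series_exp_coeff.
have dom : {ae nu N, forall u K, D0 u -> (`|(S K u)%:E| <= (cst (expR c)%:E) u)%E}.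
  apply: aeW => u K /D0P u0; rewrite /= lee_fin /S.
  have e1 : 0 <= expR (- (n%:R * u)) <= 1.
    by rewrite expR_ge0 -expR0 ler_expR oppr_le0 mulr_ge0.
  apply: (@le_trans _ _ (series (exp_coeff c) K)); last first.
    apply: nondecreasing_cvgn_le (is_cvg_series_exp_coeff c) K.
    apply: nondecreasing_series => k _ _; rewrite /exp_coeff/=.
    by rewrite divr_ge0 ?exprn_ge0.
  rewrite -/(S K u) SE /series/=; apply: (le_trans (ler_norm_sum _ _ _)); apply: ler_sum => k _.
  rewrite /exp_coeff/= normrM normfV normr_nat ler_wpM2r ?invr_ge0//.
  rewrite normrX normrN normrM (ger0_norm c0) ger0_norm ?expR_ge0//.
  rewrite lerXn2r ?nnegrE ?mulr_ge0 ?expR_ge0//; case/andP: e1 => _ e1.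
  by rewrite ler_piMr.
have intc : (nu N).-integrable D0 (cst (expR c)%:E).
  apply/integrableP; split => //.
  by rewrite integral_cst//= (nu_D0 fN) -EFinM ltry.
have [_ _] := dominated_convergence mD0 mS mlim cv intc dom.
by under eq_fun do rewrite (intS _).2.
Qed.

(** The Gumbel distribution functions exp (- n e^(n (a - u))) tend to the
    indicator of u > a. *)
Let gumbel_cvg a u :
  expR (- (n%:R * expR (n%:R * a) * expR (- (n%:R * u)))) @[n --> \oo] -->
  (\1_(`]a, +oo[) u : R).
Proof.
rewrite indicE; have [au|ua] := ltP a u.
  rewrite mem_set/=; last by rewrite in_itv/= au.
  rewrite -[X in _ --> X]expR0.
  apply: (@cvg_comp _ _ _ _ expR _ (nbhs (0 : R))); last exact: continuous_expR.
  pose d := (u - a) / 2; have d0 : 0 < d by rewrite divr_gt0 ?subr_gt0.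
  rewrite -oppr0; apply: cvgN.
  have z1 : `|expR (- d)| < 1 by rewrite ger0_norm ?expR_ge0// expR_lt1 oppr_lt0.
  have G : d^-1 * expR (- d) ^+ n @[n --> \oo] --> (0 : R).
    by rewrite -[X in _ --> X](mulr0 d^-1); apply: cvgMr; exact: cvg_expr.
  apply: (@squeeze_cvgr _ _ _ _ (cst 0) (fun n => d^-1 * expR (- d) ^+ n)) => //; last exact: cvg_cst.
  apply: nearW => n; rewrite !mulr_ge0 ?expR_ge0//=.
  have -> : n%:R * expR (n%:R * a) * expR (- (n%:R * u)) =
      (d^-1 * expR (- d) ^+ n) * (n%:R * d * expR (- (n%:R * d))).
    rewrite -expRM_natl -mulrA -expRD.
    have -> : n%:R * a + - (n%:R * u) = n%:R * - d + - (n%:R * d) by rewrite /d; field.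
    by rewrite expRD; field; rewrite gt_eqF.
  rewrite ler_piMr ?mulr_ge0 ?invr_ge0 ?(ltW d0) ?exprn_ge0 ?expR_ge0//.
  rewrite expRN ler_pdivrMr ?expR_gt0// mul1r.
  by apply: le_trans (expR_ge1Dx _); rewrite lerDr.
rewrite memNset/=; last by rewrite in_itv/= andbT ltNge ua.
apply: (@squeeze_cvgr _ _ _ _ (cst 0) (fun n => expR (- n%:R))) => //;
  [|exact: cvg_cst|exact: cvgn_expR].
apply: nearW => n; rewrite expR_ge0/= ler_expR lerN2 -mulrA -expRD ler_peMr//.
by rewrite -expR0 ler_expR -mulrBr mulr_ge0// subr_ge0.
Qed.

Let nu_ray f N M a : laplace_represents f N -> laplace_represents f M ->
  nu N `]a, +oo[%classic = nu M `]a, +oo[%classic.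
Proof.
move=> fN fM.
have ray P : laplace_represents f P ->
    (\int[nu P]_(u in D0) (expR (- (n%:R * expR (n%:R * a) * expR (- (n%:R * u)))))%:E
      @[n --> \oo] --> nu P `]a, +oo[%classic)%E.
  move=> fP.
  have -> : nu P `]a, +oo[%classic = (\int[nu P]_(u in D0) (\1_(`]a, +oo[) u)%:E)%E.
    rewrite integral_indic//.
    rewrite [in LHS](_ : `]a, +oo[%classic = (`]a, +oo[ `&` D0) `|` (`]a, +oo[ `&` `]-oo, 0[)); last first.
      rewrite -setIUr (_ : D0 `|` _ = setT) ?setIT//.
      by apply/seteqP; split => // u _; have [u0|u0] := leP 0 u; [left|right];
        rewrite /= in_itv/= ?andbT.
    rewrite measureU//; first last.
    - apply/seteqP; split => // u [[_ /D0P u0] [_]] /=.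
      by rewrite in_itv/= ltNge u0.
    - by apply: measurableI.
    - by apply: measurableI.
    rewrite [X in (_ + X)%E](_ : _ = 0%E) ?adde0//.
    apply: (subset_measure0 _ _ _ (nu_neg fP)) => //; first exact: measurableI.
  have m1 n : measurable_fun D0 (fun u => (expR (- (n%:R * expR (n%:R * a) * expR (- (n%:R * u)))))%:E).
    apply: measurable_funTS; apply/measurable_EFinP; apply: measurableT_comp => //.
    apply: measurableT_comp => //; apply: measurable_funM => //.
    by apply/measurable_EFinP; exact: mexp.
  have m2 : measurable_fun D0 (fun u => (\1_(`]a, +oo[) u : R)%:E).
    by apply: measurable_funTS; apply/measurable_EFinP; exact: measurable_indic.
  have cv : {ae nu P, forall u, D0 u ->
      (expR (- (n%:R * expR (n%:R * a) * expR (- (n%:R * u)))))%:E @[n --> \oo] -->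
      (\1_(`]a, +oo[) u : R)%:E}.
    by apply: aeW => u _; apply: cvg_EFin; [exact: nearW|exact: gumbel_cvg].
  have dom : {ae nu P, forall u n, D0 u ->
     (`|(expR (- (n%:R * expR (n%:R * a) * expR (- (n%:R * u)))))%:E| <= cst 1%:E u)%E}.
    apply: aeW => u n _; rewrite /= lee_fin ger0_norm ?expR_ge0// expR_le1.
  have intc : (nu P).-integrable D0 (cst 1%:E).
    apply/integrableP; split => //.
    by rewrite integral_cst//= (nu_D0 fP) -EFinM ltry.
  by have [] := dominated_convergence mD0 m1 m2 cv intc dom.
have E n : (\int[nu N]_(u in D0) (expR (- (n%:R * expR (n%:R * a) * expR (- (n%:R * u)))))%:E =
    \int[nu M]_(u in D0) (expR (- (n%:R * expR (n%:R * a) * expR (- (n%:R * u)))))%:E)%E.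
  have c0 : 0 <= n%:R * expR (n%:R * a) by rewrite mulr_ge0 ?expR_ge0.
  by apply: (cvg_unique _ (nu_gumbel (n := n) fN c0) (nu_gumbel (n := n) fM c0)).
have {E} E := funext E.
have RM := ray _ fM; rewrite -E in RM.
exact: (cvg_unique _ (ray _ fN) RM).
Qed.

(** The rays ]a, +oo[ determine the finite measure e^(-u) N(du), and dividing by
    the density e^(-u) recovers N. *)
Lemma laplace_unique f N M : laplace_represents f N -> laplace_represents f M ->
  forall A, measurable A -> N A = M A.
Proof.
move=> fN fM A mA.
have fin P a : laplace_represents f P -> (nu P `]a, +oo[%classic < +oo)%E.
  move=> fP; apply: (@le_lt_trans _ _ (nu P D0 + nu P `]-oo, 0%R[%classic)%E).
    rewrite -measureU//.
      by apply: le_measure; rewrite ?inE//; [exact: measurableU|move=> u _;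
        have [u0|u0] := leP 0 u; [left|right]; rewrite /= in_itv/= ?andbT].
    by apply/seteqP; split => // u [/D0P u0] /=; rewrite in_itv/= ltNge u0.
  by rewrite (nu_neg fP) adde0 (nu_D0 fP) ltry.
have nuE B : measurable B -> nu N B = nu M B.
  move=> mB.
  refine (@measure_unique _ R (measurableTypeR R) (@ocitv R)
    (fun n => `](- n%:R), n%:R]%classic) _ _ _ _ (nu N) (nu M) _ _ B mB) => //.
  - exact: ocitvI.
  - by move=> n; exact: is_ocitv.
  - apply/seteqP; split => // x _; exists (Num.truncn `|x|).+1 => //=.
    rewrite in_itv/=; have := truncnS_gt `|x|; rewrite ltr_norml => /andP[-> /ltW].
    by rewrite andTb.
  - move=> _ [[a b] _ <-]/=.
    have [ab|ba] := leP a b; last first.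
      by rewrite set_itv_ge ?measure0// -leNgt bnd_simp ltW.
    have ocE P : laplace_represents f P ->
        nu P `]a, b]%classic = (nu P `]a, +oo[%classic - nu P `]b, +oo[%classic)%E.
      move=> fP; rewrite (_ : `]a, b]%classic = `]a, +oo[ `\` `]b, +oo[).
        rewrite measureD//; last exact: fin.
        congr (_ - nu P _)%E; apply/setIidPr => u /=.
        by rewrite !in_itv/= !andbT; exact: le_lt_trans.
      apply/seteqP; split => u /=; rewrite !in_itv/= !andbT.
        by move=> /andP[-> ub]; split => //; apply/negP; rewrite -leNgt.
      by move=> [-> /negP]; rewrite -leNgt.
    by rewrite !ocE// (nu_ray a fN fM) (nu_ray b fN fM).
  - move=> n; apply: le_lt_trans (fin N (- n%:R) fN).
    apply: le_measure; rewrite ?inE//.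
    by move=> u /=; rewrite !in_itv/= andbT => /andP[].
have back (P : {measure set (measurableTypeR R) -> \bar R}) : P A = (\int[nu P]_(u in A) (expR u)%:E)%E.
  rewrite ge0_integral_density//.
  - rewrite -[LHS]mul1e -integral_cst//; apply: eq_integral => u _.
    by rewrite -EFinM -expRD subrr expR0.
  - by apply: measurable_funTS; apply/measurable_EFinP.
rewrite (back N) (back M); apply: eq_measure_integral => B mB _; exact: nuE.
Qed.

End laplace_uniqueness.

Section laplace_complete_monotonicity.
Context {R : realType}.
Implicit Types (f : R -> R) (x u a c : R).
Variable M : {measure set (measurableTypeR R) -> \bar R}.

Local Notation P := (`]0%R, +oo[%classic : set (measurableTypeR R)).

Hypothesis M_fin : (M P < +oo)%E.

Let F n x := (\int[M]_(u in P) (u ^+ n * expR (- (x * u))))%R.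

Let integrable_cst c : M.-integrable P (cst c%:E).
Proof.
apply/integrableP; split => //.
rewrite (_ : (fun u => _) = cst `|c|%:E)// integral_cst//.
exact: lte_mul_pinfty.
Qed.

Let measurable_int n x : measurable_fun P (fun u : R => u ^+ n * expR (- (x * u))).
Proof.
apply: measurable_pos => u _; apply: cvgM; first exact: exprn_continuous.
apply: continuous_comp; last exact: continuous_expR.
by apply: cvgN; apply: cvgM; [exact: cvg_cst|exact: cvg_id].
Qed.

Let bound n x u : 0 < x -> 0 < u -> u ^+ n * expR (- (x * u)) <= n`!%:R / x ^+ n.
Proof.
move=> x0 u0; have f0 : 0 < n`!%:R :> R by rewrite ltr0n fact_gt0.
rewrite ler_pdivlMr ?exprn_gt0// expRN mulrAC -exprMn ler_pdivrMr ?expR_gt0//.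
rewrite -ler_pdivrMl// mulrC [u * x]mulrC.
have s0 : 0 <= x * u by rewrite mulr_ge0 ?ltW.
case: n f0 => [|n] f0; first by rewrite expr0 fact0 divr1 -expR0 ler_expR.
by apply: le_trans (expR_ge1Dxn n s0); rewrite lerDr.
Qed.

Let integrable_int n x : 0 < x ->
  M.-integrable P (EFin \o (fun u => u ^+ n * expR (- (x * u)))).
Proof.
move=> x0; apply: (@le_integrable _ _ _ _ _ measurable_posR _ (cst (n`!%:R / x ^+ n)%:E)).
- by apply/measurable_EFinP; exact: measurable_int.
- move=> u /posP u0; rewrite /= lee_fin ger0_norm ?mulr_ge0 ?exprn_ge0 ?expR_ge0 ?(ltW u0)//.
  rewrite ger0_norm ?bound// divr_ge0 ?exprn_ge0 ?(ltW x0)//.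
- exact: integrable_cst.
Qed.

Let is_derive_F n x : 0 < x -> is_derive x (1 : R) (F n) (- F n.+1 x).
Proof.
move=> x0; have x20 : 0 < x / 2 by rewrite divr_gt0.
pose G u := `|u| ^+ n.+1 * expR (- (x / 2 * u)).
pose g y u := u ^+ n * expR (- (y * u)).
have Ix : `](x / 2), (x * 2)[%classic x by rewrite /= in_itv/=; apply/andP; split; lra.
have I0 y : `](x / 2), (x * 2)[%classic y -> 0 < y /\ x / 2 <= y.
  by rewrite /= in_itv/= => /andP[h _]; split; [exact: lt_trans h|exact: ltW].
have dg y u : is_derive y (1 : R) (g ^~ u) (- (u ^+ n.+1 * expR (- (y * u)))).
  have d1 : is_derive y (1 : R) (fun y => - (y * u)) (- u).
    apply: is_deriveN; have := is_deriveM (is_derive_id y (1 : R)) (is_derive_cst u y (1 : R)).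
    by rewrite /GRing.scale/= mulr0 add0r mulr1.
  have d2 := @is_derive1_comp R expR (fun y => - (y * u)) y _ _ (is_derive_expR (- (y * u))) d1.
  have := is_deriveZ (u ^+ n) d2.
  have -> : (u ^+ n *: (expR (- (y * u)) * - u) : R) = - (u ^+ n.+1 * expR (- (y * u))).
    by rewrite /GRing.scale/= exprSr; ring.
  exact.
have intg y : `](x / 2), (x * 2)[%classic y -> M.-integrable P (EFin \o g y).
  by move=> /I0[y0 _]; exact: integrable_int.
have dgI y u : `](x / 2), (x * 2)[%classic y -> P u -> derivable (g ^~ u) y 1.
  by move=> _ _; have [] := dg y u.
have G0 u : 0 <= G u by rewrite mulr_ge0 ?exprn_ge0 ?expR_ge0.
have intG : M.-integrable P (EFin \o G).
  apply: (eq_integrable measurable_posR _ _ _ (integrable_int n.+1 x20)).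
  by move=> u /set_mem/posP u0; rewrite /= /G ger0_norm ?ltW.
have Gub y u : `](x / 2), (x * 2)[%classic y -> P u -> `|partial1of2 g y u| <= G u.
  move=> /I0[y0 xy] /posP u0; rewrite partial1of2E.
  have [_ ->] := dg y u.
  rewrite normrN normrM normrX (ger0_norm (expR_ge0 _)) /G ler_wpM2l ?exprn_ge0//.
  by rewrite ler_expR lerN2 ler_wpM2r ?(ltW u0).
have D := derivable_under_integral measurable_posR Ix intg dgI G0 intG Gub.
have E := differentiation_under_integral measurable_posR Ix intg dgI G0 intG Gub.
apply: DeriveDef; first exact: D.
rewrite -derive1E E -mulN1r -RintegralZl//; last exact: integrable_int.
apply: eq_Rintegral => u _; rewrite partial1of2E; have [_ ->] := dg x u.
by rewrite mulN1r.
Qed.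

(** The n-th derivative is (-1)^n times the integral of u^n e^(-x u), which is
    positive on the half-line. *)
Lemma laplace_strictly_completely_monotone f : M P != 0%E ->
  (forall x, 0 < x -> f x = \int[M]_(u in P) expR (- (x * u)))%R ->
  strictly_completely_monotone f.
Proof.
move=> M0 fE.
have dn n x : 0 < x -> derive1n n f x = (-1) ^+ n * F n x.
  elim: n x => [|n IH] x x0.
    by rewrite /= fE// mul1r /F; apply: eq_Rintegral => u _; rewrite expr0 mul1r.
  rewrite /= derive1E.
  have -> : 'D_1 (derive1n n f) x = 'D_1 (fun x => (-1) ^+ n * F n x) x.
    apply: near_eq_derive; near=> y; apply: IH.
    by near: y; exact: lt_nbhsr.
  have [_ ->] := is_deriveZ ((-1) ^+ n) (is_derive_F n x0).
  by rewrite /GRing.scale/= mulrN exprS mulN1r mulNr.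
split=> n x x0.
  have [d _] := is_deriveZ ((-1) ^+ n) (is_derive_F n x0).
  apply: near_eq_derivable d; near=> y; rewrite dn//.
  by near: y; exact: lt_nbhsr.
rewrite dn// mulrA -exprMn mulrNN mulr1 expr1n mul1r.
rewrite -lte_fin /F /Rintegral fineK; last exact: integrable_fin_num (integrable_int n x0).
apply: integral_gt0 => //.
- by apply/measurable_EFinP; exact: measurable_int.
- by move=> u /posP u0; rewrite lte_fin mulr_gt0 ?exprn_gt0 ?expR_gt0.
Unshelve. all: by end_near. Qed.

Lemma laplace_cvg0 f :
  (forall x, 0 < x -> f x = \int[M]_(u in P) expR (- (x * u)))%R ->
  f x @[x --> 0^'+] --> fine (M P).
Proof.
move=> fE; apply/cvg_at_rightP => v [v0 v1].
have MP : M P \is a fin_num by rewrite ge0_fin_numE.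
have E n : (f (v n))%:E = (\int[M]_(u in P) (u ^+ 0 * expR (- (v n * u)))%:E)%E.
  rewrite fE// /Rintegral; under eq_integral do rewrite -[expR _]mul1r.
  rewrite fineK//; exact: integrable_fin_num (integrable_int 0 (v0 n)).
have mn n : measurable_fun P (fun u : R => (u ^+ 0 * expR (- (v n * u)))%:E).
  by apply/measurable_EFinP; exact: measurable_int.
have mlim : measurable_fun P (fun u : R => 1%:E : \bar R) by exact: measurable_cst.
have cv : {ae M, forall u, P u -> (u ^+ 0 * expR (- (v n * u)))%:E @[n --> \oo] --> 1%:E}.
  apply: aeW => u _.
  have C : expR (- (v n * u)) @[n --> \oo] --> expR 0.
    apply: (@cvg_comp _ _ _ _ expR _ (nbhs (0 : R))); last exact: continuous_expR.
    by rewrite -oppr0 -(mul0r u); apply: cvgN; apply: cvgMl.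
  have C' : u ^+ 0 * expR (- (v n * u)) @[n --> \oo] --> (1 : R).
    by rewrite -expR0; under eq_fun do rewrite mul1r.
  by apply: cvg_EFin; [exact: nearW|exact: C'].
have dom : {ae M, forall u n, P u -> (`|(u ^+ 0 * expR (- (v n * u)))%:E| <= cst 1%:E u)%E}.
  apply: aeW => u n /posP u0; rewrite /= lee_fin mul1r ger0_norm ?expR_ge0// expR_le1.
  by rewrite oppr_le0 mulr_ge0 ?ltW.
have [_ _] := dominated_convergence measurable_posR mn mlim cv (integrable_cst 1) dom.
rewrite integral_cst// mul1e => H.
have H' : (f (v n))%:E @[n --> \oo] --> (fine (M P))%:E.
  by rewrite fineK//; under eq_fun do rewrite E.
exact: (fine_cvg H').
Qed.

End laplace_complete_monotonicity.

(** * Growth of completely monotone entire functions *)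
Section growth.
Context {R : realType}.
Implicit Types (x y z l : R).
Variables (phi : nat -> R -> R) (C q : R).
Hypothesis dphi : forall k x, is_derive x (1 : R) (phi k) (- phi k.+1 x).
Hypothesis q0 : 0 < q.
Hypothesis C0 : 0 <= C.
Hypothesis phi_bound : forall k x, `|phi k x| <= C * q ^+ k * expR (q * `|x|).

(** The Taylor polynomial at z = 0 of z |-> phi k (X - z). *)
Let T X K k z := \sum_(j < K) phi (k + j)%N X * (z ^+ j / j`!%:R).

Let is_derive_monomial j z : is_derive z (1 : R) (fun z => z ^+ j.+1 / j.+1`!%:R) (z ^+ j / j`!%:R).
Proof.
rewrite (_ : (fun z => _) = (fun z => j.+1`!%:R^-1 * z ^+ j.+1)); last first.
  by apply/funext => y; rewrite mulrC.
have dX : is_derive z (1 : R) (fun z : R => z ^+ j.+1) (j.+1%:R * z ^+ j).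
  have := is_deriveX j.+1 (is_derive_id z (1 : R)).
  by rewrite exprfctE /GRing.scale/= mulr1.
have -> : z ^+ j / j`!%:R = j.+1`!%:R^-1 * (j.+1%:R * z ^+ j).
  by rewrite factS natrM; field; rewrite nat1r !pnatr_eq0 -lt0n fact_gt0.
exact: (is_deriveZ (j.+1`!%:R^-1) dX).
Qed.

Let is_derive_T X K k z : is_derive z (1 : R) (T X K.+1 k) (T X K k.+1 z).
Proof.
elim: K => [|K IH].
  rewrite (_ : T X 1 k = cst (phi k X)); last first.
    by apply/funext => y; rewrite /T big_ord_recl big_ord0/= addn0 expr0 fact0 divr1 mulr1 addr0.
  by rewrite /T big_ord0; exact: is_derive_cst.
rewrite (_ : T X K.+2 k = T X K.+1 k \+ (fun z => phi (k + K.+1)%N X * (z ^+ K.+1 / K.+1`!%:R))); last first.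
  by apply/funext => y; rewrite /T big_ord_recr.
rewrite (_ : T X K.+1 k.+1 z = T X K k.+1 z + phi (k + K.+1)%N X * (z ^+ K / K`!%:R)).
  exact: (is_deriveD IH (is_deriveZ (phi (k + K.+1)%N X) (is_derive_monomial K z))).
by rewrite /T big_ord_recr/= addSnnS.
Qed.

Let le_of_derive (h g dh dg : R -> R) z : 0 <= z ->
  (forall y, is_derive y (1 : R) h (dh y)) -> (forall y, is_derive y (1 : R) g (dg y)) ->
  h 0 <= g 0 -> (forall y, 0 <= y <= z -> dh y <= dg y) -> h z <= g z.
Proof.
rewrite le_eqVlt => /predU1P[<-//|z0] h' g' hg0 dhg.
have d y : is_derive y (1 : R) (g \- h) (dg y - dh y) by exact: is_deriveB.
have [|c cz E] := @MVT R (g \- h) (fun y => dg y - dh y) 0 z z0.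
  apply: continuous_subspaceT => y.
  by have [? _] := d y; apply/differentiable_continuous/derivable1_diffP.
rewrite -subr_ge0 -[g z - h z]/((g \- h) z) -[X in 0 <= X](subrK ((g \- h) 0)) E.
rewrite addr_ge0 ?subr_ge0// mulr_ge0 ?subr_ge0 ?(ltW z0)// dhg//.
by move: cz; rewrite in_itv/= => /andP[/ltW-> /ltW->].
Qed.

(** Integrate phi_bound K times. *)
Let taylor X z K k : 0 <= X -> 0 <= z ->
  `|phi k (X - z) - T X K k z| <=
  C * q ^+ (k + K) * expR (q * (X + z)) * (z ^+ K / K`!%:R).
Proof.
move=> X0; move: {2}z (lexx z) => Z.
have dphiX n y : is_derive y (1 : R) (fun z => phi n (X - z)) (phi n.+1 (X - y)).
  have d1 : is_derive y (1 : R) (fun z => X - z) (- 1).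
    by have := is_deriveB (is_derive_cst X y (1 : R)) (is_derive_id y (1 : R)); rewrite sub0r.
  by have := @is_derive1_comp R (phi n) _ y _ _ (dphi n (X - y)) d1; rewrite mulrN1 opprK.
elim: K k z => [|K IH] k z zZ z0.
  rewrite addn0 /T big_ord0 subr0 expr0 fact0 divr1 mulr1.
  apply: (le_trans (phi_bound _ _)); rewrite ler_wpM2l ?mulr_ge0 ?exprn_ge0 ?(ltW q0)//.
  rewrite ler_expR ler_wpM2l ?(ltW q0)//; apply: (le_trans (ler_normB _ _)).
  by rewrite !ger0_norm.
set D := C * q ^+ (k + K.+1) * expR (q * (X + z)).
have D0 : 0 <= D by rewrite !mulr_ge0 ?exprn_ge0 ?expR_ge0 ?(ltW q0).
pose h y := phi k (X - y) - T X K.+1 k y.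
have dh y : is_derive y (1 : R) h (phi k.+1 (X - y) - T X K k.+1 y) by exact: is_deriveB.
pose g y := D * (y ^+ K.+1 / K.+1`!%:R).
have dg y : is_derive y (1 : R) g (D * (y ^+ K / K`!%:R)).
  exact: (is_deriveZ D (is_derive_monomial K y)).
have h0 : h 0 = 0.
  rewrite /h subr0 /T big_ord_recl/= addn0 expr0 fact0 divr1 mulr1 big1 ?addr0 ?subrr// => i _.
  by rewrite /bump/= expr0n/= mul0r mulr0.
have g0 : g 0 = 0 by rewrite /g expr0n/= mul0r mulr0.
have le y : 0 <= y <= z -> `|phi k.+1 (X - y) - T X K k.+1 y| <= D * (y ^+ K / K`!%:R).
  move=> /andP[y0 yz]; apply: (le_trans (IH k.+1 y (le_trans yz zZ) y0)).
  rewrite ler_wpM2r ?divr_ge0 ?exprn_ge0// /D addSnnS ler_wpM2l ?mulr_ge0 ?exprn_ge0 ?(ltW q0)//.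
  by rewrite ler_expR ler_wpM2l ?(ltW q0)// lerD2l.
rewrite -/(h z) -/(g z) ler_norml; apply/andP; split.
- rewrite lerNl; apply: (@le_of_derive (fun y => - h y) g _ _ z z0) => //.
  + by rewrite h0 g0 oppr0.
  + by move=> y /le; rewrite ler_norml => /andP[+ _]; rewrite lerNl.
- apply: (@le_of_derive h g _ _ z z0) => //.
  + by rewrite h0 g0.
  + by move=> y /le; rewrite ler_norml => /andP[].
Qed.

Let taylor_cvg X z k : 0 <= X -> 0 <= z -> T X K k z @[K --> \oo] --> phi k (X - z).
Proof.
move=> X0 z0.
have B : C * q ^+ k * expR (q * (X + z)) * exp_coeff (q * z) K @[K --> \oo] --> (0 : R).
  rewrite -[X in _ --> X](mulr0 (C * q ^+ k * expR (q * (X + z)))); apply: cvgMr.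
  exact: cvg_series_cvg_0 (is_cvg_series_exp_coeff (q * z)).
apply/cvgrPdist_le => e e0.
move/cvgrPdist_le : B => /(_ e e0); apply: filterS => K.
rewrite sub0r normrN => h; apply: le_trans h; apply: (le_trans (taylor K k X0 z0)).
apply: le_trans (ler_norm _); rewrite le_eqVlt; apply/orP; left; apply/eqP.
by rewrite /exp_coeff/= exprD exprMn; ring.
Qed.

Hypothesis phi_ge0 : forall k x, 0 < x -> 0 <= phi k x.
Hypothesis phi00 : 0 < phi 0 0.

(** Jensen's inequality for the weights phi k X * X^k / k! and the convex
    function k |-> e^(k l). *)
Let jensen X l : 0 < X -> 0 < l ->
  phi 0 0 * expR (X * (phi 1 0 / phi 0 0) * l) <= phi 0 (X - expR l * X).
Proof.
move=> X0 l0; set c := X * (phi 1 0 / phi 0 0).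
pose A := expR (c * l) * (1 - c * l); pose B := expR (c * l) * l.
have tangent (k : nat) : A + B * k%:R <= expR l ^+ k.
  rewrite -expRM_natl -[leRHS](_ : expR (c * l) * expR ((k%:R - c) * l) = _); last first.
    by rewrite -expRD; congr expR; ring.
  rewrite (_ : A + _ = expR (c * l) * (1 + (k%:R - c) * l)); last by rewrite /A /B; ring.
  by rewrite ler_wpM2l ?expR_ge0// expR_ge1Dx.
have fin K : A * T X K.+1 0 X + B * X * T X K 1 X <= T X K.+1 0 (expR l * X).
  rewrite -[B * X * _]mulrA.
  have -> : X * T X K 1 X = \sum_(k < K.+1) k%:R * (phi k X * (X ^+ k / k`!%:R)).
    rewrite big_ord_recl mul0r add0r mulr_sumr; apply: eq_bigr => k _.
    rewrite /= /bump/= add1n factS natrM exprS; field.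
    by rewrite nat1r !pnatr_eq0 -lt0n fact_gt0.
  rewrite /T !mulr_sumr -big_split/=; apply: ler_sum => k _.
  rewrite add0n exprMn.
  have w0 : 0 <= phi k X * (X ^+ k / k`!%:R).
    by rewrite mulr_ge0 ?phi_ge0// divr_ge0// exprn_ge0 ?(ltW X0).
  have -> : phi k X * (expR l ^+ k * X ^+ k / k`!%:R) =
    expR l ^+ k * (phi k X * (X ^+ k / k`!%:R)) by ring.
  by rewrite [B * _]mulrA -mulrDl ler_wpM2r.
have L0 := @taylor_cvg X X 0%N (ltW X0) (ltW X0).
have L1 := @taylor_cvg X X 1%N (ltW X0) (ltW X0).
have bX0 : 0 <= expR l * X by rewrite mulr_ge0 ?expR_ge0 ?(ltW X0).
have L2 := @taylor_cvg X _ 0%N (ltW X0) bX0.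
rewrite subrr in L0 L1.
rewrite -cvg_shiftS in L0; rewrite -cvg_shiftS in L2.
have L : A * T X K.+1 0 X + B * X * T X K 1 X @[K --> \oo] -->
    A * phi 0 0 + B * X * phi 1 0.
  by apply: cvgD; apply: cvgMr.
apply: le_trans (ler_cvg_to L L2 _); last by apply: nearW => K; exact: fin.
rewrite le_eqVlt; apply/orP; left; apply/eqP.
rewrite /A /B /c; field.
by rewrite gt_eqF.
Qed.

(** By Jensen's inequality phi 0 (- y) grows at least at the exponential rate
    phi 1 0 / phi 0 0, up to a factor tending to 1 as l tends to 0, whereas
    phi_bound allows at most the rate q. *)
Lemma completely_monotone_growth : phi 1 0 <= q * phi 0 0.
Proof.
rewrite -ler_pdivrMr//; set r := phi 1 0 / phi 0 0.
have rate l : 0 < l -> r * l <= q * (expR l - 1).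
  move=> l0; rewrite leNgt; apply/negP => lt.
  set d := r * l - q * (expR l - 1); have d0 : 0 < d by rewrite subr_gt0.
  have H X : 0 < X -> phi 0 0 * (1 + X * d) <= C.
    move=> X0; have el1 : 1 < expR l by rewrite expR_gt1.
    have xneg : X - expR l * X <= 0 by rewrite subr_le0 ler_peMl ?(ltW X0) ?(ltW el1).
    have := le_trans (jensen X0 l0) (le_trans (ler_norm _) (phi_bound 0 _)).
    rewrite expr0 mulr1 ler0_norm// -/r.
    rewrite (_ : expR (X * r * l) = expR (X * d) * expR (q * - (X - expR l * X))); last first.
      by rewrite -expRD; congr expR; rewrite /d; ring.
    rewrite mulrA ler_pM2r ?expR_gt0// => h; apply: le_trans h.
    by rewrite ler_pM2l//; exact: expR_ge1Dx.
  (* X is chosen so that phi 0 0 * (1 + X * d) = phi 0 0 + C + 1 *)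
  pose X := (C + 1) / (phi 0 0 * d).
  have pd0 : 0 < phi 0 0 * d by rewrite mulr_gt0.
  have X0 : 0 < X by rewrite divr_gt0// ltr_wpDl.
  have := H X X0; rewrite mulrDr mulr1 mulrCA /X divfK ?gt_eqF//.
  have := phi00; lra.
rewrite leNgt; apply/negP => qr; have r0 : 0 < r := lt_trans q0 qr.
(* then r * (1 - l) = (r + q) / 2 > q, while e^l - 1 <= l / (1 - l) *)
pose l := (r - q) / (2 * r).
have r20 : 0 < 2 * r by rewrite mulr_gt0.
have l0 : 0 < l by rewrite divr_gt0// subr_gt0.
have el := rate l l0.
have l1 : 1 - l = (r + q) / (2 * r) by rewrite /l; field; rewrite gt_eqF.
have e1 : 1 - l <= expR (- l) by have := expR_ge1Dx (- l).
have e0 := expR_gt0 l.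
have h1 : (1 - l) * expR l <= 1.
  apply: le_trans (ler_wpM2r (ltW e0) e1) _.
  by rewrite -expRD addNr expR0.
have h2 : r * (1 - l) <= q.
  have h3 : r * l * (1 - l) <= q * l.
    have l10 : 0 <= 1 - l by rewrite l1 divr_ge0 ?addr_ge0 ?ltW.
    apply: le_trans (ler_wpM2r l10 el) _.
    by rewrite -mulrA ler_wpM2l ?(ltW q0)//; lra.
  by rewrite -(ler_pM2r l0); lra.
move: h2; rewrite l1.
rewrite (_ : r * ((r + q) / (2 * r)) = (r + q) / 2); last by field; rewrite gt_eqF.
by lra.
Qed.

End growth.

(** * The Mittag-Leffler series *)
Section mittag_leffler.
Context {R : realType}.
Variables alpha beta gamma kappa : R.
Hypotheses (alpha0 : 0 < alpha) (beta0 : 0 < beta) (gamma0 : 0 < gamma) (kappa0 : 0 < kappa).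

(** The n-th moment that a measure with Laplace transform ML_series at - x must
    have. *)
Definition ML_moment n : R :=
  Gamma (gamma + kappa * n%:R) / (Gamma gamma * Gamma (beta + alpha * n%:R)).

Local Notation m := ML_moment.

Lemma ML_seriesE z : ML_series alpha beta gamma kappa z = egf m z.
Proof.
rewrite /ML_series /egf; congr (limn _); congr (series _); apply/funext => n.
by rewrite /egf_coef /m !invfM; ring.
Qed.

Let arg_gt0 (a b : R) n : 0 < a -> 0 < b -> 0 < a + b * n%:R.
Proof. by move=> a0 b0; rewrite ltr_pwDl// mulr_ge0// ltW. Qed.

Lemma ML_moment_gt0 n : 0 < m n.
Proof. by rewrite divr_gt0 ?mulr_gt0 ?Gamma_gt0 ?arg_gt0. Qed.

Let eventually_ge (a c : R) : 0 < c -> \forall n \near \oo, a <= c * n%:R.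
Proof.
move=> c0; have := nbhs_infty_ger (a / c); apply: filterS => n.
by rewrite ler_pdivrMr// mulrC.
Qed.

Let b' := beta - 1 - alpha.

Let v n := (gamma + kappa * n.+1%:R) `^ kappa / (b' + alpha * n.+1%:R) `^ alpha.

Let ML_moment_ratio : \forall n \near \oo, m n.+1 <= v n * m n.
Proof.
have := eventually_ge 1 alpha0; apply: filterS => n /= hn.
have y1 : 1 < beta + alpha * n%:R by have := beta0; lra.
have := Gamma_shift_le (arg_gt0 n gamma0 kappa0) (ltW kappa0).
have := Gamma_shift_ge y1 (ltW alpha0).
rewrite (_ : beta + alpha * n%:R - 1 = b' + alpha * n.+1%:R); last by rewrite -natr1 /b'; ring.
rewrite (_ : beta + alpha * n%:R + alpha = beta + alpha * n.+1%:R); last by rewrite -natr1; ring.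
rewrite (_ : gamma + kappa * n%:R + kappa = gamma + kappa * n.+1%:R); last by rewrite -natr1; ring.
have z0 : 0 < b' + alpha * n.+1%:R by rewrite -natr1 /b'; have := beta0; lra.
have p0 : 0 < (b' + alpha * n.+1%:R) `^ alpha by rewrite powR_gt0.
have G0 := Gamma_gt0 gamma0.
have G1 := Gamma_gt0 (arg_gt0 n beta0 alpha0).
have G2 := Gamma_gt0 (arg_gt0 n.+1 beta0 alpha0).
move=> h1 h2; rewrite /v /m ler_pdivrMr ?mulr_gt0//; apply: (le_trans h2).
set P := (_ + _) `^ kappa; set Q := (_ + _) `^ alpha in p0 h1 *.
have P0 : 0 <= P by rewrite powR_ge0.
rewrite -[leRHS](_ : P * Gamma (gamma + kappa * n%:R) *
   (Gamma (beta + alpha * n.+1%:R) / (Q * Gamma (beta + alpha * n%:R))) = _); last first.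
  by field; rewrite !gt_eqF.
rewrite ler_peMr ?mulr_ge0 ?(ltW (Gamma_gt0 _)) ?arg_gt0//.
by rewrite ler_pdivlMr ?mulr_gt0// mul1r.
Qed.

(** The ratios of consecutive moments are bounded by v, which tends to 1 for
    alpha = kappa and is O(n^(kappa - alpha)) otherwise. *)
Lemma ML_moment_geometric (q : R) : kappa <= alpha -> 0 < q -> (alpha = kappa -> 1 < q) ->
  exists2 D, 0 <= D & forall n, m n <= D * q ^+ n.
Proof.
rewrite le_eqVlt => /predU1P[ak q0 /(_ (esym ak)) q1|ka q0 _].
  pose u n : R := (gamma * harmonic n + alpha) / (b' * harmonic n + alpha).
  have u1 : u n @[n --> \oo] --> (1 : R).
    have L c : c * harmonic n + alpha @[n --> \oo] --> alpha.
      rewrite -[X in _ --> X]add0r -[X in _ --> X + _](mulr0 c).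
      by apply: cvgD; [apply: cvgMr; exact: cvg_harmonic|exact: cvg_cst].
    rewrite -(divff (lt0r_neq0 alpha0)); apply: cvgM => //.
    by apply: cvgV => //; exact: lt0r_neq0.
  apply: (ratio_geometric_bound _ _ (cvg_powR_1 alpha u1) q1 q0) => [n|].
    exact/ltW/ML_moment_gt0.
  near=> n; have h : m n.+1 <= v n * m n by near: n; exact: ML_moment_ratio.
  apply: (le_trans h); rewrite ler_pM2r ?ML_moment_gt0//.
  have N0 : 0 < n.+1%:R :> R by [].
  have z0 : 0 < b' + alpha * n.+1%:R.
    have hn : - b' <= alpha * n%:R by near: n; exact: eventually_ge.
    by rewrite -natr1; have := alpha0; lra.
  rewrite ler_pdivrMr ?powR_gt0// ak -powRM ?(ltW z0)//; last first.
    rewrite /u /harmonic/=.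
    rewrite (_ : _ / _ = (gamma + alpha * n.+1%:R) / (b' + alpha * n.+1%:R)); last first.
      by field; rewrite nat1r !gt_eqF.
    by rewrite divr_ge0 ?(ltW z0)// ltW// arg_gt0.
  rewrite (_ : u n * _ = gamma + alpha * n.+1%:R)//.
  by rewrite /u /harmonic/=; field; rewrite nat1r !gt_eqF.
have p0 : 0 < alpha - kappa by rewrite subr_gt0.
pose C := (alpha / 2) `^ (- (alpha - kappa)).
have L : C * n.+1%:R `^ (- (alpha - kappa)) @[n --> \oo] --> (0 : R).
  by rewrite -(mulr0 C); apply: cvgMr; exact: cvg_powR_natN.
apply: (ratio_geometric_bound _ _ L q0 q0) => [n|].
  exact/ltW/ML_moment_gt0.
near=> n; have h : m n.+1 <= v n * m n by near: n; exact: ML_moment_ratio.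
apply: (le_trans h); rewrite ler_pM2r ?ML_moment_gt0//.
have N0 : 0 < n.+1%:R :> R by [].
set y := b' + alpha * n.+1%:R.
have y2 : alpha / 2 * n.+1%:R <= y.
  have hn : - b' <= alpha / 2 * n%:R by near: n; apply: eventually_ge; rewrite divr_gt0.
  by rewrite /y -[n.+1%:R]natr1; have := alpha0; lra.
have a20 : 0 < alpha / 2 by rewrite divr_gt0.
have y0 : 0 < y by apply: lt_le_trans y2; rewrite mulr_gt0.
have yk : gamma + kappa * n.+1%:R <= y.
  have hn : gamma - b' <= (alpha - kappa) * n%:R by near: n; exact: eventually_ge.
  by rewrite /y -[n.+1%:R]natr1; have := alpha0; lra.
rewrite ler_pdivrMr ?powR_gt0//; apply: (@le_trans _ _ (y `^ kappa)).
  by rewrite ge0_ler_powR ?nnegrE ?(ltW kappa0) ?(ltW y0)// ltW// arg_gt0.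
rewrite -powRM ?(ltW a20)// !powRN.
rewrite (_ : y `^ alpha = y `^ (alpha - kappa) * y `^ kappa); last first.
  by rewrite -powRD ?subrK//; rewrite gt_eqF ?implybT.
rewrite mulrA ler_peMl ?powR_ge0// mulrC ler_pdivlMr ?mul1r; last first.
  by rewrite powR_gt0// mulr_gt0.
by rewrite ge0_ler_powR ?nnegrE ?(ltW p0) ?(ltW y0)// mulr_ge0// ltW.
Unshelve. all: end_near.
Qed.

Lemma entire_ML_moment : kappa <= alpha -> entire_coef m.
Proof.
move=> ka; have [//|//|D D0 H] := @ML_moment_geometric 2 ka _ _; first by rewrite ltr1n.
apply: (@entire_coef_geometric _ _ D 2) => // n.
by rewrite ger0_norm// ltW// ML_moment_gt0.
Qed.

Let phi k x := egf (fun n => m (n + k)%N) (- x).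

Let entire_shift k : kappa <= alpha -> entire_coef (fun n => m (n + k)%N).
Proof.
move=> ka; elim: k => [|k IH].
  by under eq_fun do rewrite addn0; exact: entire_ML_moment.
by under eq_fun do rewrite -addSnnS; exact: (entire_coef_shift IH).
Qed.

Let dphi k x : kappa <= alpha -> is_derive x (1 : R) (phi k) (- phi k.+1 x).
Proof.
move=> ka; have d := @is_derive_egf _ _ (- x) (entire_shift k ka).
have dN : is_derive x (1 : R) (-%R : R -> R) (- 1) by exact: is_deriveN.
have := @is_derive1_comp R _ _ x _ _ d dN; rewrite mulrN1.
congr (is_derive _ _ _ (- egf _ _)).
by apply/funext => n; rewrite addSnnS.
Qed.

Let E := realization alpha beta gamma kappa.

Let EE : kappa <= alpha -> E = phi 0.
Proof.
move=> ka; apply/funext => x; rewrite /E /realization ltNge ka/= ML_seriesE /phi.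
by congr (egf _ _); apply/funext => n; rewrite addn0.
Qed.

Let derive1n_phi k x : kappa <= alpha -> derive1n k (phi 0) x = (-1) ^+ k * phi k x.
Proof.
move=> ka; elim: k x => [|k IH] x; first by rewrite mul1r.
rewrite /= (_ : derive1n k (phi 0) = fun x => (-1) ^+ k * phi k x); last exact/funext.
rewrite derive1E.
have d := is_deriveZ ((-1) ^+ k) (dphi k x ka).
have := @derive_val _ _ _ _ _ _ _ d.
by rewrite /GRing.scale/= => ->; rewrite exprS mulrN mulN1r mulNr.
Qed.

(** Under complete monotonicity no ratio of consecutive moments exceeds the
    exponential type of the series, which is at most q. *)
Let moment_step q j : kappa <= alpha -> completely_monotone E ->
  0 < q -> (alpha = kappa -> 1 < q) -> m j.+1 <= q * m j.
Proof.
move=> ka [_ cm] q0 q1; have [D D0 H] := ML_moment_geometric ka q0 q1.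
have bound k x : `|phi (k + j)%N x| <= D * q ^+ j * q ^+ k * expR (q * `|x|).
  rewrite -(normrN x); apply: egf_geometric_bound; rewrite ?mulr_ge0 ?exprn_ge0 ?(ltW q0)// => n.
  rewrite ger0_norm; last by rewrite ltW// ML_moment_gt0.
  apply: le_trans (H _) _; rewrite -!mulrA ler_wpM2l// -!exprD le_eqVlt; apply/orP; left.
  by apply/eqP; congr (_ ^+ _); rewrite addnA addnC (addnC n).
have dphij k x : is_derive x (1 : R) (phi (k + j)%N) (- phi (k.+1 + j)%N x).
  by rewrite addSn; exact: dphi.
have phi_ge0 k x : 0 < x -> 0 <= phi (k + j)%N x.
  move=> x0; have := cm (k + j)%N x x0; rewrite EE// derive1n_phi//.
  by rewrite mulrA -exprMn mulrNN mulr1 expr1n mul1r.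
have phi0 k : phi k 0 = m k by rewrite /phi oppr0 egf0.
have DJ : 0 <= D * q ^+ j by rewrite mulr_ge0// exprn_ge0// ltW.
have := @completely_monotone_growth R (fun k => phi (k + j)%N) _ q dphij q0 DJ bound phi_ge0.
rewrite /= !phi0 add1n add0n; apply; exact: ML_moment_gt0.
Qed.

(** For alpha > kappa the series has type 0, whereas m 1 / m 0 > 0. For
    alpha = kappa it has type at most 1, so that the moments do not increase;
    but for beta < gamma they grow like n^(gamma - beta). *)
Lemma ML_completely_monotone : kappa <= alpha -> completely_monotone E ->
  alpha = kappa /\ gamma <= beta.
Proof.
move=> ka cm; have step := moment_step _ ka cm.
have ak : alpha = kappa.
  apply/eqP; rewrite eq_le ka andbT leNgt; apply/negP => lt.
  have m0 := ML_moment_gt0 0; have m1 := ML_moment_gt0 1.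
  pose q := m 1 / (2 * m 0).
  have q0 : 0 < q by rewrite divr_gt0// mulr_gt0.
  have q1 : alpha = kappa -> 1 < q by move=> e; move: lt; rewrite e ltxx.
  have := step q 0%N q0 q1.
  rewrite (_ : q * m 0 = m 1 / 2); last by rewrite /q; field; rewrite gt_eqF.
  by lra.
split => //; rewrite leNgt; apply/negP => bg.
have dec j : m j <= m 0.
  elim: j => // j IH; apply: le_trans IH; rewrite leNgt; apply/negP => lt.
  have mj := ML_moment_gt0 j.
  pose q := (1 + m j.+1 / m j) / 2.
  have q1 : 1 < q.
    by rewrite /q ltr_pdivlMr// mul1r -[2]/(1 + 1) ltrD2l ltr_pdivlMr// mul1r.
  have := step q j (lt_trans ltr01 q1) (fun=> q1).
  rewrite (_ : q * m j = (m j + m j.+1) / 2); last by rewrite /q; field; rewrite gt_eqF.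
  by lra.
have p0 : 0 < gamma - beta by rewrite subr_gt0.
have G0 := Gamma_gt0 gamma0.
pose c := (m 0 * Gamma gamma) `^ (gamma - beta)^-1.
have [N _ /(_ N (leqnn N)) hn] := eventually_ge (2 + c) kappa0; set n := N in hn.
have c0 : 0 <= c by rewrite powR_ge0.
have y1 : 1 < beta + kappa * n%:R by have := beta0; lra.
have := Gamma_shift_ge y1 (ltW p0).
rewrite (_ : beta + kappa * n%:R + (gamma - beta) = gamma + kappa * n%:R); last by ring.
move=> h; have := dec n; rewrite {1}/m ak ler_pdivrMr; last first.
  by rewrite mulr_gt0// Gamma_gt0// arg_gt0.
move=> /(le_trans h); rewrite mulrA ler_pM2r ?Gamma_gt0 ?arg_gt0// => h2.
have z0 : 0 <= beta + kappa * n%:R - 1 by lra.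
have i0 : 0 <= (gamma - beta)^-1 by rewrite invr_ge0 ltW.
have M0 : 0 <= m 0 * Gamma gamma by rewrite mulr_ge0 ?(ltW G0)// ltW// ML_moment_gt0.
have : ((beta + kappa * n%:R - 1) `^ (gamma - beta)) `^ (gamma - beta)^-1 <= c.
  by apply: ge0_ler_powR => //; rewrite nnegrE// powR_ge0.
rewrite -powRrM divff ?gt_eqF// powRr1//.
by have := beta0; lra.
Qed.

Lemma ML_realization0 : kappa <= alpha -> E 0 = (Gamma beta)^-1.
Proof.
move=> ka; rewrite EE// /phi oppr0 egf0 addn0 /m !mulr0 !addr0.
by field; rewrite !gt_eqF ?Gamma_gt0.
Qed.

End mittag_leffler.

(** * The Wright kernel and its sign *)
Section laplace_duality.
Context {R : realType}.
Implicit Types (x u s : R) (k : R -> R).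
Local Notation leb := (@lebesgue_measure R).
Local Notation T := (measurableTypeR R).
Local Notation P := (`]0%R, +oo[%classic : set T).

Let measurable_mul_expR x k : measurable_fun P k ->
  measurable_fun P (fun u => (expR (- (x * u)) * k u)%:E).
Proof.
move=> mk; apply/measurable_EFinP; apply: measurable_funM => //.
apply: measurable_pos => t t0; apply: continuous_comp; last exact: continuous_expR.
by apply: cvgN; apply: cvgM; [exact: cvg_cst|exact: cvg_id].
Qed.

(** The Laplace transform is self-adjoint, by Tonelli's theorem. *)
Lemma laplace_symmetric k1 k2 : measurable_fun P k1 -> measurable_fun P k2 ->
  (forall x, 0 < x -> 0 <= k1 x) -> (forall x, 0 < x -> 0 <= k2 x) ->
  (\int[leb]_(x in P) ((k1 x)%:E * \int[leb]_(u in P) (expR (- (x * u)) * k2 u)%:E) =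
   \int[leb]_(u in P) ((k2 u)%:E * \int[leb]_(x in P) (expR (- (u * x)) * k1 x)%:E))%E.
Proof.
move=> m1 m2 k10 k20.
pose a : T -> R := k1 \_ P; pose b : T -> R := k2 \_ P.
have ma : measurable_fun setT a by exact: (measurable_restrictT _ measurable_posR).1.
have mb : measurable_fun setT b by exact: (measurable_restrictT _ measurable_posR).1.
have a0 x : 0 <= a x.
  by rewrite /a patchE; case: ifPn => // /set_mem/posP/k10.
have b0 x : 0 <= b x.
  by rewrite /b patchE; case: ifPn => // /set_mem/posP/k20.
pose F (z : T * T) := (a z.1 * (expR (- (z.1 * z.2)) * b z.2))%:E.
have mF : measurable_fun setT F.
  apply/measurable_EFinP; apply: measurable_funM; first exact: measurableT_comp.
  apply: measurable_funM; last exact: measurableT_comp.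
  apply: measurableT_comp => //; apply: measurableT_comp => //.
  by apply: measurable_funM.
have F0 z : (0 <= F z)%E.
  rewrite lee_fin; apply: mulr_ge0; first exact: a0.
  by apply: mulr_ge0; [exact: expR_ge0|exact: b0].
have := fubini_tonelli (m1 := leb) (m2 := leb) F mF F0.
have on_P (k : R -> R) x : 0 < x -> (k \_ P) x = k x.
  by move=> x0; rewrite patchE mem_set//; exact/posP.
have off_P (k : R -> R) x : x \notin P -> (k \_ P) x = 0.
  by move=> x0; rewrite patchE (negbTE x0).
have step k1' k2' (f : T -> T -> R) : measurable_fun P k1' -> measurable_fun P k2' ->
    (forall x, 0 < x -> 0 <= k1' x) -> (forall x, 0 < x -> 0 <= k2' x) ->
    (forall x u, f x u = (k1' \_ P) x * (expR (- (x * u)) * (k2' \_ P) u)) ->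
    (\int[leb]_x \int[leb]_u (f x u)%:E =
     \int[leb]_(x in P) ((k1' x)%:E * \int[leb]_(u in P) (expR (- (x * u)) * k2' u)%:E))%E.
  move=> m1' m2' k1'0 k2'0 fE; rewrite [RHS]integral_mkcond.
  apply: eq_integral => x _; rewrite patchE; case: ifPn => xP; last first.
    by rewrite integral0_eq// => u _; rewrite fE off_P// mul0r.
  have x0 := (posP x).1 (set_mem xP).
  rewrite -(ge0_integralZl_EFin _ measurable_posR); last 3 first.
  - by move=> u /posP u0; rewrite lee_fin mulr_ge0 ?expR_ge0 ?k2'0.
  - exact: measurable_mul_expR.
  - exact: k1'0.
  rewrite [RHS]integral_mkcond; apply: eq_integral => u _.
  rewrite fE on_P// [in RHS]patchE; case: ifPn => uP; last by rewrite off_P// !mulr0.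
  by rewrite on_P//; exact/posP/set_mem.
rewrite (step k1 k2 (fun x u => a x * (expR (- (x * u)) * b u)))//.
rewrite (step k2 k1 (fun u x => a x * (expR (- (x * u)) * b u)))//.
by move=> u x; rewrite /a /b [u * x]mulrC; ring.
Qed.

Lemma measurable_laplace k : measurable_fun P k -> (forall x, 0 < x -> 0 <= k x) ->
  measurable_fun P (fun x : T => \int[leb]_(u in P) (expR (- (x * u)) * k u)%:E)%E.
Proof.
move=> mk k0; apply: measurable_funTS.
pose a : T -> R := k \_ P.
have ma : measurable_fun setT a by exact: (measurable_restrictT _ measurable_posR).1.
have a0 x : 0 <= a x.
  by rewrite /a patchE; case: ifPn => // /set_mem/posP/k0.
pose F (z : T * T) := (expR (- (z.1 * z.2)) * a z.2)%:E.
have mF : measurable_fun setT F.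
  apply/measurable_EFinP; apply: measurable_funM; last exact: measurableT_comp.
  apply: measurableT_comp => //; apply: measurableT_comp => //.
  by apply: measurable_funM.
have F0 z : (0 <= F z)%E.
  by rewrite lee_fin; apply: mulr_ge0; [exact: expR_ge0|exact: a0].
have := measurable_fun_fubini_tonelli_F (m2 := leb) F mF F0.
congr measurable_fun; apply/funext => x.
rewrite [RHS]integral_mkcond; apply: eq_integral => u _.
by rewrite /F /a !patchE/=; case: ifPn => //; rewrite mulr0.
Qed.

End laplace_duality.

Section power_substitution.
Context {R : realType}.
Implicit Types (x u s p : R) (h g : R -> R).
Local Notation leb := (@lebesgue_measure R).
Local Notation T := (measurableTypeR R).
Local Notation P := (`]0%R, +oo[%classic : set T).

Lemma integral_powR_subst p h g : 0 < p -> measurable_fun P h ->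
  (forall t : R, 0 < t -> h (t `^ p) * (p * t `^ (p - 1)) = g t) ->
  leb.-integrable P (EFin \o g) ->
  leb.-integrable P (EFin \o h) /\
  (\int[leb]_(u in P) (h u)%:E = \int[leb]_(t in P) (g t)%:E)%E.
Proof.
move=> p0 mh hg ig.
have mh' : measurable_fun P (EFin \o h) by exact/measurable_EFinP.
have J (t : R) : 0 < t -> 0 <= p * t `^ (p - 1).
  by move=> t0; rewrite mulr_ge0 ?powR_ge0 ?(ltW p0).
have step (c : R -> R) : (forall a b, 0 <= b -> c (a * b) = c a * b) -> (forall a, 0 <= c a) ->
    measurable_fun P (EFin \o (c \o h)) ->
    (\int[leb]_(u in P) (c (h u))%:E = \int[leb]_(t in P) (c (g t))%:E)%E.
  move=> cM c0 mc.
  rewrite -(@ge0_integral_powR_subst R 1 p (fun u => (c (h u))%:E) ltr01 p0 mc); last first.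
    by move=> y _; rewrite lee_fin.
  apply: eq_integral => t /set_mem/posP t0; rewrite !mul1r -EFinM -hg//.
  by rewrite cM// J.
split.
  apply/integrableP; split => //; have /integrableP[_] := ig.
  apply: le_lt_trans; rewrite le_eqVlt; apply/orP; left; apply/eqP.
  apply: (step Num.norm) => //.
    by move=> a b b0; rewrite normrM (ger0_norm b0).
  by apply/measurable_EFinP; exact: measurableT_comp.
rewrite integralE [RHS]integralE; congr (_ - _)%E.
  under eq_integral do rewrite funeposE -EFin_max.
  under [RHS]eq_integral do rewrite funeposE -EFin_max.
  apply: (step (fun a => Num.max a 0)) => [a b b0|a|].
  - by rewrite maxr_pMl// mul0r.
  - by rewrite le_max lexx orbT.
  by apply/measurable_EFinP; exact: measurable_maxr.
under eq_integral do rewrite funenegE -EFinN -EFin_max.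
under [RHS]eq_integral do rewrite funenegE -EFinN -EFin_max.
apply: (step (fun a => Num.max (- a) 0)) => [a b b0|a|].
- by rewrite maxr_pMl// mul0r mulNr.
- by rewrite le_max lexx orbT.
by apply/measurable_EFinP; apply: measurable_maxr => //; exact: measurableT_comp.
Qed.

End power_substitution.

Section kernel.
Context {R : realType}.
Implicit Types (x u s p : R) (h g : R -> R).
Local Notation leb := (@lebesgue_measure R).
Local Notation T := (measurableTypeR R).
Local Notation P := (`]0%R, +oo[%classic : set T).
Variables alpha beta gamma kappa : R.
Hypotheses (alpha0 : 0 < alpha) (beta0 : 0 < beta) (gamma0 : 0 < gamma) (kappa0 : 0 < kappa).
Hypothesis alpha_kappa : alpha < kappa.

Local Notation K := (kernelK alpha beta gamma kappa).

Let rho01 : 0 < alpha / kappa < 1.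
Proof. by rewrite divr_gt0// ltr_pdivrMr// mul1r. Qed.

Lemma continuous_kernelK u : 0 < u -> {for u, continuous K}.
Proof.
move=> u0; apply: cvgM.
  by apply: cvgM; [exact: continuous_powRl|exact: cvg_cst].
apply: (@continuous_comp _ _ _ (fun u => u `^ kappa^-1)
  (fun t => Wright (- (alpha / kappa)) (beta - alpha * gamma / kappa) (- t))).
  exact: continuous_powRl.
exact: continuous_wright.
Qed.

Lemma measurable_kernelK : measurable_fun P K.
Proof. by apply: measurable_pos => u; exact: continuous_kernelK. Qed.

(** The substitution u = t^kappa turns it into mellin_wright. *)
Lemma mellin_kernelK s : kappa * s < gamma ->
  leb.-integrable P (EFin \o (fun u => u `^ (- s) * K u)) /\
  (\int[leb]_(u in P) (u `^ (- s) * K u)%:E =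
   (Gamma (gamma - kappa * s) / (Gamma gamma * Gamma (beta - alpha * s)))%:E)%E.
Proof.
move=> sg; have z0 : 0 < gamma - kappa * s by rewrite subr_gt0.
have [I1 I2] := mellin_wright rho01 (beta - alpha * gamma / kappa) z0.
pose w t := t `^ (gamma - kappa * s - 1) *
  Wright (- (alpha / kappa)) (beta - alpha * gamma / kappa) (- t).
have G0 : Gamma gamma != 0 by rewrite gt_eqF// Gamma_gt0.
pose g t := (Gamma gamma)^-1 * w t.
have Ig : leb.-integrable P (EFin \o g).
  by have := integrableZl measurable_posR (Gamma gamma)^-1 I1.
have [|t t0|Ih Eh] := @integral_powR_subst R kappa (fun u => u `^ (- s) * K u) g kappa0 _ _ Ig.
- apply: measurable_funM; last exact: measurable_kernelK.
  by apply: measurable_pos => u; exact: continuous_powRl.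
- rewrite /g /w /kernelK -!powRrM mulfV ?gt_eqF// (powRr1 (ltW t0)).
  have t0' : (t == 0) = false by rewrite gt_eqF.
  rewrite (_ : t `^ (gamma - kappa * s - 1) = t `^ (kappa * - s) *
    t `^ (kappa * (gamma / kappa - 1)) * t `^ (kappa - 1)).
    by field; rewrite G0 gt_eqF.
  rewrite -!powRD ?t0' ?implybT//; congr (_ `^ _).
  by field; rewrite gt_eqF.
split => //; rewrite Eh.
have -> : (\int[leb]_(t in P) (g t)%:E = ((Gamma gamma)^-1)%:E * \int[leb]_(t in P) (w t)%:E)%E.
  by rewrite -(integralZl measurable_posR I1).
rewrite I2 -EFinM; congr EFin.
rewrite (_ : _ + alpha / kappa * _ = beta - alpha * s); last by field; rewrite gt_eqF.
by rewrite invfM; ring.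
Qed.

Lemma kernelK_gt0 u : alpha * gamma <= kappa * beta -> 0 < u -> 0 < K u.
Proof.
move=> agb u0; rewrite mulr_gt0 ?divr_gt0 ?powR_gt0 ?mulr_gt0 ?Gamma_gt0//.
rewrite wright_gt0 ?powR_gt0// subr_ge0 ler_pdivrMr//.
by rewrite [beta * _]mulrC.
Qed.

Lemma integrable_kernelK : leb.-integrable P (EFin \o K).
Proof.
have s0 : kappa * 0 < gamma by rewrite mulr0.
have [I _] := mellin_kernelK s0; apply: eq_integrable I => // u _.
by rewrite /= oppr0 powRr0 mul1r.
Qed.

Lemma integral_kernelK : (\int[leb]_(u in P) (K u)%:E = ((Gamma beta)^-1)%:E)%E.
Proof.
have s0 : kappa * 0 < gamma by rewrite mulr0.
have [_] := mellin_kernelK s0; rewrite !mulr0 !subr0.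
rewrite (_ : _ / _ = (Gamma beta)^-1); last by field; rewrite !gt_eqF ?Gamma_gt0.
by move=> <-; apply: eq_integral => u _; rewrite oppr0 powRr0 mul1r.
Qed.

Lemma integrable_expR_kernelK x : 0 <= x ->
  leb.-integrable P (EFin \o (fun u => expR (- (x * u)) * K u)).
Proof.
move=> x0; apply: (le_integrable measurable_posR _ _ integrable_kernelK).
  apply/measurable_EFinP; apply: measurable_pos => u u0.
  apply: cvgM; last exact: continuous_kernelK.
  apply: continuous_comp; last exact: continuous_expR.
  by apply: cvgN; apply: cvgM; [exact: cvg_cst|exact: cvg_id].
move=> u /posP u0; rewrite lee_fin normrM ler_piMl//.
by rewrite ger0_norm ?expR_ge0// expR_le1 oppr_le0 mulr_ge0// ltW.
Qed.

Local Notation E := (realization alpha beta gamma kappa).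

Lemma realization_kernelK x : 0 <= x ->
  ((E x)%:E = \int[leb]_(u in P) (expR (- (x * u)) * K u)%:E)%E.
Proof.
move=> x0; rewrite /realization alpha_kappa fineK//.
exact: (integrable_fin_num measurable_posR (integrable_expR_kernelK x0)).
Qed.

Let kpos u := Num.max (K u) 0.
Let kneg u : R := Num.max (- K u) 0.

(** Against x^(s-1) the positive and negative parts of the kernel are exchanged
    for their Mellin transforms, so that a nonnegative Laplace transform has a
    nonnegative Mellin transform. *)
Lemma mellin_kernelK_ge0 s : (forall x, 0 < x -> 0 <= E x) -> 0 < s -> kappa * s < gamma ->
  0 <= Gamma (gamma - kappa * s) / (Gamma gamma * Gamma (beta - alpha * s)).
Proof.
move=> E0 s0 sg; have [I1 I2] := mellin_kernelK sg.
have mK := measurable_kernelK.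
have mpos : measurable_fun P kpos by exact: measurable_maxr.
have mneg : measurable_fun P kneg by apply: measurable_maxr => //; exact: measurableT_comp.
have pos0 u : 0 <= kpos u by rewrite le_max lexx orbT.
have neg0 u : 0 <= kneg u by rewrite le_max lexx orbT.
have posM (c u : R) : 0 <= c -> maxe (c * K u)%:E 0%E = (c * kpos u)%:E.
  by move=> c0; rewrite -EFin_max /kpos maxr_pMr// mulr0.
have negM (c u : R) : 0 <= c -> maxe (- (c * K u)%:E)%E 0%E = (c * kneg u)%:E.
  by move=> c0; rewrite -EFinN -EFin_max /kneg maxr_pMr// mulr0 mulrN.
pose A (k : R -> R) x := (\int[leb]_(u in P) (expR (- (x * u)) * k u)%:E)%E.
have le x : 0 < x -> (A kneg x <= A kpos x)%E.
  move=> x0; have := E0 x x0; rewrite -lee_fin realization_kernelK ?(ltW x0)// integralE.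
  have J := integrable_expR_kernelK (ltW x0).
  rewrite sube_ge0; last first.
    by rewrite (integrable_fin_num measurable_posR (integrable_funepos measurable_posR J)) orbT.
  have -> : (\int[leb]_(u in P) (fun u => (expR (- (x * u)) * K u)%:E)^\- u = A kneg x)%E.
    by apply: eq_integral => u _; rewrite funenegE negM ?expR_ge0.
  have -> : (\int[leb]_(u in P) (fun u => (expR (- (x * u)) * K u)%:E)^\+ u = A kpos x)%E.
    by apply: eq_integral => u _; rewrite funeposE posM ?expR_ge0.
  by [].
have mpow : measurable_fun P (fun x : R => x `^ (s - 1)).
  by apply: measurable_pos => x; exact: continuous_powRl.
have dual (k : R -> R) : measurable_fun P k -> (forall u, 0 <= k u) ->
    (\int[leb]_(x in P) ((x `^ (s - 1))%:E * A k x) =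
     (Gamma s)%:E * \int[leb]_(u in P) (u `^ (- s) * k u)%:E)%E.
  move=> mk k0; rewrite (@laplace_symmetric R (fun x => x `^ (s - 1)) k)//; last first.
    by move=> x _; rewrite powR_ge0.
  rewrite -(ge0_integralZl_EFin _ measurable_posR); last 3 first.
  - by move=> u _; rewrite lee_fin mulr_ge0 ?powR_ge0.
  - apply/measurable_EFinP/measurable_funM => //.
    by apply: measurable_pos => x; exact: continuous_powRl.
  - by rewrite ltW// Gamma_gt0.
  apply: eq_integral => u /set_mem/posP u0; under eq_integral do rewrite mulrC.
  by rewrite integral_Gamma_scale// -!EFinM; congr EFin; ring.
have : (\int[leb]_(x in P) ((x `^ (s - 1))%:E * A kneg x) <=
        \int[leb]_(x in P) ((x `^ (s - 1))%:E * A kpos x))%E.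
  have A0 (k : R -> R) x : (forall u, 0 <= k u) -> (0 <= A k x)%E.
    by move=> k0; apply: integral_ge0 => u _; rewrite lee_fin mulr_ge0 ?expR_ge0.
  have mA (k : R -> R) : measurable_fun P k -> (forall u, 0 <= k u) ->
      measurable_fun P (fun x => ((x `^ (s - 1))%:E * A k x)%E).
    move=> mk k0; apply: emeasurable_funM; first exact/measurable_EFinP.
    by apply: measurable_laplace => // u _.
  apply: (ge0_le_integral _ measurable_posR).
  - by move=> x _; rewrite mule_ge0 ?lee_fin ?powR_ge0 ?A0.
  - exact: mA.
  - exact: mA.
  - by move=> x /posP x0; rewrite lee_wpmul2l ?lee_fin ?powR_ge0 ?le.
rewrite !dual// lee_pmul2l ?lte_fin ?Gamma_gt0// => h.
rewrite -lee_fin -I2 integralE sube_ge0; last first.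
  by rewrite (integrable_fin_num measurable_posR (integrable_funepos measurable_posR I1)) orbT.
move: h; congr (_ <= _)%E.
  by apply: eq_integral => u _; rewrite funenegE negM ?powR_ge0.
by apply: eq_integral => u _; rewrite funeposE posM ?powR_ge0.
Qed.

(** The Mellin transform of the kernel at s has the sign of Gamma (beta - alpha s),
    which is negative for beta - alpha s in ]-1, 0[; such s below gamma / kappa
    exist exactly when beta - alpha gamma / kappa < 0. *)
Lemma kernelK_completely_monotone : completely_monotone E -> alpha * gamma <= kappa * beta.
Proof.
move=> [_ cm]; rewrite leNgt; apply/negP => lt.
have E0 x : 0 < x -> 0 <= E x by move=> x0; have := cm 0%N x x0; rewrite mul1r.
pose mu := beta - alpha * gamma / kappa.
have mu0 : mu < 0.
  rewrite /mu subr_lt0 ltr_pdivlMr//; by rewrite mulrC.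
(* 0 < d < min (1, - mu) *)
pose d := - mu / (1 - mu).
have m1 : 0 < 1 - mu by lra.
have d0 : 0 < d by rewrite divr_gt0// oppr_gt0.
have d1 : d < 1 by rewrite ltr_pdivrMr// mul1r; lra.
have dmu : d < - mu by rewrite /d ltr_pdivrMr//; nra.
pose s := (beta + d) / alpha.
have s0 : 0 < s by rewrite divr_gt0// addr_gt0.
have sE : beta - alpha * s = - d by rewrite /s; field; rewrite gt_eqF.
have sg : kappa * s < gamma.
  rewrite /s mulrA ltr_pdivrMr//.
  have : alpha * gamma / kappa * kappa = alpha * gamma by rewrite divfK// gt_eqF.
  move: dmu; rewrite /mu; have := kappa0; nra.
have := mellin_kernelK_ge0 E0 s0 sg; rewrite leNgt => /negP; apply.
rewrite invfM mulrA pmulr_rlt0; last by rewrite divr_gt0// Gamma_gt0// subr_gt0.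
rewrite sE GammaV_rec mulNr oppr_lt0 divr_gt0// Gamma_gt0//; lra.
Qed.

End kernel.

(** * The beta kernel *)
Section beta_integral.
Context {R : realType}.
Implicit Types (x u v a b : R).
Local Notation leb := (@lebesgue_measure R).
Local Notation T := (measurableTypeR R).
Local Notation P := (`]0%R, +oo[%classic : set T).

(** Euler's beta integral on the half-line, from the symmetry of the Laplace
    transform for x^(a+b-1) e^(-x) and v^(a-1). *)
Lemma integral_beta a b : 0 < a -> 0 < b ->
  (\int[leb]_(v in P) (v `^ (a - 1) * (1 + v) `^ (- (a + b)))%:E =
   (Gamma a * Gamma b / Gamma (a + b))%:E)%E.
Proof.
move=> a0 b0; have ab0 : 0 < a + b by rewrite addr_gt0.
pose k1 x := x `^ (a + b - 1) * expR (- x); pose k2 v := v `^ (a - 1).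
have m1 : measurable_fun P k1.
  apply: measurable_pos => t t0; apply: cvgM; first exact: continuous_powRl.
  by apply: continuous_comp; [exact: cvgN|exact: continuous_expR].
have m2 : measurable_fun P k2 by apply: measurable_pos => t; exact: continuous_powRl.
have k10 x : 0 < x -> 0 <= k1 x by move=> _; rewrite mulr_ge0 ?powR_ge0 ?expR_ge0.
have k20 x : 0 < x -> 0 <= k2 x by move=> _; rewrite powR_ge0.
have := laplace_symmetric m1 m2 k10 k20.
have -> : (\int[leb]_(x in P) ((k1 x)%:E * \int[leb]_(u in P) (expR (- (x * u)) * k2 u)%:E) =
    (Gamma a * Gamma b)%:E)%E.
  rewrite EFinM -(integral_Gamma b0) -(ge0_integralZl_EFin _ measurable_posR); last 3 first.
  - by move=> t _; rewrite lee_fin mulr_ge0 ?powR_ge0 ?expR_ge0.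
  - by have /integrableP[] := integrable_gamma b0.
  - by rewrite ltW// Gamma_gt0.
  apply: eq_integral => x /set_mem/posP x0; under eq_integral do rewrite mulrC.
  rewrite integral_Gamma_scale// -!EFinM; congr EFin; rewrite /k1.
  have -> : x `^ (b - 1) = x `^ (a + b - 1) * x `^ (- a).
    by rewrite -powRD ?(gt_eqF x0) ?implybT//; congr (_ `^ _); ring.
  by ring.
have -> : (\int[leb]_(u in P) ((k2 u)%:E * \int[leb]_(x in P) (expR (- (u * x)) * k1 x)%:E) =
    (Gamma (a + b))%:E * \int[leb]_(v in P) (v `^ (a - 1) * (1 + v) `^ (- (a + b)))%:E)%E.
  rewrite -(ge0_integralZl_EFin _ measurable_posR); last 3 first.
  - by move=> t _; rewrite lee_fin mulr_ge0 ?powR_ge0.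
  - apply/measurable_EFinP; apply: measurable_pos => t t0; apply: cvgM; first exact: continuous_powRl.
    apply: (@continuous_comp _ _ _ (fun v => 1 + v) (fun t => t `^ (- (a + b)))).
      by apply: cvgD; [exact: cvg_cst|exact: cvg_id].
    by apply: continuous_powRl; rewrite addr_gt0.
  - by rewrite ltW// Gamma_gt0.
  apply: eq_integral => v /set_mem/posP v0.
  have c0 : 0 < 1 + v by rewrite addr_gt0.
  have -> : (\int[leb]_(x in P) (expR (- (v * x)) * k1 x)%:E =
      ((1 + v) `^ (- (a + b)) * Gamma (a + b))%:E)%E.
    rewrite -integral_Gamma_scale//; apply: eq_integral => x _; congr EFin.
    by rewrite /k1 mulrCA -expRD; congr (_ * expR _); ring.
  by rewrite -!EFinM; congr EFin; rewrite /k2; ring.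
set I := (\int[leb]_(v in P) _)%E => h; have G0 := Gamma_gt0 ab0.
have -> : (I = ((Gamma (a + b))^-1)%:E * ((Gamma (a + b))%:E * I))%E.
  by rewrite muleA -EFinM mulVf ?gt_eqF// mul1e.
by rewrite -h -EFinM; congr EFin; ring.
Qed.

End beta_integral.

Section kernel_eq.
Context {R : realType}.
Implicit Types (x u v : R).
Local Notation leb := (@lebesgue_measure R).
Local Notation T := (measurableTypeR R).
Local Notation P := (`]0%R, +oo[%classic : set T).
Local Notation I := (`]0%R, 1%R[%classic : set T).
Variables beta gamma kappa : R.
Hypotheses (gamma0 : 0 < gamma) (kappa0 : 0 < kappa) (gamma_beta : gamma < beta).

Local Notation K := (kernel_eq beta gamma kappa).

Let beta_gamma : 0 < beta - gamma. Proof. by rewrite subr_gt0. Qed.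

Lemma measurable_kernel_eq : measurable_fun [set: T] (K : T -> R).
Proof.
apply: measurable_funM; last by apply: measurable_indic; exact: measurable_itv.
apply: measurable_funM; last exact: measurable_cst.
apply: measurable_funM; first exact: measurable_powR.
apply: (measurableT_comp (measurable_powR _)).
by apply: measurable_funB => //; exact: measurable_powR.
Qed.

Lemma kernel_eq_ge0 u : 0 <= K u.
Proof.
rewrite /kernel_eq mulr_ge0 ?indicE// divr_ge0 ?mulr_ge0 ?powR_ge0 ?(ltW kappa0)//.
- by rewrite ltW// Gamma_gt0.
- by rewrite ltW// Gamma_gt0.
Qed.

Let off_unit u : 1 <= u -> K u = 0.
Proof.
move=> u1; rewrite /kernel_eq indicE memNset ?mulr0//=.
by rewrite in_itv/= => /andP[_]; rewrite ltNge u1.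
Qed.

(** The substitution u = (v / (1 + v))^kappa turns the moments into beta
    integrals. *)
Lemma moment_kernel_eq n :
  (\int[leb]_(u in P) (u ^+ n * K u)%:E = (ML_moment kappa beta gamma kappa n)%:E)%E.
Proof.
have D0 v : 0 < v -> 0 < 1 + v by move=> v0; rewrite addr_gt0.
have one_powR p : 1 = 1 `^ p :> R by rewrite powR1.
pose w v := v / (1 + v).
have w0 v : 0 < v -> 0 < w v by move=> v0; rewrite divr_gt0// D0.
have w1 v : 0 < v -> w v < 1 by move=> v0; rewrite ltr_pdivrMr ?D0// mul1r ltrDr.
have wC v : 0 < v -> 1 - w v = (1 + v)^-1.
  by move=> v0; rewrite /w; field; rewrite gt_eqF// D0.
pose F v := w v `^ kappa.
pose f v := kappa * w v `^ (kappa - 1) * ((1 + v) ^+ 2)^-1.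
pose G u := u `^ kappa^-1 * (1 - u `^ kappa^-1) `^ (- 1).
have dw v : 0 < v -> is_derive v (1 : R) w ((1 + v) ^+ 2)^-1.
  move=> v0; have v1 := D0 v v0.
  have d1 : is_derive v (1 : R) (fun v => 1 + v) 1.
    by have := is_deriveD (is_derive_cst (1 : R) v 1) (is_derive_id v (1 : R)); rewrite add0r.
  have d2 : is_derive v (1 : R) (fun v => (1 + v)^-1) (- (1 + v) ^- 2 *: 1).
    by apply: (@is_deriveV _ (fun v => 1 + v)) => //; rewrite gt_eqF.
  have := is_deriveM (is_derive_id v (1 : R)) d2.
  congr is_derive; rewrite /GRing.scale/=; field; rewrite gt_eqF//.
have f0 v : 0 < v -> 0 <= f v.
  by move=> v0; rewrite !mulr_ge0 ?powR_ge0 ?(ltW kappa0)// invr_ge0 exprn_ge0// ltW ?D0.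
have cw v : 0 < v -> {for v, continuous w}.
  by move=> v0; have [? _] := dw v v0; exact/differentiable_continuous/derivable1_diffP.
have cf v : 0 < v -> {for v, continuous f}.
  move=> v0; apply: cvgM; last first.
    apply: cvgV; first by rewrite expf_neq0// gt_eqF ?D0.
    apply: (@continuous_comp _ _ _ (fun v => 1 + v) (fun t => t ^+ 2)).
      by apply: cvgD; [exact: cvg_cst|exact: cvg_id].
    exact: exprn_continuous.
  apply: cvgM; first exact: cvg_cst.
  apply: (@continuous_comp _ _ _ w (fun t => t `^ (kappa - 1))); first exact: cw.
  by apply: continuous_powRl; exact: w0.
have dF v : 0 < v -> is_derive v (1 : R) F (f v).
  move=> v0; have := @is_derive1_comp R (fun t => t `^ kappa) w v _ _
    (is_derive_powR kappa (w0 v v0)) (dw v v0); exact.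
have incF u v : 0 < u -> u < v -> F u < F v.
  move=> u0 uv; have v0 := lt_trans u0 uv.
  rewrite gt0_ltr_powR ?nnegrE ?(ltW (w0 _ _))//.
  have : (1 + v)^-1 < (1 + u)^-1 by rewrite ltf_pV2 ?posrE ?D0// ltrD2l.
  by rewrite -!wC// ltrD2l ltrN2.
have iI : is_interval I by exact: interval_is_interval.
have IP : I `<=` P by move=> u /=; rewrite !in_itv/= andbT => /andP[].
have FI v : 0 < v -> I (F v).
  move=> v0; rewrite /= in_itv/= powR_gt0 ?w0//=.
  rewrite [X in _ < X](one_powR kappa) gt0_ltr_powR ?nnegrE ?ler01 ?w1//.
  by rewrite ltW// w0.
have GI u : I u -> 0 < G u /\ F (G u) = u.
  rewrite /= in_itv/= => /andP[u0 u1]; rewrite /G.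
  set t := u `^ kappa^-1.
  have t0 : 0 < t by rewrite powR_gt0.
  have t1 : t < 1.
    rewrite [X in _ < X](one_powR kappa^-1) gt0_ltr_powR ?nnegrE ?invr_gt0//.
    exact: ltW.
  have c0 : 0 < 1 - t by rewrite subr_gt0.
  rewrite powR_inv1 ?(ltW c0)//; split; first by rewrite divr_gt0.
  rewrite /F (_ : w _ = t).
    by rewrite /t -powRrM mulVf ?gt_eqF// powRr1// ltW.
  by rewrite /w; field; rewrite subrK oner_neq0 gt_eqF.
have mG : measurable_fun [set: T] (G : T -> T).
  apply: measurable_funM; first exact: measurable_powR.
  apply: (measurableT_comp (measurable_powR _)).
  by apply: measurable_funB => //; exact: measurable_powR.
pose h u := (u ^+ n * K u)%:E.
have mh : measurable_fun I (h : T -> \bar R).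
  apply/measurable_EFinP; apply: measurable_funTS; apply: measurable_funM.
    exact: measurable_funX.
  exact: measurable_kernel_eq.
have h0 u : I u -> (0 <= h u)%E.
  by rewrite /= in_itv/= => /andP[u0 _]; rewrite lee_fin mulr_ge0 ?exprn_ge0 ?(ltW u0) ?kernel_eq_ge0.
have mI : measurable I by exact: measurable_itv.
transitivity (\int[leb]_(u in I) h u)%E.
  rewrite integral_mkcond [RHS]integral_mkcond; apply: eq_integral => u _.
  rewrite !patchE; case: (pselect (I u)) => Iu.
    by rewrite !mem_set//; exact: IP.
  rewrite [in RHS]memNset//; case: ifPn => // /set_mem/posP u0.
  rewrite off_unit ?mulr0// leNgt; apply/negP => u1.
  by apply: Iu; rewrite /= in_itv/= u0.
rewrite -(ge0_change_of_variables f0 cf dF incF mI iI IP FI GI mG mh h0).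
set a := gamma + kappa * n%:R.
have a0 : 0 < a by rewrite ltr_pwDl// mulr_ge0// ltW.
have G0 := Gamma_gt0 gamma0; have Gb := Gamma_gt0 beta_gamma.
pose c := (Gamma gamma * Gamma (beta - gamma))^-1.
have c0 : 0 <= c by rewrite invr_ge0 mulr_ge0 ?ltW.
transitivity (\int[leb]_(v in P) (c%:E *
    (v `^ (a - 1) * (1 + v) `^ (- (a + (beta - gamma))))%:E))%E.
  apply: eq_integral => v /set_mem/posP v0; rewrite /h -!EFinM; congr EFin.
  have := FI v v0; rewrite /kernel_eq indicE => /mem_set ->; rewrite mulr1.
  have v1 := D0 v v0; have wv := w0 v v0.
  have -> : F v `^ kappa^-1 = w v.
    by rewrite /F -powRrM mulfV ?gt_eqF// powRr1// ltW.
  have E1 : F v ^+ n * F v `^ (gamma / kappa - 1) * w v `^ (kappa - 1) = w v `^ (a - 1).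
    rewrite -powR_mulrn ?powR_ge0// /F -!powRrM -!powRD ?(gt_eqF wv) ?implybT//.
    by congr (_ `^ _); rewrite /a; field; rewrite gt_eqF.
  have E2 : w v `^ (a - 1) = v `^ (a - 1) * (1 + v) `^ (- (a - 1)).
    rewrite /w powRM ?invr_ge0 ?(ltW v0) ?(ltW v1)//; congr (_ * _).
    by rewrite -powR_inv1 ?(ltW v1)// -powRrM mulN1r.
  have E3 : (1 - w v) `^ (beta - gamma - 1) * ((1 + v) ^+ 2)^-1 =
      (1 + v) `^ (- (beta - gamma + 1)).
    rewrite wC// -powR_mulrn ?(ltW v1)// -powRN -[(1 + v)^-1]powR_inv1 ?(ltW v1)//.
    rewrite -powRrM -powRD ?(gt_eqF v1) ?implybT//.
    by congr (_ `^ _); ring.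
  have E4 : (1 + v) `^ (- (a - 1)) * (1 + v) `^ (- (beta - gamma + 1)) =
      (1 + v) `^ (- (a + (beta - gamma))).
    by rewrite -powRD ?(gt_eqF v1) ?implybT//; congr (_ `^ _); ring.
  transitivity (c * (w v `^ (a - 1) *
    ((1 - w v) `^ (beta - gamma - 1) * ((1 + v) ^+ 2)^-1))).
    rewrite -E1 /f /c; have := exprn_gt0 2 v1; move: ((1 + v) ^+ 2) => z z0.
    by field; rewrite !gt_eqF.
  by rewrite E2 E3 -E4; ring.
rewrite (ge0_integralZl_EFin _ measurable_posR)//; last 2 first.
- by move=> v _; rewrite lee_fin mulr_ge0 ?powR_ge0.
- apply/measurable_EFinP; apply: measurable_pos => t t0; apply: cvgM.
    exact: continuous_powRl.
  apply: (@continuous_comp _ _ _ (fun v => 1 + v) (fun t => t `^ _)).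
    by apply: cvgD; [exact: cvg_cst|exact: cvg_id].
  by apply: continuous_powRl; exact: D0.
rewrite integral_beta// -EFinM; congr EFin; rewrite /ML_moment -/a /c.
rewrite (_ : a + (beta - gamma) = beta + kappa * n%:R); last by rewrite /a; ring.
field; rewrite !gt_eqF// Gamma_gt0//.
by rewrite ltr_pwDl ?mulr_ge0 ?(ltW kappa0)// (lt_trans gamma0).
Qed.

Lemma integrable_moment_kernel_eq n : leb.-integrable P (EFin \o (fun u => u ^+ n * K u)).
Proof.
apply/integrableP; split.
  apply/measurable_EFinP; apply: measurable_funTS; apply: measurable_funM.
    exact: measurable_funX.
  exact: measurable_kernel_eq.
have <- : (\int[leb]_(u in P) (u ^+ n * K u)%:E =
    \int[leb]_(u in P) `|(u ^+ n * K u)%:E|)%E.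
  apply: eq_integral => u /set_mem/posP u0.
  by rewrite /= ger0_norm// mulr_ge0 ?exprn_ge0 ?(ltW u0) ?kernel_eq_ge0.
by rewrite moment_kernel_eq ltry.
Qed.

(** The series is the exponential series of e^(-x u) integrated termwise; since
    the kernel lives on ]0, 1[, its terms are dominated by those of e^|x|. *)
Lemma realization_kernel_eq x :
  ((realization kappa beta gamma kappa x)%:E =
   \int[leb]_(u in P) (expR (- (x * u)) * K u)%:E)%E.
Proof.
have beta0 : 0 < beta := lt_trans gamma0 gamma_beta.
have em := entire_ML_moment kappa0 beta0 gamma0 kappa0 (lexx kappa).
rewrite /realization ltxx ML_seriesE.
set m := ML_moment _ _ _ _.
pose S N u := series (exp_coeff (- (x * u))) N * K u.
have intS N : leb.-integrable P (fun u => (S N u)%:E) /\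
    (\int[leb]_(u in P) (S N u)%:E = (series (egf_coef m (- x)) N)%:E)%E.
  elim: N => [|N [I E]].
    rewrite /series/= !big_geq//; split.
      rewrite (_ : (fun u => _) = cst 0%E); first exact: integrable0.
      by apply/funext => u; rewrite /S /series/= big_geq// mul0r.
    by rewrite integral0_eq// => u _; rewrite /S /series/= big_geq// mul0r.
  have J := integrableZl measurable_posR ((- x) ^+ N / N`!%:R) (integrable_moment_kernel_eq N).
  have SS : (fun u => (S N.+1 u)%:E) =
      (fun u => (S N u)%:E + ((- x) ^+ N / N`!%:R)%:E * (u ^+ N * K u)%:E)%E.
    apply/funext => u; rewrite /S /series/= big_nat_recr//= -EFinM -EFinD; congr EFin.
    by rewrite /exp_coeff/= -mulNr exprMn; ring.
  rewrite SS; split; first exact: (integrableD measurable_posR I J).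
  rewrite (integralD measurable_posR I J) E (integralZl measurable_posR (integrable_moment_kernel_eq N)).
  rewrite moment_kernel_eq -EFinM -EFinD /series/= big_nat_recr//=; congr EFin.
  by rewrite /egf_coef -/m; ring.
have mS N : measurable_fun P (fun u => (S N u)%:E) by have [/integrableP[]] := intS N.
have mK : measurable_fun P K by apply: measurable_funTS; exact: measurable_kernel_eq.
have mlim : measurable_fun P (fun u => (expR (- (x * u)) * K u)%:E).
  apply/measurable_EFinP; apply: measurable_funM => //.
  apply: measurable_pos => t t0; apply: continuous_comp; last exact: continuous_expR.
  by apply: cvgN; apply: cvgM; [exact: cvg_cst|exact: cvg_id].
have cv : {ae leb, forall u, P u -> (S N u)%:E @[N --> \oo] --> (expR (- (x * u)) * K u)%:E}.
  apply: aeW => u _; apply: cvg_EFin; first exact: nearW.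
  by apply: cvgMl; exact: is_cvg_series_exp_coeff.
have dom : {ae leb, forall u N, P u ->
    (`|(S N u)%:E| <= (expR `|x|)%:E * (u ^+ 0 * K u)%:E)%E}.
  apply: aeW => u N /posP u0; rewrite -EFinM lee_fin mul1r /S normrM (ger0_norm (kernel_eq_ge0 u)).
  have [u1|u1] := leP 1 u; first by rewrite off_unit// !mulr0.
  rewrite ler_wpM2r ?kernel_eq_ge0//.
  have xu : `|- (x * u)| <= `|x| by rewrite normrN normrM (gtr0_norm u0) ler_piMr// ltW.
  apply: (@le_trans _ _ (series (exp_coeff `|x|) N)); last first.
    apply: nondecreasing_cvgn_le (is_cvg_series_exp_coeff `|x|) N.
    apply: nondecreasing_series => k _ _; rewrite /exp_coeff/=.
    by rewrite divr_ge0 ?exprn_ge0.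
  rewrite /series/=; apply: (le_trans (ler_norm_sum _ _ _)); apply: ler_sum => k _.
  rewrite /exp_coeff/= normrM normfV normr_nat ler_wpM2r ?invr_ge0// normrX.
  by rewrite lerXn2r ?nnegrE.
have intc := integrableZl measurable_posR (expR `|x|) (integrable_moment_kernel_eq 0).
have [_ _] := dominated_convergence measurable_posR mS mlim cv intc dom.
under eq_fun do rewrite (intS _).2.
have L : (series (egf_coef m (- x)) N)%:E @[N --> \oo] --> (egf m (- x))%:E.
  by apply: cvg_EFin; [exact: nearW|exact: is_cvg_egf].
by move=> L'; exact: (cvg_unique _ L L').
Qed.

End kernel_eq.

(** * Bernstein measures *)
Section bernstein.
Context {R : realType}.
Implicit Types (x u c : R) (f k : R -> R).
Local Notation leb := (@lebesgue_measure R).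
Local Notation T := (measurableTypeR R).
Local Notation P := (`]0%R, +oo[%classic : set T).

Lemma completely_monotoneW f : strictly_completely_monotone f -> completely_monotone f.
Proof. by move=> [fs f0]; split => // n x x0; exact/ltW/f0. Qed.

Let measurable_expN (D : set T) x : measurable_fun D (fun u : R => (expR (- (x * u)))%:E).
Proof.
apply: measurable_funTS; apply/measurable_EFinP; apply: measurableT_comp => //.
by apply: measurableT_comp => //; exact: measurable_funM.
Qed.

(** Every admissible case follows from a Laplace representation on ]0, +oo[ by a
    nonzero finite measure. *)
Lemma positive_bernstein_measure f (M : {measure set T -> \bar R}) c :
  0 < c -> M `]-oo, 0%R]%classic = 0%E -> M P = c%:E ->
  (forall x, 0 < x -> ((f x)%:E = \int[M]_(u in P) (expR (- (x * u)))%:E)%E) ->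
  [/\ strictly_completely_monotone f, bernstein_measure f M,
      M `[0%R, +oo[%classic = c%:E & f x @[x --> 0^'+] --> c].
Proof.
move=> c0 M0 MP fE.
have m0 : measurable ([set 0] : set T) by exact: measurable_set1.
have mD : measurable (`[0%R, +oo[%classic : set T) by exact: measurable_itv.
have mN : measurable (`]-oo, 0%R]%classic : set T) by exact: measurable_itv.
have M1 : M [set 0] = 0%E.
  by apply: (subset_measure0 m0 mN _ M0) => u ->; rewrite /= in_itv/= lexx.
have DP : `[0%R, +oo[%classic `\` [set 0] = P.
  apply/seteqP; split => u /=; rewrite !in_itv/= !andbT.
    by move=> [u0 /eqP u1]; rewrite lt_neqAle eq_sym u1.
  by move=> u0; split; [exact: ltW|apply/eqP; rewrite gt_eqF].
have fE' x : 0 < x -> f x = \int[M]_(u in P) expR (- (x * u)).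
  by move=> x0; rewrite /Rintegral -fE.
have fin : (M P < +oo)%E by rewrite MP ltry.
have fl : laplace_represents f M.
  split.
    apply: (subset_measure0 _ mN _ M0); first exact: measurable_itv.
    by move=> u /=; rewrite !in_itv/=; exact: ltW.
  move=> x x0; rewrite fE// -DP; apply/esym/ge0_negligible_integral => //.
split.
- by apply: (laplace_strictly_completely_monotone fin) => //; rewrite MP gt_eqF// lte_fin.
- by split => // N fN; exact: laplace_unique fN fl.
- rewrite -MP; apply/eqP; rewrite eq_le; apply/andP; split.
    have -> : `[0%R, +oo[%classic = P `|` [set 0] :> set T.
      by rewrite -DP setUC setDUK// => u ->; rewrite /= in_itv/= lexx.
    by rewrite -[M P]adde0 -M1; apply: measureU2 => //; exact: measurable_posR.
  by rewrite le_measure ?inE// -DP; exact: subDsetl.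
- by have := laplace_cvg0 fin fE'; rewrite MP.
Qed.

Lemma density_bernstein_measure f k c : 0 < c -> measurable_fun P k ->
  (forall u, 0 < u -> 0 <= k u) -> (\int[leb]_(u in P) (k u)%:E = c%:E)%E ->
  (forall x, 0 < x -> ((f x)%:E = \int[leb]_(u in P) (expR (- (x * u)) * k u)%:E)%E) ->
  exists M : {measure set T -> \bar R}, has_density_pos M k /\
  [/\ strictly_completely_monotone f, bernstein_measure f M,
      M `[0%R, +oo[%classic = c%:E & f x @[x --> 0^'+] --> c].
Proof.
move=> c0 mk k0 kc fE; pose g : T -> R := k \_ P.
have mg : measurable_fun setT g by exact: (measurable_restrictT _ measurable_posR).1.
have g0 u : 0 <= g u by rewrite /g patchE; case: ifPn => // /set_mem/posP/k0.
pose M := density_measure leb mg g0.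
have ME (A : set T) : (M A = \int[leb]_(u in A `&` P) (k u)%:E)%E.
  rewrite integral_mkcondr; apply: eq_integral => u _.
  by rewrite /g !patchE; case: ifPn.
exists M; split; first by split => // A _; exact: ME.
apply: positive_bernstein_measure => //.
- rewrite [LHS]ME (_ : _ `&` _ = set0) ?integral_set0//.
  apply/seteqP; split => u //=; rewrite !in_itv/= andbT => -[].
  by rewrite leNgt => /negP.
- by rewrite [LHS]ME setIid.
move=> x x0; rewrite fE// ge0_integral_density//.
apply: eq_integral => u uP.
by rewrite -EFinM /g patchE uP.
Qed.

End bernstein.

Section dirac.
Context {R : realType}.
Variables gamma kappa : R.
Hypotheses (gamma0 : 0 < gamma) (kappa0 : 0 < kappa).
Local Notation T := (measurableTypeR R).
Local Notation P := (`]0%R, +oo[%classic : set T).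

Lemma realization_exp (x : R) : realization kappa gamma gamma kappa x = expR (- x) / Gamma gamma.
Proof.
rewrite /realization ltxx ML_seriesE.
rewrite (_ : ML_moment kappa gamma gamma kappa = fun n => (Gamma gamma)^-1 * 1 + 0 * 1).
  by rewrite egf_lin ?egf1; [ring|exact: entire_coef1..].
apply/funext => n; rewrite /ML_moment mul0r addr0 mulr1; field.
by rewrite !gt_eqF// Gamma_gt0// ltr_pwDl// mulr_ge0// ltW.
Qed.

Lemma dirac_bernstein_measure : exists M : {measure set T -> \bar R},
  (forall A, measurable A -> M A = (((Gamma gamma)^-1)%:E * \d_(1%R : T) A)%E) /\
  [/\ strictly_completely_monotone (realization kappa gamma gamma kappa),
      bernstein_measure (realization kappa gamma gamma kappa) M,
      M `[0%R, +oo[%classic = ((Gamma gamma)^-1)%:E &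
      realization kappa gamma gamma kappa x @[x --> 0^'+] --> (Gamma gamma)^-1].
Proof.
have G0 : 0 < (Gamma gamma)^-1 by rewrite invr_gt0 Gamma_gt0.
pose M := mscale (NngNum (ltW G0)) (\d_(1%R : T)).
have ME A : M A = (((Gamma gamma)^-1)%:E * \d_(1%R : T) A)%E by [].
have P1 : (\d_(1%R : T) P = 1%E :> \bar R).
  by rewrite diracE mem_set//=; exact/posP.
exists M; split => //; apply: positive_bernstein_measure => //.
- by rewrite [LHS]ME diracE memNset ?mule0//= in_itv/= leNgt ltr01.
- by rewrite [LHS]ME P1 mule1.
move=> x x0; have mf : measurable_fun P (fun u : R => (expR (- (x * u)))%:E).
  apply: measurable_funTS; apply/measurable_EFinP; apply: measurableT_comp => //.
  by apply: measurableT_comp => //; exact: measurable_funM.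
rewrite ge0_integral_mscale//.
rewrite integral_dirac//.
by rewrite P1 mul1e mulr1 realization_exp EFinM muleC.
Qed.

End dirac.

(** * The characterization *)
Unset Implicit Arguments.

Theorem theorem2 (R : realType) (alpha beta gamma kappa : R)
    (alpha_gt0 : 0 < alpha) (beta_gt0 : 0 < beta)
    (gamma_gt0 : 0 < gamma) (kappa_gt0 : 0 < kappa) :
  let mu := beta - alpha * gamma / kappa in
  let E := realization alpha beta gamma kappa in
  (completely_monotone E <->
     (alpha <= kappa /\ alpha * gamma <= kappa * beta)) /\
  (alpha <= kappa -> alpha * gamma <= kappa * beta ->
     strictly_completely_monotone E /\
     (exists M : {measure set (measurableTypeR R) -> \bar R},
        bernstein_measure E M /\
        (alpha < kappa -> 0 <= mu ->
           has_density_pos M (kernelK alpha beta gamma kappa) /\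
           (forall u : R, 0 < u -> 0 < kernelK alpha beta gamma kappa u)) /\
        (alpha = kappa -> gamma < beta ->
           has_density_pos M (kernel_eq beta gamma kappa)) /\
        (alpha = kappa -> beta = gamma ->
           (forall A : set (measurableTypeR R), measurable A ->
              M A = (((Gamma gamma)^-1)%:E * \d_(1%R : measurableTypeR R) A)%E) /\
           (forall x : R, 0 <= x -> E x = expR (- x) / Gamma gamma)) /\
        M (`[0%R, +oo[%classic) = ((Gamma beta)^-1)%:E) /\
     E x @[x --> 0^'+] --> (Gamma beta)^-1 /\
     E 0 = (Gamma beta)^-1).
Proof.
move=> mu E.
have Gb : 0 < (Gamma beta)^-1 by rewrite invr_gt0 Gamma_gt0.
set admissible := (alpha <= kappa -> _).
suff adm : admissible.
  split => //; split => [cm|[ak mu0]]; last first.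
    by apply: completely_monotoneW; have [] := adm ak mu0.
  have [ak|ka] := ltP alpha kappa.
    split; first exact: ltW.
    exact: (kernelK_completely_monotone alpha_gt0 beta_gt0 gamma_gt0 kappa_gt0 ak cm).
  have [-> gb] := ML_completely_monotone alpha_gt0 beta_gt0 gamma_gt0 kappa_gt0 ka cm.
  by rewrite ler_pM2l.
rewrite /admissible => + mu0; rewrite le_eqVlt => /predU1P[ak|ak].
  have E0 : E 0 = (Gamma beta)^-1 by apply: ML_realization0; rewrite ?ak.
  move: mu0; rewrite ak ler_pM2l// le_eqVlt => /predU1P[gb|gb].
    have [M [MA [scm bM tot lim]]] := dirac_bernstein_measure gamma_gt0 kappa_gt0.
    rewrite /E ak -gb in E0 *; split => //; split => //.
    exists M; split => //; split; first by rewrite ltxx.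
    split; first by rewrite ltxx.
    split => //.
    by move=> _ _; split => // x _; exact: realization_exp.
  have [||||M [MK [scm bM tot lim]]] := @density_bernstein_measure R E
    (kernel_eq beta gamma kappa) (Gamma beta)^-1 Gb.
  - by apply: measurable_funTS; exact: measurable_kernel_eq.
  - by move=> u _; exact: kernel_eq_ge0.
  - have := moment_kernel_eq gamma_gt0 kappa_gt0 gb 0.
    under eq_integral do rewrite mul1r.
    move=> ->; congr EFin; rewrite /ML_moment !mulr0 !addr0; field.
    by rewrite !gt_eqF ?Gamma_gt0.
  - by move=> x _; rewrite /E ak; exact: realization_kernel_eq.
  split => //; split => //; exists M; split => //; split; first by rewrite ltxx.
  split; first by [].
  by split => // _ bg; move: gb; rewrite bg ltxx.
have K0 := kernelK_gt0 alpha_gt0 gamma_gt0 kappa_gt0 ak mu0.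
have EK x : 0 <= x -> ((E x)%:E =
    \int[lebesgue_measure]_(u in (`]0%R, +oo[%classic : set (measurableTypeR R)))
      (expR (- (x * u)) * kernelK alpha beta gamma kappa u)%:E)%E.
  exact: realization_kernelK.
have IK : (\int[lebesgue_measure]_(u in (`]0%R, +oo[%classic : set (measurableTypeR R)))
    (kernelK alpha beta gamma kappa u)%:E = ((Gamma beta)^-1)%:E)%E.
  exact: integral_kernelK.
have [||||M [MK [scm bM tot lim]]] := @density_bernstein_measure R E
  (kernelK alpha beta gamma kappa) (Gamma beta)^-1 Gb.
- exact: measurable_kernelK.
- by move=> u u0; rewrite ltW// K0.
- exact: IK.
- by move=> x x0; exact/EK/ltW.
have ak' : alpha <> kappa by move=> e; move: ak; rewrite e ltxx.
split => //; split; first by exists M.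
split => //; apply: EFin_inj; rewrite EK// -IK.
by apply: eq_integral => u _; rewrite mul0r oppr0 expR0 mul1r.
Qed.
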